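(* Let $\alpha>0$. For $\theta\in\mathbb{H}$ with $|\theta|\le 1$, the transform $\widetilde{\mathcal{L}_\theta^\alpha}=\mathcal{A}^{-1}\,\Gamma_\theta\,\mathcal{A}$ defines a continuous integral transform from $L^{2,\alpha}_{\mathbb{H}}(\mathbb{R}^+)$ onto $L^{2,\alpha}_{\mathbb{H}}(\mathbb{R}^+)$ with norm not exceeding $1$. For $|\theta|=1$, we have $$\langle\widetilde{\mathcal{L}_\theta^\alpha}\varphi,\widetilde{\mathcal{L}_\theta^\alpha}\psi\rangle_\alpha=\langle\varphi,\psi\rangle_\alpha\qquad\text{for all }\varphi,\psi\in L^{2,\alpha}_{\mathbb{H}}(\mathbb{R}^+).$$
   Context: $\mathbb{H}$ denotes the quaternions, $\mathbb{B}=\{q\in\mathbb{H}:|q|<1\}$, $\mathbb{R}^+=(0,\infty)$. For $\alpha>0$, $L^{2,\alpha}_{\mathbb{H}}(\mathbb{R}^+)$ is the right quaternionic Hilbert space of functions $\varphi:\mathbb{R}^+\to\mathbb{H}$ square integrable with respect to the inner product $\langle\varphi,\psi\rangle_\alpha=\int_0^\infty\overline{\varphi(x)}\,\psi(x)\,x^\alpha e^{-x}\,dx$. The slice hyperholomorphic Bergman space of second kind is $$A^{2,\alpha}_{slice}(\mathbb{B})=\Big\{f(q)=\sum_{n=0}^\infty q^nc_n:\ c_n\in\mathbb{H},\ \sum_{n=0}^\infty\frac{n!}{\Gamma(\alpha+n+1)}|c_n|^2<\infty\Big\},$$ with inner product $\langle f,g\rangle=\int_{\mathbb{B}_I}\overline{f(z)}\,g(z)\,(1-|z|^2)^{\alpha-1}\,dx\,dy$,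 where $z=x+Iy$, $\mathbb{B}_I=\mathbb{B}\cap(\mathbb{R}+I\mathbb{R})$ and $I\in\mathbb{H}$ with $I^2=-1$ (the value does not depend on $I$). The second Bargmann transform $\mathcal{A}:L^{2,\alpha}_{\mathbb{H}}(\mathbb{R}^+)\to A^{2,\alpha}_{slice}(\mathbb{B})$, $$(\mathcal{A}\varphi)(q)=\frac{1}{\sqrt{\pi\Gamma(\alpha)}\,(1-q)^{\alpha+1}}\int_0^\infty\exp\Big(\frac{tq}{q-1}\Big)\varphi(t)\,t^\alpha e^{-t}\,dt,$$ is known to be a unitary isometry onto, with inverse $\mathcal{A}^{-1}$. For $\theta\in\mathbb{H}$ and $f(q)=\sum_{n=0}^\infty q^nc_n\in A^{2,\alpha}_{slice}(\mathbb{B})$, the action $\Gamma_\theta$ is $\Gamma_\theta f(q)=\sum_{n=0}^\infty q^n\theta^nc_n$.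
   Formalization: ''Onto'' is proved only for |θ|=1 (for |θ|<1 it is false, e.g. for θ=0 the range is the constants; there only ''into'' is claimed), and ''integral transform'' with an absolutely convergent kernel on all of L² is proved only for |θ|<1 (it fails for |θ|=1, e.g. for θ=1, the identity). *)

(* Defs.v *)
From HB Require Import structures.
From mathcomp Require Import all_boot all_order all_algebra.
From mathcomp Require Import ring lra.
From mathcomp Require Import all_classical all_reals all_analysis.

Set Implicit Arguments.
Unset Strict Implicit.
Unset Printing Implicit Defensive.
Import Order.TTheory GRing.Theory Num.Theory.
Import numFieldNormedType.Exports.

Local Open Scope classical_set_scope.
Local Open Scope ring_scope.

Record quat (R : Type) : Type :=
  Quat { qre : R; qi : R; qj : R; qk : R }.
Arguments qre {R} q.
Arguments qi {R} q.
Arguments qj {R} q.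
Arguments qk {R} q.

Definition quat_tuple (R : Type) (q : quat R) : R * R * R * R :=
  (qre q, qi q, qj q, qk q).
Definition tuple_quat (R : Type) (t : R * R * R * R) : quat R :=
  Quat t.1.1.1 t.1.1.2 t.1.2 t.2.

Lemma quat_tupleK (R : Type) : cancel (@quat_tuple R) (@tuple_quat R).
Proof. by case. Qed.

HB.instance Definition _ (R : choiceType) :=
  Choice.copy (quat R) (can_type (@quat_tupleK R)).

Section QuatAlgebra.
Variable R : realType.
Local Notation H := (quat R).
Implicit Types p q r : H.

Definition qzero : H := Quat 0 0 0 0.
Definition qone : H := Quat 1 0 0 0.
Definition qopp q : H := Quat (- qre q) (- qi q) (- qj q) (- qk q).
Definition qadd p q : H :=
  Quat (qre p + qre q) (qi p + qi q) (qj p + qj q) (qk p + qk q).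
Definition qscale (a : R) q : H :=
  Quat (a * qre q) (a * qi q) (a * qj q) (a * qk q).
Definition qmul p q : H :=
  Quat (qre p * qre q - qi p * qi q - qj p * qj q - qk p * qk q)
       (qre p * qi q + qi p * qre q + qj p * qk q - qk p * qj q)
       (qre p * qj q - qi p * qk q + qj p * qre q + qk p * qi q)
       (qre p * qk q + qi p * qj q - qj p * qi q + qk p * qre q).
Definition qconj q : H := Quat (qre q) (- qi q) (- qj q) (- qk q).
Definition qsqn q : R := qre q ^+ 2 + qi q ^+ 2 + qj q ^+ 2 + qk q ^+ 2.
Definition qnorm q : R := Num.sqrt (qsqn q).
Definition qinv q : H :=
  if q == qzero then q else qscale (qsqn q)^-1 (qconj q).

Lemma qaddA : associative qadd.
Proof. by move=> p q r; congr Quat; rewrite addrA. Qed.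
Lemma qaddC : commutative qadd.
Proof. by move=> p q; congr Quat; rewrite addrC. Qed.
Lemma qadd0 : left_id qzero qadd.
Proof. by case=> *; congr Quat; rewrite add0r. Qed.
Lemma qaddN : left_inverse qzero qopp qadd.
Proof. by case=> *; congr Quat; rewrite addNr. Qed.

HB.instance Definition _ := GRing.isZmodule.Build H qaddA qaddC qadd0 qaddN.

Lemma qmulA : associative qmul.
Proof. by move=> p q r; congr Quat; rewrite /=; ring. Qed.
Lemma qmul1l : left_id qone qmul.
Proof. by case=> *; congr Quat; rewrite /=; ring. Qed.
Lemma qmul1r : right_id qone qmul.
Proof. by case=> *; congr Quat; rewrite /=; ring. Qed.
Lemma qmulDl : left_distributive qmul qadd.
Proof. by move=> p q r; congr Quat; rewrite /=; ring. Qed.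
Lemma qmulDr : right_distributive qmul qadd.
Proof. by move=> p q r; congr Quat; rewrite /=; ring. Qed.
Lemma qone_neq0 : qone != 0 :> H.
Proof. by apply/eqP => -[] /eqP; rewrite oner_eq0. Qed.

HB.instance Definition _ :=
  GRing.Zmodule_isNzRing.Build H qmulA qmul1l qmul1r qmulDl qmulDr qone_neq0.

Lemma qscaleA (a b : R) q : qscale a (qscale b q) = qscale (a * b) q.
Proof. by congr Quat; rewrite /= mulrA. Qed.
Lemma qscale1 : left_id 1 qscale.
Proof. by case=> *; congr Quat; rewrite mul1r. Qed.
Lemma qscaleDr : right_distributive qscale +%R.
Proof. by move=> a p q; congr Quat; rewrite /= mulrDr. Qed.
Lemma qscaleDl q : {morph qscale^~ q : a b / a + b}.
Proof. by move=> a b; congr Quat; rewrite /= mulrDl. Qed.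

HB.instance Definition _ :=
  GRing.Zmodule_isLmodule.Build R H qscaleA qscale1 qscaleDr qscaleDl.

Lemma qscaleAl (a : R) p q : a *: (p * q) = (a *: p) * q.
Proof. by congr Quat; rewrite /=; ring. Qed.
Lemma qscaleAr (a : R) p q : a *: (p * q) = p * (a *: q).
Proof. by congr Quat; rewrite /=; ring. Qed.

HB.instance Definition _ := GRing.Lmodule_isLalgebra.Build R H qscaleAl.
HB.instance Definition _ := GRing.Lalgebra_isAlgebra.Build R H qscaleAr.

Lemma qsqn_ge0 q : 0 <= qsqn q.
Proof. by rewrite !addr_ge0 ?sqr_ge0. Qed.

Lemma qsqn_eq0 q : (qsqn q == 0) = (q == 0).
Proof.
apply/idP/eqP => [|->]; last by rewrite /qsqn /= expr0n /= !addr0.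
rewrite /qsqn !paddr_eq0 ?addr_ge0 ?sqr_ge0// !sqrf_eq0.
by case: q => a b c d /= /andP[/andP[/andP[/eqP-> /eqP->] /eqP->] /eqP->].
Qed.

Lemma qmulVq : {in [pred q | q != 0 :> H], left_inverse 1 qinv *%R}.
Proof.
move=> q; rewrite inE /qinv => q0; rewrite (negbTE q0).
have n0 : qsqn q != 0 by rewrite qsqn_eq0.
by congr Quat; move: n0; rewrite /qsqn /=; case: q {q0} => a b c d /= n0;
  field.
Qed.

Lemma qmulqV : {in [pred q | q != 0 :> H], right_inverse 1 qinv *%R}.
Proof.
move=> q; rewrite inE /qinv => q0; rewrite (negbTE q0).
have n0 : qsqn q != 0 by rewrite qsqn_eq0.
by congr Quat; move: n0; rewrite /qsqn /=; case: q {q0} => a b c d /= n0;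
  field.
Qed.

Lemma qunitP p q : q * p = 1 /\ p * q = 1 -> p != 0.
Proof.
case=> qp _; apply/eqP => p0; move: qp; rewrite p0 mulr0 => /esym/eqP.
by rewrite oner_eq0.
Qed.

Lemma qinv_out : {in [predC [pred q | q != 0 :> H]], qinv =1 id}.
Proof. by move=> q; rewrite !inE negbK /qinv => ->. Qed.

HB.instance Definition _ :=
  GRing.NzRing_hasMulInverse.Build H qmulVq qmulqV qunitP qinv_out.

Lemma qnormD p q : qnorm (p + q) <= qnorm p + qnorm q.
Proof.
rewrite -ler_sqr ?nnegrE ?addr_ge0 ?sqrtr_ge0//.
rewrite sqrrD !sqr_sqrtr ?qsqn_ge0// -sqrtrM ?qsqn_ge0//.
pose s := qre p * qre q + qi p * qi q + qj p * qj q + qk p * qk q.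
have -> : qsqn (p + q) = qsqn p + s *+ 2 + qsqn q.
  by rewrite /qsqn /s /=; ring.
rewrite lerD2r lerD2l lerMn2r /=; apply: le_trans (ler_norm _) _.
rewrite -sqrtr_sqr ler_wsqrtr// -subr_ge0.
have -> : qsqn p * qsqn q - s ^+ 2 =
    (qre p * qi q - qi p * qre q) ^+ 2 + (qre p * qj q - qj p * qre q) ^+ 2 +
    (qre p * qk q - qk p * qre q) ^+ 2 + (qi p * qj q - qj p * qi q) ^+ 2 +
    (qi p * qk q - qk p * qi q) ^+ 2 + (qj p * qk q - qk p * qj q) ^+ 2.
  by rewrite /qsqn /s; ring.
by rewrite !addr_ge0 ?sqr_ge0.
Qed.

Lemma qnormZ (a : R) q : qnorm (a *: q) = `|a| * qnorm q.
Proof.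
rewrite -sqrtr_sqr -sqrtrM ?sqr_ge0//; congr Num.sqrt.
by rewrite /qsqn /=; ring.
Qed.

Lemma qnorm_eq0 q : qnorm q = 0 -> q = 0.
Proof.
by move/eqP; rewrite sqrtr_eq0 => q0; apply/eqP; rewrite -qsqn_eq0 eq_le q0
  qsqn_ge0.
Qed.

HB.instance Definition _ :=
  Lmodule_isNormed.Build R H qnormD qnormZ qnorm_eq0.

End QuatAlgebra.

Section QuatFunctions.
Variable R : realType.
Local Notation H := (quat R).

Definition qim (q : H) : H := Quat 0 (qi q) (qj q) (qk q).

(* The exponential in the slice of q: exp (x + I y) = e^x (cos y + I sin y)
   with y = |Im q| and I = Im q / |Im q|; since 0^-1 = 0, the vector part is 0
   when q is real. *)
Definition qexp (q : H) : H :=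
  expR (qre q) *:
    ((cos `|qim q|)%:A + (sin `|qim q| / `|qim q|) *: qim q).

(* Principal logarithm, meaningful off the half-line ]-oo, 0]; it is only used
   at 1 - q with `|q| < 1, whose real part is positive. *)
Definition qlog (q : H) : H :=
  (ln `|q|)%:A + (acos (qre q / `|q|) / `|qim q|) *: qim q.

Definition qpow (q : H) (s : R) : H := qexp (s *: qlog q).

Definition qmeasurable (D : set R) (f : R -> H) : Prop :=
  [/\ measurable_fun D (qre \o f), measurable_fun D (qi \o f),
      measurable_fun D (qj \o f) & measurable_fun D (qk \o f)].

Definition qintegrable (D : set R) (f : R -> H) : Prop :=
  let mu := @lebesgue_measure R in
  [/\ mu.-integrable D (EFin \o (qre \o f)), mu.-integrable D (EFin \o (qi \o f)),
      mu.-integrable D (EFin \o (qj \o f)) & mu.-integrable D (EFin \o (qk \o f))].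

Definition qintegral (D : set R) (f : R -> H) : H :=
  let mu := @lebesgue_measure R in
  Quat (\int[mu]_(x in D) qre (f x)) (\int[mu]_(x in D) qi (f x))
       (\int[mu]_(x in D) qj (f x)) (\int[mu]_(x in D) qk (f x)).

End QuatFunctions.

Section Spaces.
Variable R : realType.
Local Notation H := (quat R).
Local Notation mu := (@lebesgue_measure R).
Implicit Types (alpha : R) (phi psi : R -> H) (f g : H -> H) (c : nat -> H).

Definition Rpos : set R := [set x | 0 < x].

Definition weight alpha (x : R) : R := x `^ alpha * expR (- x).

Definition Gamma (s : R) : R :=
  \int[mu]_(x in Rpos) (x `^ (s - 1) * expR (- x)).

(* Elements of L^2 are represented by functions on R of which only the values
   on Rpos matter; two of them are identified when they agree a.e. there. *)
Definition aeq phi psi : Prop := {ae mu, forall x, Rpos x -> phi x = psi x}.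

Definition L2 alpha phi : Prop :=
  qmeasurable Rpos phi /\
  mu.-integrable Rpos (EFin \o (fun x => `|phi x| ^+ 2 * weight alpha x)).

Definition ip alpha phi psi : H :=
  qintegral Rpos (fun x => weight alpha x *: (qconj (phi x) * psi x)).

Definition L2norm alpha phi : R := Num.sqrt (qre (ip alpha phi phi)).

Definition right_linear alpha (T : (R -> H) -> R -> H) : Prop :=
  forall phi psi (l : H), L2 alpha phi -> L2 alpha psi ->
    aeq (T (fun x => phi x + psi x * l)) (fun x => T phi x + T psi x * l).

Definition L2_continuous alpha (T : (R -> H) -> R -> H) : Prop :=
  forall phi, L2 alpha phi -> forall e : R, 0 < e ->
    exists2 d : R, 0 < d & forall psi, L2 alpha psi ->
      L2norm alpha (fun x => psi x - phi x) < d ->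
      L2norm alpha (fun x => T psi x - T phi x) < e.

Definition opnorm alpha (T : (R -> H) -> R -> H) : \bar R :=
  ereal_sup [set (L2norm alpha (T phi))%:E |
             phi in [set phi | L2 alpha phi /\ L2norm alpha phi <= 1]].

Definition kernel_operator alpha (T : (R -> H) -> R -> H) : Prop :=
  exists K : R -> R -> H,
    [/\ measurable_fun setT (fun xy : R * R => qre (K xy.1 xy.2)),
        measurable_fun setT (fun xy : R * R => qi (K xy.1 xy.2)),
        measurable_fun setT (fun xy : R * R => qj (K xy.1 xy.2)) &
        measurable_fun setT (fun xy : R * R => qk (K xy.1 xy.2))] /\
    forall phi, L2 alpha phi -> {ae mu, forall x, Rpos x ->
      qintegrable Rpos (fun y => weight alpha y *: (K x y * phi y)) /\
      T phi x = qintegral Rpos (fun y => weight alpha y *: (K x y * phi y))}.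

Definition qball : set H := [set q | `|q| < 1].

(* f(q) = sum_n q^n c_n on the unit ball. *)
Definition expands f c : Prop :=
  forall q, qball q -> series (fun n => q ^+ n * c n) @ \oo --> f q.

Definition bergman alpha f : Prop :=
  exists2 c, expands f c &
    cvgn (series (fun n => n`!%:R / Gamma (alpha + n%:R + 1) * `|c n| ^+ 2)).

Definition coeffs f : nat -> H := xget (fun=> 0) [set c | expands f c].

Definition Gamma_act (theta : H) f : H -> H :=
  fun q => limn (series (fun n => q ^+ n * theta ^+ n * coeffs f n)).

Definition bargmann alpha phi : H -> H := fun q =>
  (Num.sqrt (pi * Gamma alpha))^-1 *:
    ((qpow (1 - q) (alpha + 1))^-1 *
     qintegral Rpos
       (fun t => weight alpha t *: (qexp (t *: (q / (q - 1))) * phi t))).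

(* The preimage of g in L^2, unique up to a.e. equality. *)
Definition bargmann_inv alpha g : R -> H :=
  xget (fun=> 0) [set phi | L2 alpha phi /\ {in qball, bargmann alpha phi =1 g}].

Definition Ltilde alpha (theta : H) phi : R -> H :=
  bargmann_inv alpha (Gamma_act theta (bargmann alpha phi)).

End Spaces.

(* Main.v *)
Require Import Defs.
From mathcomp Require Import all_boot all_order all_algebra.
From mathcomp Require Import ring lra.
From mathcomp Require Import complex.
From mathcomp Require Import all_classical all_reals all_analysis measurable_realfun.

Set Implicit Arguments.
Unset Strict Implicit.
Unset Printing Implicit Defensive.
Import Order.TTheory GRing.Theory Num.Theory.
Import numFieldNormedType.Exports.
Local Open Scope classical_set_scope.
Local Open Scope ring_scope.

(** The normalized generalized Laguerre polynomials [e n] form an orthonormal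
    basis of the square integrable functions for the weight [x ^ alpha * exp (- x)],
    and the Bargmann kernel is their generating function. The transform of
    [phi] is therefore the power series with coefficients
    [bargmann_scale * sqrt (laguerre_sqn n) *: c n], where [c n] is the [n]-th
    coefficient of [phi] in the basis ([bargmann_expands]). The action of
    [theta] multiplies Taylor coefficients by [theta ^+ n] on the left and the
    other factor is real, so the conjugated operator is the diagonal operator
    that sends [c n] to [theta ^+ n * c n] ([Ltilde_spec]).

    Everything is read off from this diagonal form. Since [|theta| <= 1], each
    coefficient can only decrease in norm, and Parseval's identity gives the bound on
    the norm, hence continuity. If [|theta| = 1], the inverse of [theta ^+ n] is its
    conjugate, so that inner products are preserved and every sequence of
    coefficients is reached. If [|theta| < 1], the operator has the kernel
    [sum_n e n x * e n y * theta ^+ n]. The [e n] are real, so quaternion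
    valued functions can be expanded one component at a time.

    The facts on Laguerre polynomials come from three sources.
    - Orthogonality and norms: the polynomials are eigenvectors of a second order
      differential operator which integration by parts shows to be symmetric.
    - The generating function ([laguerre_generating_function]): its partial sums
      solve, up to two boundary terms, the first order equation of the closed form.
      The three term recurrence makes the polynomials grow subexponentially in the
      degree, so the boundary terms tend to [0] on the disc. A quaternion lies in a
      copy of the complex plane, which transfers the formula to quaternions.
    - Totality ([laguerre_on_total]): by the generating function a function
      orthogonal to all of them is orthogonal to every [exp (- s x)], hence to the
      indicator functions of half-lines, which are limits of the functions
      [1 - exp (- exp (N * (a - x)))].

    Series of functions are summed almost everywhere when their norms are
    summable ([wL2_series_ae]); this gives the Riesz-Fischer theorem, and lets
    pointwise series such as the Bargmann kernel be integrated term by term. *)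

(** * Measurable limits *)

(** The upper limit is measurable without restriction to the set where the sequence
    converges, and agrees with the limit there. *)
Definition esup_limit (T : Type) (R : realType) (u : nat -> T -> R) (x : T) : R :=
  fine (limn_esup (fun n => (u n x)%:E)).

Lemma measurable_esup_limit d (T : measurableType d) (R : realType) (D : set T)
    (u : nat -> T -> R) :
  (forall n, measurable_fun D (u n)) -> measurable_fun D (esup_limit u).
Proof.
move=> mu; apply: measurableT_comp => //.
by apply: measurable_fun_limn_esup => n; exact/measurable_EFinP.
Qed.

Lemma esup_limit_cvg (T : Type) (R : realType) (u : nat -> T -> R) x (l : R) :
  u n x @[n --> \oo] --> l -> esup_limit u x = l.
Proof.
move=> ul; have ul' : (u n x)%:E @[n --> \oo] --> l%:E.
  by apply: cvg_EFin => //; exact: nearW.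
by rewrite /esup_limit is_cvg_limn_esupE ?(cvg_lim _ ul')//; apply/cvg_ex; exists l%:E.
Qed.

(** * Real square integrable functions for a weight *)

Section WeightedL2.
Context d (T : measurableType d) (R : realType).
Variables (mu : {measure set T -> \bar R}) (D : set T) (w : T -> R).
Hypotheses (mD : measurable D) (mw : measurable_fun D w).
Hypothesis w_gt0 : forall x, D x -> 0 < w x.
Implicit Types f g h : T -> R.

Definition wL2 f : Prop :=
  measurable_fun D f /\ mu.-integrable D (EFin \o (fun x => f x ^+ 2 * w x)).

Definition wip f g : R := \int[mu]_(x in D) (f x * g x * w x).

Definition wnorm f : R := Num.sqrt (wip f f).

Let w_ge0 x : D x -> 0 <= w x. Proof. by move=> /w_gt0/ltW. Qed.

Lemma wL2_integrable f g : wL2 f -> wL2 g ->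
  mu.-integrable D (EFin \o (fun x => f x * g x * w x)).
Proof.
move=> [mf If] [mg Ig]; have Ifg := integrableD mD If Ig.
apply: le_integrable Ifg => //.
  by apply/measurable_EFinP; do 2 apply: measurable_funM => //.
move=> x Dx /=; rewrite lee_fin -mulrDl !normrM ler_wpM2r//.
rewrite [leRHS]ger0_norm ?addr_ge0 ?sqr_ge0// -[f x ^+ 2]real_normK ?num_real//.
rewrite -[g x ^+ 2]real_normK ?num_real//.
have := sqr_ge0 (`|f x| - `|g x|); have := sqr_ge0 `|f x|; have := sqr_ge0 `|g x|.
by set a := `|f x|; set b := `|g x|; nra.
Qed.

Lemma wL2D f g : wL2 f -> wL2 g -> wL2 (fun x => f x + g x).
Proof.
move=> Lf Lg; split; first by apply: measurable_funD; [case: Lf | case: Lg].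
have I1 := integrableD mD (wL2_integrable Lf Lf) (wL2_integrable Lg Lg).
have I2 := integrableD mD (wL2_integrable Lf Lg) (wL2_integrable Lg Lf).
apply: eq_integrable (integrableD mD I1 I2) => //= x _ /=.
by rewrite -!EFinD; congr EFin; ring.
Qed.

Lemma wL2Z (a : R) f : wL2 f -> wL2 (fun x => a * f x).
Proof.
move=> Lf; split; first by apply: measurable_funM => //; case: Lf.
have := integrableZl mD (a ^+ 2) (wL2_integrable Lf Lf).
by apply: eq_integrable => //= x _ /=; rewrite -EFinM; congr EFin; ring.
Qed.

Lemma wL20 : wL2 (fun=> 0).
Proof.
split=> //; apply: eq_integrable (integrable0 _ _) => //= x _.
by rewrite /= expr0n mul0r.
Qed.

Lemma wL2B f g : wL2 f -> wL2 g -> wL2 (fun x => f x - g x).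
Proof.
move=> Lf Lg; have := wL2D Lf (wL2Z (-1) Lg); congr wL2.
by apply/funext => x; rewrite mulN1r.
Qed.

Lemma wL2_abs f : wL2 f -> wL2 (fun x => `|f x|).
Proof.
move=> [mf If]; split; first exact: measurableT_comp.
by apply: eq_integrable If => //= x _ /=; rewrite real_normK ?num_real.
Qed.

Lemma wL2_sum (I : Type) (s : seq I) (F : I -> T -> R) :
  (forall i, wL2 (F i)) -> wL2 (fun x => \sum_(i <- s) F i x).
Proof.
move=> LF; elim: s => [|i s IH].
  by have := wL20; congr wL2; apply/funext => x; rewrite big_nil.
have := wL2D (LF i) IH; congr wL2; apply/funext => x.
by rewrite big_cons.
Qed.

Lemma wipC f g : wip f g = wip g f.
Proof. by apply: eq_Rintegral => x _; rewrite [f x * _]mulrC. Qed.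

Lemma wipDl f g h : wL2 f -> wL2 g -> wL2 h ->
  wip (fun x => f x + g x) h = wip f h + wip g h.
Proof.
move=> Lf Lg Lh; rewrite /wip -RintegralD//; try exact: wL2_integrable.
by apply: eq_Rintegral => x _; rewrite !mulrDl.
Qed.

Lemma wipZl a f h : wL2 f -> wL2 h -> wip (fun x => a * f x) h = a * wip f h.
Proof.
move=> Lf Lh; rewrite /wip -RintegralZl//; try exact: wL2_integrable.
by apply: eq_Rintegral => x _; rewrite !mulrA.
Qed.

Lemma wipDr f g h : wL2 f -> wL2 g -> wL2 h ->
  wip h (fun x => f x + g x) = wip h f + wip h g.
Proof. by move=> *; rewrite wipC wipDl// !(wipC h). Qed.

Lemma wipZr a f h : wL2 f -> wL2 h -> wip h (fun x => a * f x) = a * wip h f.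
Proof. by move=> *; rewrite wipC wipZl// (wipC h). Qed.

Lemma wipBl f g h : wL2 f -> wL2 g -> wL2 h ->
  wip (fun x => f x - g x) h = wip f h - wip g h.
Proof.
move=> Lf Lg Lh; rewrite /wip -RintegralB//; try exact: wL2_integrable.
by apply: eq_Rintegral => x _; rewrite !mulrBl.
Qed.

Lemma wip0l h : wip (fun=> 0) h = 0.
Proof.
rewrite /wip /Rintegral (eq_integral (cst 0%E)) ?integral0// => x _.
by rewrite !mul0r.
Qed.

Lemma wip_suml (I : Type) (s : seq I) (F : I -> T -> R) h :
  (forall i, wL2 (F i)) -> wL2 h ->
  wip (fun x => \sum_(i <- s) F i x) h = \sum_(i <- s) wip (F i) h.
Proof.
move=> LF Lh; elim: s => [|i s IH].
  rewrite big_nil -[RHS](wip0l h); congr (wip _ h).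
  by apply/funext => x; rewrite big_nil.
rewrite big_cons -IH -wipDl//; last exact: wL2_sum.
by congr (wip _ h); apply/funext => x; rewrite big_cons.
Qed.

Lemma wip_ge0 f : 0 <= wip f f.
Proof.
by apply: Rintegral_ge0 => x Dx; rewrite mulr_ge0 ?w_ge0// -expr2 sqr_ge0.
Qed.

Lemma wnorm_ge0 f : 0 <= wnorm f. Proof. exact: sqrtr_ge0. Qed.

Lemma sqr_wnorm f : wnorm f ^+ 2 = wip f f.
Proof. by rewrite sqr_sqrtr// wip_ge0. Qed.

Lemma wip_CS_sqr f g : wL2 f -> wL2 g -> wip f g ^+ 2 <= wip f f * wip g g.
Proof.
move=> Lf Lg.
have key (a b : R) :
    0 <= a ^+ 2 * wip f f + 2 * (a * b) * wip f g + b ^+ 2 * wip g g.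
  have := wip_ge0 (fun x => a * f x + b * g x).
  rewrite wipDl ?wipDr ?wipZl ?wipZr//; do ?[exact: wL2Z|apply: wL2D; exact: wL2Z].
  by rewrite (wipC g f); congr (_ <= _); ring.
have := key (wip g g) (- wip f g).
have := key (- wip f g) (wip f f).
have := wip_ge0 f; have := wip_ge0 g.
have [/eqP|] := eqVneq (wip f f + wip g g) 0; last first.
  set A := wip f f; set B := wip g g; set C := wip f g => AB0 B0 A0 K1 K2.
  have AB : 0 < A + B by rewrite lt0r AB0 addr_ge0.
  by rewrite -(ler_pM2l AB); nra.
rewrite paddr_eq0 ?wip_ge0// => /andP[/eqP f0 /eqP g0] _ _ _ _.
have := key 1 1; have := key 1 (-1); rewrite f0 g0.
by set C := wip f g => ? ?; have -> : C = 0 by lra; rewrite expr0n mulr0.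
Qed.

Lemma wip_CS f g : wL2 f -> wL2 g -> `|wip f g| <= wnorm f * wnorm g.
Proof.
move=> Lf Lg; rewrite -ler_sqr ?nnegrE ?mulr_ge0 ?wnorm_ge0//.
by rewrite real_normK ?num_real// exprMn !sqr_wnorm wip_CS_sqr.
Qed.

Lemma wnormD f g : wL2 f -> wL2 g ->
  wnorm (fun x => f x + g x) <= wnorm f + wnorm g.
Proof.
move=> Lf Lg; rewrite -ler_sqr ?nnegrE ?addr_ge0 ?wnorm_ge0//.
rewrite sqr_wnorm sqrrD !sqr_wnorm wipDl ?wipDr//; try exact: wL2D.
have := le_trans (ler_norm _) (wip_CS Lf Lg); rewrite (wipC g f).
by move: (wnorm f) (wnorm g) => a b; rewrite mulr2n; lra.
Qed.

Lemma wnorm_abs f : wnorm (fun x => `|f x|) = wnorm f.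
Proof.
congr Num.sqrt; apply: eq_Rintegral => x _.
by rewrite -!expr2 real_normK ?num_real.
Qed.

Lemma wnormZ a f : wL2 f -> wnorm (fun x => a * f x) = `|a| * wnorm f.
Proof.
move=> Lf; rewrite /wnorm wipZl ?wipZr//; last exact: wL2Z.
by rewrite mulrA -expr2 sqrtrM ?sqr_ge0// sqrtr_sqr.
Qed.

Lemma wnorm0 : wnorm (fun=> 0) = 0.
Proof. by rewrite /wnorm wip0l sqrtr0. Qed.

Lemma wnorm_sum (I : Type) (s : seq I) (F : I -> T -> R) :
  (forall i, wL2 (F i)) ->
  wnorm (fun x => \sum_(i <- s) F i x) <= \sum_(i <- s) wnorm (F i).
Proof.
move=> LF; elim: s => [|i s IH].
  rewrite big_nil [X in wnorm X](_ : _ = fun=> 0) ?wnorm0//.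
  by apply/funext => x; rewrite big_nil.
rewrite big_cons; apply: le_trans (_ : wnorm (F i) + wnorm (fun x => \sum_(i <- s) F i x) <= _).
  rewrite [X in wnorm X](_ : _ = fun x => F i x + \sum_(i <- s) F i x).
    by apply: wnormD => //; exact: wL2_sum.
  by apply/funext => x; rewrite big_cons.
by rewrite lerD2l.
Qed.

Lemma wip_ae_eq f g h : wL2 f -> wL2 g -> wL2 h ->
  {ae mu, forall x, D x -> f x = g x} -> wip f h = wip g h.
Proof.
move=> Lf Lg Lh fg; rewrite /wip /Rintegral; congr fine.
apply: ae_eq_integral => //.
- by case/integrableP: (wL2_integrable Lf Lh).
- by case/integrableP: (wL2_integrable Lg Lh).
- by apply: filterS fg => x /= fg Dx; rewrite fg.
Qed.

Section AbsolutelySummable.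
Variable g : nat -> T -> R.
Hypothesis Lg : forall k, wL2 (g k).
Hypothesis sum_wnorm : cvgn (series (fun k => wnorm (g k))).

Let A n x : R := series (fun k => `|g k x|) n.

Let A_ge0 n x : 0 <= A n x.
Proof. by rewrite /A /series /= sumr_ge0. Qed.

Let A_nd x : {homo (A ^~ x) : n m / (n <= m)%N >-> n <= m}.
Proof.
move=> n m nm; rewrite -subr_ge0 /A sub_series_geq//.
exact: sumr_ge0.
Qed.

Let wL2A n : wL2 (A n).
Proof. by apply: wL2_sum => k; exact: wL2_abs. Qed.

Let G x : \bar R := limn (fun n => (A n x * A n x * w x)%:E).

Let A2w_nd x : D x ->
  {homo (fun n => (A n x * A n x * w x)%:E) : n m / (n <= m)%N >-> (n <= m)%E}.
Proof.
move=> Dx n m nm; rewrite lee_fin ler_wpM2r ?w_ge0//.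
by apply: ler_pM => //; exact: A_nd.
Qed.

Let A2w_le_G n x : D x -> ((A n x * A n x * w x)%:E <= G x)%E.
Proof.
move=> Dx; have nd := A2w_nd Dx.
rewrite /G (cvg_lim _ (ereal_nondecreasing_cvgn nd))//.
by apply: ereal_sup_ubound; exists n.
Qed.

(** [G] is the square of the sum of the [|g k|], times the weight. By monotone
    convergence its integral is the limit of the squared norms of the partial
    sums, and these are bounded by the square of the sum of the norms. *)
Let integrable_G : mu.-integrable D G.
Proof.
have mA n : measurable_fun D (fun x => (A n x * A n x * w x)%:E).
  by case/integrableP: (wL2_integrable (wL2A n) (wL2A n)).
have A0 n x : D x -> (0 <= (A n x * A n x * w x)%:E)%E.
  by move=> Dx; rewrite lee_fin mulr_ge0 ?w_ge0// mulr_ge0.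
apply/integrableP; split.
  apply: emeasurable_fun_cvg mA _ => x Dx.
  by apply: ereal_nondecreasing_is_cvgn; exact: A2w_nd.
rewrite (_ : (\int[mu]_(x in D) `|G x|)%E = (\int[mu]_(x in D) G x)%E); last first.
  apply: eq_integral => x; rewrite inE => Dx; rewrite gee0_abs//.
  by apply: le_trans (A2w_le_G 0 Dx); exact: A0.
have := @cvg_monotone_convergence _ _ _ mu _ mD _ mA A0 (fun x Dx => A2w_nd Dx).
move=> /cvg_lim <-//.
pose M := limn (series (fun k => wnorm (g k))).
apply: (@le_lt_trans _ _ (M ^+ 2)%:E); last exact: ltry.
apply: lime_le.
  apply: ereal_nondecreasing_is_cvgn => n m nm.
  apply: ge0_le_integral => // x Dx; [exact: A0 | exact: A2w_nd].
apply: nearW => n.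
rewrite -[X in (X <= _)%E]fineK; last first.
  exact: integrable_fin_num (wL2_integrable (wL2A n) (wL2A n)).
rewrite lee_fin -[leLHS]/(wip (A n) (A n)) -sqr_wnorm.
have wA : wnorm (A n) <= series (fun k => wnorm (g k)) n.
  apply: le_trans (wnorm_sum _ _) _ => [k|]; first exact: wL2_abs.
  by apply: ler_sum => k _; rewrite wnorm_abs.
have wM : wnorm (A n) <= M.
  apply: le_trans wA _; apply: nondecreasing_cvgn_le => // k m km.
  by rewrite -subr_ge0 sub_series_geq// sumr_ge0// => i _; exact: wnorm_ge0.
by rewrite lerXn2r ?nnegrE ?wnorm_ge0// (le_trans _ wM) ?wnorm_ge0.
Qed.

Lemma wL2_series_ae : {ae mu, forall x, D x -> cvgn (series (fun k => g k x))}.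
Proof.
apply: filterS (integrable_ae mD integrable_G) => x /= Gfin Dx.
apply: normed_cvg; apply: nondecreasing_is_cvgn.
  exact: A_nd.
exists (1 + fine (G x) / w x) => _ [n _ <-].
have : A n x * A n x <= fine (G x) / w x.
  by rewrite ler_pdivlMr ?w_gt0// -lee_fin fineK ?Gfin//; exact: A2w_le_G.
by rewrite -[X in X <= 1 + _]/(A n x); nra.
Qed.

Variables (S : T -> R) (mS : measurable_fun D S).
Hypothesis gS :
  {ae mu, forall x, D x -> series (fun k => g k x) n @[n --> \oo] --> S x}.

Let P n x : R := series (fun k => g k x) n.

Let wL2P n : wL2 (P n).
Proof. exact: wL2_sum. Qed.

Let PA n x : `|P n x| <= A n x.
Proof. exact: ler_norm_sum. Qed.

Let P2_le_G n x : D x -> ((P n x * P n x * w x)%:E <= G x)%E.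
Proof.
move=> Dx; apply: le_trans (A2w_le_G n Dx); rewrite lee_fin ler_wpM2r ?w_ge0//.
by rewrite -!expr2 -real_normK ?num_real// lerXn2r ?nnegrE.
Qed.

(** The integrable function [G] dominates the squares of all the partial sums. *)
Lemma wL2_series_lim : wL2 S.
Proof.
split=> //.
have mP n : measurable_fun D (fun x => (P n x * P n x * w x)%:E).
  by case/integrableP: (wL2_integrable (wL2P n) (wL2P n)).
have [||||+ _ _] := @dominated_convergence _ _ _ mu D mD _
  (EFin \o (fun x => S x ^+ 2 * w x)) G mP.
- by apply/measurable_EFinP; apply: measurable_funM => //; exact: measurable_funX.
- apply: filterS gS => x /= cgS Dx; apply: cvg_EFin; first exact: nearW.
  rewrite expr2; apply: cvgM; last exact: cvg_cst.
  by apply: cvgM; exact: cgS.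
- exact: integrable_G.
- apply/aeW => x n Dx; apply: le_trans (P2_le_G n Dx).
  by rewrite abse_EFin ger0_norm// mulr_ge0 ?w_ge0// -expr2 sqr_ge0.
- exact.
Qed.

(** The partial sums are dominated through [2 |P h| <= P ^ 2 + h ^ 2] and [P ^ 2 w <= G]. *)
Lemma wip_series_lim h : wL2 h ->
  series (fun k => wip (g k) h) n @[n --> \oo] --> wip S h.
Proof.
move=> Lh.
have mP n : measurable_fun D (fun x => (P n x * h x * w x)%:E).
  by case/integrableP: (wL2_integrable (wL2P n) Lh).
have Ih := wL2_integrable Lh Lh.
have [||||_ _ +] := @dominated_convergence _ _ _ mu D mD _
  (EFin \o (fun x => S x * h x * w x))
  (fun x => (G x + (h x * h x * w x)%:E)%E) mP.
- by case/integrableP: (wL2_integrable wL2_series_lim Lh).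
- apply: filterS gS => x /= cgS Dx; apply: cvg_EFin; first exact: nearW.
  apply: cvgM; last exact: cvg_cst.
  by apply: cvgM; [exact: cgS | exact: cvg_cst].
- exact: (integrableD mD integrable_G Ih).
- apply/aeW => x n Dx; rewrite abse_EFin.
  apply: le_trans (leeD (P2_le_G n Dx) (lexx _)).
  rewrite -EFinD lee_fin -mulrDl !normrM [`|w x|]ger0_norm ?w_ge0// ler_wpM2r ?w_ge0//.
  rewrite -!expr2 -[P n x ^+ 2]real_normK ?num_real// -[h x ^+ 2]real_normK ?num_real//.
  have := sqr_ge0 (`|P n x| - `|h x|).
  have := sqr_ge0 `|P n x|; have := sqr_ge0 `|h x|.
  by set a := `|P n x|; set b := `|h x|; nra.
move=> cvgP.
rewrite [X in X @ _ --> _](_ : _ =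
  (fun n => fine (\int[mu]_(x in D) (P n x * h x * w x)%:E)%E)); last first.
  apply/funext => n; rewrite -[RHS]/(wip (P n) h) /P /series /=.
  by rewrite wip_suml.
apply: fine_cvg; rewrite fineK; first exact: cvgP.
exact: integrable_fin_num (wL2_integrable wL2_series_lim Lh).
Qed.

End AbsolutelySummable.

Section OrthonormalBasis.
Variable e : nat -> T -> R.
Hypothesis Le : forall n, wL2 (e n).
Hypothesis e_orth : forall n m, wip (e n) (e m) = (n == m)%:R.

Let fsum (b : nat -> R) (s : seq nat) x : R := \sum_(i <- s) b i * e i x.

Let Lfsum b s : wL2 (fsum b s).
Proof. by apply: wL2_sum => i; exact: wL2Z. Qed.

Let fsum_ip b s h : wL2 h -> wip (fsum b s) h = \sum_(i <- s) b i * wip (e i) h.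
Proof.
move=> Lh; rewrite wip_suml// => [|i]; last exact: wL2Z.
by apply: eq_bigr => i _; rewrite wipZl.
Qed.

Let fsum_sqr b s : uniq s -> wip (fsum b s) (fsum b s) = \sum_(i <- s) b i ^+ 2.
Proof.
move=> us; rewrite fsum_ip//; apply: eq_big_seq => i si.
rewrite wipC fsum_ip// (bigD1_seq i)//= e_orth eqxx mulr1.
rewrite big1 ?addr0 ?expr2// => j ji.
by rewrite e_orth (negbTE ji) mulr0.
Qed.

(** The residue of [h] after projection on finitely many [e n] has nonnegative norm. *)
Lemma bessel h : wL2 h -> cvgn (series (fun n => wip (e n) h ^+ 2)).
Proof.
move=> Lh; apply: nondecreasing_is_cvgn => [n m nm|].
  by rewrite -subr_ge0 sub_series_geq// sumr_ge0// => i _; exact: sqr_ge0.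
exists (wip h h) => _ [n _ <-].
pose s := index_iota 0 n; pose b i := wip (e i) h.
have := wip_ge0 (fun x => h x - fsum b s x).
rewrite wipBl//; last exact: wL2B.
rewrite (wipC h) (wipC (fsum b s)) !wipBl// fsum_sqr ?iota_uniq//.
rewrite (wipC h) fsum_ip// -/s /series /=.
have -> : \sum_(i <- s) b i * wip (e i) h = \sum_(i <- s) b i ^+ 2.
  by apply: eq_bigr => i _; rewrite expr2.
by rewrite subrr subr0 subr_ge0.
Qed.

(** The coefficients of [h] are square summable, so that [2 |b c| <= b ^ 2 + c ^ 2]
    dominates the series. *)
Lemma wip_series_cvg (b : nat -> R) h : cvgn (series (fun n => b n ^+ 2)) ->
  wL2 h -> cvgn (series (fun n => b n * wip (e n) h)).
Proof.
move=> cb Lh; apply: normed_cvg.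
have := is_cvg_seriesD cb (bessel Lh); apply: series_le_cvg => [n|n|n].
- exact: normr_ge0.
- by rewrite fctE addr_ge0// sqr_ge0.
rewrite /= normrM -[leRHS]/(b n ^+ 2 + wip (e n) h ^+ 2) -[b n ^+ 2]real_normK ?num_real//.
rewrite -[wip _ _ ^+ 2]real_normK ?num_real//.
have := sqr_ge0 (`|b n| - `|wip (e n) h|).
have := sqr_ge0 `|b n|; have := sqr_ge0 `|wip (e n) h|.
set x := `|b n|; set y := `|wip _ _|.
by nra.
Qed.

(** Summability of squares does not make the norms of the terms summable, so the
    terms are grouped into blocks whose norms decrease geometrically: these add up almost
    everywhere. The pairing with [h] converges along all partial sums, so its limit
    is the one found along the blocks. *)
Theorem riesz_fischer (b : nat -> R) : cvgn (series (fun n => b n ^+ 2)) ->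
  exists2 S, wL2 S & forall h, wL2 h ->
    series (fun n => b n * wip (e n) h) n @[n --> \oo] --> wip S h.
Proof.
move=> cb; pose s := series (fun n => b n ^+ 2).
have s_nd : {homo s : n m / (n <= m)%N >-> n <= m}.
  move=> n m nm; rewrite -subr_ge0 sub_series_geq// sumr_ge0// => i _.
  exact: sqr_ge0.
have tail k : exists N, forall n, (N <= n)%N -> limn s - s n <= (2^-1 ^+ k) ^+ 2.
  have ek : 0 < (2^-1 ^+ k : R) ^+ 2 by rewrite !exprn_gt0// invr_gt0.
  have /cvgrPdist_le/(_ _ ek)[N _ NP] := cb.
  exists N => n /NP; exact: le_trans (ler_norm _).
(* [m k] is the start of the [k]-th block; [m k.+1] is at least [N k]. *)
have [N NP] := choice tail.
pose m k := \sum_(0 <= j < k) (N j).+1.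
have mS k : m k.+1 = (m k + (N k).+1)%N by rewrite /m big_nat_recr.
have m_ge k : (k <= m k)%N.
  by elim: k => // k IH; rewrite mS addnS ltnS (leq_trans IH)// leq_addr.
pose B k := fsum b (index_iota (m k) (m k.+1)).
have LB k : wL2 (B k) by exact: Lfsum.
have BE k h : wL2 h -> wip (B k) h =
    \sum_(m k <= i < m k.+1) b i * wip (e i) h by exact: fsum_ip.
have wB k : wnorm (B k.+1) <= 2^-1 ^+ k.
  rewrite -ler_sqr ?nnegrE ?wnorm_ge0 ?exprn_ge0 ?invr_ge0//.
  rewrite sqr_wnorm fsum_sqr ?iota_uniq//.
  have mm : (m k.+1 <= m k.+2)%N by rewrite (mS k.+1) leq_addr.
  rewrite -[leLHS](sub_series_geq (fun i => b i ^+ 2) mm) -/s.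
  apply: le_trans (NP k (m k.+1) _); last by rewrite mS addnS ltnW// ltnS leq_addl.
  by rewrite lerD2r; exact: nondecreasing_cvgn_le.
have sB : cvgn (series (fun k => wnorm (B k))).
  pose C := wnorm (B 0) + 2.
  have : cvgn (series (geometric C 2^-1)).
    by apply: is_cvg_geometric_series; rewrite ger0_norm ?invr_ge0// invf_lt1// ltr1n.
  apply: series_le_cvg => [k|k|[|k]]; first exact: wnorm_ge0.
  - by rewrite mulr_ge0 ?addr_ge0 ?wnorm_ge0// exprn_ge0 ?invr_ge0.
  - by rewrite /= expr0 mulr1 lerDl.
  - apply: le_trans (wB k) _; rewrite /= exprS mulrA ler_peMl//.
    by rewrite /C mulrDl divff ?lerDr ?mulr_ge0 ?wnorm_ge0 ?invr_ge0.
pose P n x := series (fun k => B k x) n.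
have mP n : measurable_fun D (P n) by case: (wL2_sum (index_iota 0 n) LB).
have cP : {ae mu, forall x, D x -> P n x @[n --> \oo] --> esup_limit P x}.
  apply: filterS (wL2_series_ae LB sB) => x /= cx Dx.
  have /cvg_ex[l cl] := cx Dx.
  by rewrite (esup_limit_cvg cl).
have mS' := measurable_esup_limit mP.
exists (esup_limit P); first exact: (wL2_series_lim LB sB mS' cP).
move=> h Lh; have := wip_series_lim LB sB mS' cP Lh.
have /cvg_ex[l cl] := wip_series_cvg cb Lh.
have -> : series (fun k => wip (B k) h) =
    series (fun n => b n * wip (e n) h) \o m.
  apply/funext => k /=; rewrite /series /=.
  elim: k => [|k IH]; first by rewrite /m !big_nil.
  by rewrite big_nat_recr//= IH BE// -big_cat_nat//= mS leq_addr.
have m_cvg : m k @[k --> \oo] --> \oo.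
  move=> A [n _ nA]; exists n => // k nk; apply: nA => /=.
  exact: leq_trans nk (m_ge k).
by move=> /(cvg_unique _ (cvg_comp _ _ m_cvg cl)) <-.
Qed.

Hypothesis e_total : forall h, wL2 h -> (forall n, wip (e n) h = 0) ->
  {ae mu, forall x, D x -> h x = 0}.

Lemma wip_inj f g : wL2 f -> wL2 g -> (forall n, wip (e n) f = wip (e n) g) ->
  {ae mu, forall x, D x -> f x = g x}.
Proof.
move=> Lf Lg fg; have := e_total (wL2B Lf Lg).
have fg0 n : wip (e n) (fun x => f x - g x) = 0.
  by rewrite wipC wipBl// !(wipC _ (e n)) fg subrr.
move=> /(_ fg0); apply: filterS => x /= fg_eq Dx.
by apply/eqP; rewrite -subr_eq0 fg_eq.
Qed.

(** Pairing with [e n] leaves a series with a single nonzero term. *)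
Lemma riesz_fischer_coef (b : nat -> R) S : wL2 S ->
  (forall h, wL2 h ->
    series (fun n => b n * wip (e n) h) n @[n --> \oo] --> wip S h) ->
  forall n, wip (e n) S = b n.
Proof.
move=> LS bS n; rewrite wipC; have /cvg_lim <- := bS _ (Le n); last exact: Rhausdorff.
apply/cvg_lim; first exact: Rhausdorff.
apply: cvg_near_cst; exists n.+1 => // k /= nk.
rewrite /series /= (bigD1_seq n) ?mem_index_iota ?iota_uniq//= e_orth eqxx mulr1.
by rewrite big1 ?addr0// => j jn; rewrite e_orth (negbTE jn) mulr0.
Qed.

(** The Riesz-Fischer sum of the coefficients of [f] is [f] itself, by totality. *)
Theorem parseval f g : wL2 f -> wL2 g ->
  series (fun n => wip (e n) f * wip (e n) g) n @[n --> \oo] --> wip f g.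
Proof.
move=> Lf Lg; have [S LS bS] := riesz_fischer (bessel Lf).
rewrite -(wip_ae_eq LS Lf Lg); first exact: bS.
by apply: wip_inj => // n; exact: (@riesz_fischer_coef (fun k => wip (e k) f)).
Qed.

End OrthonormalBasis.
End WeightedL2.

(** * The Gamma function *)

Section GammaFunction.
Variable R : realType.
Local Notation mu := (@lebesgue_measure R).

Lemma RposE : @Rpos R = `]0, +oo[%classic.
Proof. by apply/seteqP; split => x /=; rewrite in_itv/= andbT. Qed.

Lemma measurable_Rpos : measurable (@Rpos R : set (measurableTypeR R)).
Proof. by rewrite RposE; exact: measurable_itv. Qed.

(** From [ln (x / c) <= x / c - 1], the power is at most a constant times
    [exp (s * x / c)]; for [c = 2 * s + 1] the exponent is at most [x / 2], and [c] is
    positive even if [s = 0]. *)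
Lemma powR_expRN_le (s x : R) : 0 <= s -> 0 < x ->
  x `^ s * expR (- x) <= expR (s * ln (2 * s + 1)) * expR (- (x / 2)).
Proof.
move=> s0 x0; rewrite /powR gt_eqF// -!expRD ler_expR.
set c := 2 * s + 1; have c0 : 0 < c by rewrite /c; nra.
have xc : 1 + (x / c - 1) = x / c by rewrite addrC subrK.
have -> : ln x = ln c + ln (1 + (x / c - 1)).
  rewrite xc -lnM ?posrE ?divr_gt0//; congr ln.
  by rewrite mulrC divfK// gt_eqF.
have : ln (1 + (x / c - 1)) <= x / c - 1.
  by apply: le_ln1Dx; rewrite ltrBrDl addrN divr_gt0.
move=> /(ler_wpM2l s0); have : s * (x / c) <= x / 2.
  rewrite mulrA ler_pdivrMr// /c; nra.
set L := ln (1 + _); set q := x / c; nra.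
Qed.

Lemma cvgy_expRN_half : expR (- (x / 2)) @[x --> +oo] --> (0 : R).
Proof.
have h : (x / 2 : R) @[x --> +oo] --> +oo.
  by apply: gt0_cvgMly => //; rewrite invr_gt0.
exact: (cvg_comp _ _ h (@cvgr_expR R)).
Qed.

Lemma integrable_expRN_half :
  mu.-integrable (@Rpos R) (EFin \o (fun x => expR (- (x / 2)))).
Proof.
apply/integrableP; split.
  apply/measurable_EFinP; apply: measurable_funTS.
  apply: measurableT_comp => //; apply: measurableT_comp => //.
  by apply: measurable_funM.
under eq_integral do rewrite /= ger0_norm ?expR_ge0//.
have -> : (\int[mu]_(x in @Rpos R) (expR (- (x / 2)))%:E = 
          \int[mu]_(x in `[0%R, +oo[) (expR (- (x / 2)))%:E)%E.
  rewrite RposE integral_itv_obnd_cbnd//; apply/measurable_EFinP/measurable_funTS.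
  apply: measurableT_comp => //; apply: measurableT_comp => //.
  by apply: measurable_funM.
pose F x : R := (- 2) * expR (- (x / 2)).
have dF (x : R) : is_derive x 1 F (expR (- (x / 2))).
  apply: is_derive_eq; rewrite ?derive1_cst.
  by rewrite !scaler0 add0r /GRing.scale /= mulr1; field.
rewrite (@ge0_continuous_FTC2y _ _ F _ 0)//.
- by rewrite -EFinB ltry.
- apply: derivable_within_continuous => x _.
  have dG : is_derive (x : R) 1 (fun y : R => - 2^-1 * F y) (- 2^-1 * expR (- (x / 2))).
    exact: is_deriveZ.
  rewrite (_ : (fun _ => _) = (fun y : R => - 2^-1 * F y)); first by case: dG.
  by apply/funext => y; rewrite /F; field.
- rewrite -[0](mulr0 (-2)); apply: cvgM; first exact: cvg_cst.
  exact: cvgy_expRN_half.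
- apply/cvg_at_right_filter; apply: differentiable_continuous.
  exact/derivable1_diffP.
- by move=> x _; rewrite derive1E derive_val.
Qed.

Lemma measurable_powR_expRN (s : R) (D : set R) :
  measurable_fun D (fun x => x `^ s * expR (- x)).
Proof.
apply: measurable_funTS; apply: measurable_funM; first exact: measurable_powR.
by apply: measurableT_comp => //.
Qed.

Lemma measurable_mul_powR_expRN (c s : R) (D : set R) :
  measurable_fun D (fun x => c * x `^ s * expR (- x)).
Proof.
apply: measurable_funM; last exact: measurableT_comp.
by apply: measurable_funM => //; exact: measurable_funTS (measurable_powR s).
Qed.

Lemma integrable_powR_expRN (s : R) : 0 <= s ->
  mu.-integrable (@Rpos R) (EFin \o (fun x => x `^ s * expR (- x))).
Proof.
move=> s0.
have := integrableZl measurable_Rpos (expR (s * ln (2 * s + 1)))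
  integrable_expRN_half.
apply: le_integrable; first exact: measurable_Rpos.
  by apply/measurable_EFinP; exact: measurable_powR_expRN.
move=> x x0 /=; rewrite lee_fin !ger0_norm ?mulr_ge0 ?expR_ge0 ?powR_ge0//.
exact: powR_expRN_le.
Qed.

Lemma derivable_closed_LRcontinuous (F : R -> R) (a b : R) : a <= b ->
  (forall x, a <= x <= b -> derivable F x 1) ->
  derivable_oo_LRcontinuous F a b.
Proof.
move=> ab dF; split.
- by move=> x; rewrite in_itv /= => /andP[/ltW ax /ltW xb]; apply: dF; rewrite ax.
- apply/cvg_at_right_filter; apply: differentiable_continuous.
  by apply/derivable1_diffP/dF; rewrite lexx.
- apply/cvg_at_left_filter; apply: differentiable_continuous.
  by apply/derivable1_diffP/dF; rewrite lexx andbT.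
Qed.

Let is_derive_expRN (x : R) :
  is_derive x 1 (fun y : R => - expR (- y)) (expR (- x)).
Proof. by apply: is_derive_eq; rewrite mulrN1 opprK. Qed.

Lemma powR_expRN_by_parts (s a b : R) : 0 <= s -> 0 < a -> a < b ->
  (\int[mu]_(x in `[a, b]) (x `^ s * expR (- x))%:E =
   (a `^ s * expR (- a) - b `^ s * expR (- b))%:E +
   \int[mu]_(x in `[a, b]) (s * x `^ (s - 1) * expR (- x))%:E)%E.
Proof.
move=> s0 a0 ab.
have pos x : a <= x <= b -> 0 < x by move=> /andP[+ _]; exact: lt_le_trans.
have dpow x : a <= x <= b -> is_derive x 1 (@powR R ^~ s) (s * x `^ (s - 1)).
  by move=> /pos; exact: is_derive1_powR.
have dexp x := is_derive_expRN x.
rewrite (@integration_by_parts _ (@powR R ^~ s) (fun y => - expR (- y))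
  (fun x => s * x `^ (s - 1)) (fun x => expR (- x)))//.
- congr (_ + _)%E; first by congr EFin; ring.
  rewrite -[RHS]oppeK -[in RHS]integral_ge0N => [|x _]; last first.
    by rewrite lee_fin !mulr_ge0 ?powR_ge0 ?expR_ge0.
  by congr (- _)%E; apply: eq_integral => x _; rewrite -EFinN mulrN.
- apply: derivable_within_continuous => x; rewrite in_itv/= => /pos x0.
  apply: derivableM; first exact: derivable_cst.
  by have [] := is_derive1_powR (s - 1) x0.
- apply: derivable_closed_LRcontinuous; first exact: ltW.
  by move=> x /dpow[].
- move=> x; rewrite in_itv /= => /andP[/ltW ax /ltW xb].
  by rewrite derive1E; have [|_ ->] := dpow x; rewrite ?ax.
- apply: derivable_within_continuous => x _.
  by apply: ex_derive.
- apply: derivable_closed_LRcontinuous; first exact: ltW.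
  by move=> x _; apply: ex_derive.
- by move=> x _; rewrite derive1E derive_val.
Qed.

(* Starting at [n.+2] makes these segments nondegenerate. *)
Let A (n : nat) : set R := `[n.+2%:R^-1, n.+2%:R]%classic.

Let A_Rpos n : A n `<=` @Rpos R.
Proof.
move=> x; rewrite /A /= in_itv/= => /andP[+ _]; apply: lt_le_trans.
by rewrite invr_gt0.
Qed.

Let cvg_int_A (f : R -> R) : (forall x, 0 < x -> 0 <= f x) ->
  (forall D, measurable_fun D f) ->
  (\int[mu]_(x in A n) (f x)%:E)%E @[n --> \oo] -->
  (\int[mu]_(x in @Rpos R) (f x)%:E)%E.
Proof.
move=> f0 mf; have -> : @Rpos R = \bigcup_n A n.
  apply/seteqP; split => [x /= x0|x [n _ /A_Rpos]//].
  have [n nx] : exists n : nat, x + x^-1 < n%:R.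
    exists (Num.truncn (x + x^-1)).+1; exact: truncnS_gt.
  have xp : 0 < x by exact: x0.
  have x'0 : 0 < x^-1 by rewrite invr_gt0.
  have n2 : n%:R <= n.+2%:R :> R by rewrite ler_nat ltnW.
  exists n => //; rewrite /A /= in_itv/=; apply/andP; split; last by lra.
  rewrite -[leRHS]invrK lef_pV2 ?posrE//; lra.
apply: ge0_nondecreasing_set_cvg_integral.
- move=> n m nm; apply/subsetPset => x; rewrite /A /= !in_itv/= => /andP[nx xn].
  apply/andP; split.
    by apply: le_trans nx; rewrite lef_pV2 ?posrE// ler_nat.
  by apply: le_trans xn _; rewrite ler_nat.
- by move=> n; exact: (@measurable_itv R `[n.+2%:R^-1, n.+2%:R]).
- by move=> n; apply/measurable_EFinP; exact: mf.
- by move=> n x /A_Rpos x0; rewrite lee_fin f0.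
Qed.

(** Integration by parts on an exhaustion of the half-line by segments. *)
Lemma ge0_integral_powR_expRN (s : R) : 0 < s ->
  (\int[mu]_(x in @Rpos R) (s * x `^ (s - 1) * expR (- x))%:E =
   \int[mu]_(x in @Rpos R) (x `^ s * expR (- x))%:E)%E.
Proof.
move=> s0; have ms := measurable_mul_powR_expRN s (s - 1).
have c1 := @cvg_int_A (fun x => x `^ s * expR (- x)) (fun x _ =>
   mulr_ge0 (powR_ge0 _ _) (expR_ge0 _)) (measurable_powR_expRN s).
have c2 := @cvg_int_A (fun x => s * x `^ (s - 1) * expR (- x)) (fun x _ =>
   mulr_ge0 (mulr_ge0 (ltW s0) (powR_ge0 _ _)) (expR_ge0 _)) ms.
pose bd (x : R) : R := x `^ s * expR (- x).
have bd0 : (bd n.+2%:R^-1 - bd n.+2%:R)%:E @[n --> \oo] --> 0%E.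
  apply: cvg_EFin; first exact: nearW.
  rewrite -[0]subr0; apply: cvgB.
    apply: (@squeeze_cvgr _ _ _ _ (cst 0) (fun n => (n.+2%:R^-1) `^ s : R)).
    - apply: nearW => n; rewrite /bd mulr_ge0 ?powR_ge0 ?expR_ge0//=.
      by rewrite ler_piMr ?powR_ge0// -expR0 ler_expR oppr_le0 invr_ge0.
    - exact: cvg_cst.
    - have /cvg_at_rightP := powR_cvg0 s0; apply; split => [n|].
        by rewrite invr_gt0.
      have := @cvg_harmonic R; rewrite -(cvg_shiftS (harmonic : nat -> R)).
      exact.
  apply: (@squeeze_cvgr _ _ _ _ (cst 0)
    (fun n => expR (s * ln (2 * s + 1)) * expR (- (n.+2%:R / 2)) : R)).
  - apply: nearW => n; rewrite /bd mulr_ge0 ?powR_ge0 ?expR_ge0//=.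
    by apply: powR_expRN_le => //; exact: ltW.
  - exact: cvg_cst.
  - rewrite -[0](mulr0 (expR (s * ln (2 * s + 1)))).
    apply: cvgM; first exact: cvg_cst.
    have h : (n.+2%:R : R) @[n --> \oo] --> +oo.
      by have := @cvgr_idn R; rewrite -cvg_shiftS -cvg_shiftS.
    exact: (cvg_comp _ _ h cvgy_expRN_half).
have c3 : ((bd n.+2%:R^-1 - bd n.+2%:R)%:E +
    \int[mu]_(x in A n) (s * x `^ (s - 1) * expR (- x))%:E)%E @[n --> \oo] -->
    (\int[mu]_(x in @Rpos R) (s * x `^ (s - 1) * expR (- x))%:E)%E.
  rewrite -[X in _ --> X]add0e; apply: cvgeD bd0 c2.
  by rewrite fin_num_adde_defr.
have eq_int n : ((bd n.+2%:R^-1 - bd n.+2%:R)%:E +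
    \int[mu]_(x in A n) (s * x `^ (s - 1) * expR (- x))%:E)%E =
    (\int[mu]_(x in A n) (x `^ s * expR (- x))%:E)%E.
  rewrite powR_expRN_by_parts//; first exact: ltW.
  by rewrite (@lt_trans _ _ 1) ?invf_lt1 ?ltr1n.
move: c3; under eq_fun do rewrite eq_int.
by move=> /cvg_lim <-//; have /cvg_lim <- := c1.
Qed.

(** For [s < 1] the integrand is unbounded at [0]; integration by parts compares it
    with [x ^ s * exp (- x)], which is bounded. *)
Lemma integrable_gamma (s : R) : 0 < s ->
  mu.-integrable (@Rpos R) (EFin \o (fun x => x `^ (s - 1) * expR (- x))).
Proof.
move=> s0; have I : mu.-integrable (@Rpos R)
    (EFin \o (fun x => s * x `^ (s - 1) * expR (- x))).
  have /integrableP[_ Is] := integrable_powR_expRN (ltW s0).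
  apply/integrableP; split.
    by apply/measurable_EFinP; exact: measurable_mul_powR_expRN.
  under eq_integral do rewrite /= ger0_norm ?mulr_ge0 ?powR_ge0 ?expR_ge0 ?(ltW s0)//.
  rewrite ge0_integral_powR_expRN//; apply: le_lt_trans Is.
  by rewrite le_eqVlt; apply/orP; left; apply/eqP; apply: eq_integral => x _ /=;
    rewrite ger0_norm ?mulr_ge0 ?powR_ge0 ?expR_ge0.
have := integrableZl measurable_Rpos s^-1 I.
apply: eq_integrable; first exact: measurable_Rpos.
move=> x _ /=; rewrite -EFinM; congr EFin.
by rewrite !mulrA mulVf ?gt_eqF// mul1r.
Qed.

Lemma GammaS (s : R) : 0 < s -> Gamma (s + 1) = s * Gamma s.
Proof.
move=> s0; rewrite /Gamma addrK -RintegralZl//; last exact: integrable_gamma.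
  rewrite /Rintegral -ge0_integral_powR_expRN//; congr fine.
  by apply: eq_integral => x _; rewrite mulrA.
exact: measurable_Rpos.
Qed.

Lemma Gamma_gt0 (s : R) : 0 < s -> 0 < Gamma s.
Proof.
move=> s0; rewrite lt0r; apply/andP; split; last first.
  by apply: Rintegral_ge0 => x _; rewrite mulr_ge0 ?powR_ge0 ?expR_ge0.
apply/negP => /eqP G0; have I := integrable_gamma s0.
have : (\int[mu]_(x in @Rpos R) `|(EFin \o (fun x => (x `^ (s - 1) * expR (- x))%R)) x| = 0)%E.
  rewrite -[RHS]/(0%:E) -G0 /Gamma /Rintegral fineK; last first.
    apply: integrable_fin_num I; exact: measurable_Rpos.
  by apply: eq_integral => x _ /=; rewrite ger0_norm ?mulr_ge0 ?powR_ge0 ?expR_ge0.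
have /integrableP[mf _] := I.
move=> /(ae_eq_integral_abs mu measurable_Rpos mf) ae0.
have : {ae mu, forall x, ~ `]0, 1%R[%classic x}.
  apply: filterS ae0 => x /= h; rewrite in_itv/= => /andP[x0 _].
  have /eqP := h x0; rewrite eqe mulf_eq0 [expR _ == _]gt_eqF ?expR_gt0// orbF.
  by rewrite gt_eqF// powR_gt0.
(* The integrand is positive on the unit interval, which has measure one. *)
move=> [N [mN N0 /(_ _)]] sub.
have : (mu (`]0%R, 1%R[%classic : set R) <= mu N)%E.
  apply: le_measure; rewrite ?inE//.
  by move=> x x01; apply: sub => /=; apply.
rewrite N0 lebesgue_measure_itv/= lte_fin ltr01 oppr0 adde0.
by rewrite lee_fin ler10.
Qed.

End GammaFunction.

Arguments measurable_Rpos {R}.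

(** * Laguerre polynomials *)

Section LaguerrePolynomials.
Variables (R : realType) (alpha : R).

(** The raising operator is taken as the definition, because the differential
    equation, the lowering operator and the three term recurrence follow from it by
    algebra alone. *)
Fixpoint laguerre n : {poly R} :=
  if n is m.+1 then
    (m.+1%:R^-1)%:P * ('X * (laguerre m)^`() +
                       (m.+1%:R + alpha%:P - 'X) * laguerre m)
  else 1.

Let a : {poly R} := alpha%:P.

Let da : a^`() = 0. Proof. exact: derivC. Qed.

Let dn k : (k%:R : {poly R})^`() = 0.
Proof. by rewrite -polyC_natr derivC. Qed.

Lemma laguerre_up n : n.+1%:R * laguerre n.+1 =
  'X * (laguerre n)^`() + (n.+1%:R + a - 'X) * laguerre n.
Proof.
rewrite /= mulrA -[n.+1%:R * _]/(n.+1%:R * _) -[X in X * _ * _](polyC_natr _ n.+1).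
by rewrite -polyCM divff ?pnatr_eq0// mul1r.
Qed.

Let ode n (p : {poly R}) : {poly R} :=
  'X * p^`()^`() + (a + 1 - 'X) * p^`() + n%:R * p.

Let natpoly_neq0 n : (n.+1%:R : {poly R}) != 0.
Proof. by rewrite -polyC_natr polyC_eq0 pnatr_eq0. Qed.

(** The equation for [q] is a combination of the equation for [p] and its derivative. *)
Let ode_up n (p q : {poly R}) :
  n.+1%:R * q = 'X * p^`() + (n.+1%:R + a - 'X) * p ->
  ode n p = 0 -> ode n.+1 q = 0.
Proof.
move=> pq E; apply: (mulfI (natpoly_neq0 n)); rewrite mulr0.
have dq : n.+1%:R * q^`() =
    p^`() + 'X * p^`()^`() - p + (n.+1%:R + a - 'X) * p^`().
  have := congr1 (@deriv R) pq.
  rewrite !(derivM, derivD, derivN, derivX, derivC, da, dn) => h.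
  by transitivity (0 * q + n.+1%:R * q^`()); [ring | rewrite h; ring].
have ddq : n.+1%:R * q^`()^`() =
    'X * p^`()^`()^`() + (n.+1%:R + a - 'X) * p^`()^`() + 2 * (p^`()^`() - p^`()).
  have := congr1 (@deriv R) dq.
  rewrite !(derivM, derivD, derivN, derivX, derivC, da, dn) => h.
  by transitivity (0 * q^`() + n.+1%:R * q^`()^`()); [ring | rewrite h; ring].
have dE : 'X * p^`()^`()^`() + (a + 2 - 'X) * p^`()^`() + (n%:R - 1) * p^`() = 0.
  have := congr1 (@deriv R) E; rewrite /ode.
  rewrite !(derivM, derivD, derivN, derivX, derivC, da, dn, deriv0) => h.
  by rewrite -{}h; ring.
rewrite /ode !mulrDr !(mulrCA n.+1%:R) dq ddq pq.
transitivity ('X * ('X * p^`()^`()^`() + (a + 2 - 'X) * p^`()^`() + (n%:R - 1) * p^`())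
  + (n%:R + 2 + a - 'X) * ode n p); last by rewrite dE E !mulr0 addr0.
by rewrite /ode -[n.+1]addn1 natrD; ring.
Qed.

Lemma laguerre_ode n : 'X * (laguerre n)^`()^`() +
  (alpha%:P + 1 - 'X) * (laguerre n)^`() + n%:R * laguerre n = 0.
Proof.
elim: n => [|n IH]; last exact: ode_up (laguerre_up n) IH.
by rewrite /= -[1]/(1%:P) !derivC !mulr0 mul0r !addr0.
Qed.

(** Differentiate the raising relation, then eliminate the second derivative with the
    differential equation. *)
Lemma laguerre_down n : 'X * (laguerre n.+1)^`() =
  n.+1%:R * laguerre n.+1 - (n.+1%:R + alpha%:P) * laguerre n.
Proof.
apply: (mulfI (natpoly_neq0 n)).
have := laguerre_up n; have := laguerre_ode n.
move: (laguerre n) (laguerre n.+1) => p q E pq.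
have dq : n.+1%:R * q^`() =
    p^`() + 'X * p^`()^`() - p + (n.+1%:R + a - 'X) * p^`().
    have := congr1 (@deriv R) pq.
  rewrite !(derivM, derivD, derivN, derivX, derivC, da, dn) => h.
  by transitivity (0 * q + n.+1%:R * q^`()); [ring | rewrite h; ring].
rewrite mulrCA dq mulrBr pq.
transitivity ('X * ode n p + (n.+1%:R * ('X * p^`() + (n.+1%:R + a - 'X) * p) -
   n.+1%:R * ((n.+1%:R + a) * p))); last by rewrite /ode E mulr0 add0r.
by rewrite /ode -[n.+1]addn1 natrD; ring.
Qed.

Lemma laguerre_rec n : n.+2%:R * laguerre n.+2 =
  (n.+1%:R + n.+2%:R + alpha%:P - 'X) * laguerre n.+1 -
  (n.+1%:R + alpha%:P) * laguerre n.
Proof. by rewrite laguerre_up laguerre_down; ring. Qed.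

Lemma horner_laguerre_rec n (t : R) : n.+2%:R * (laguerre n.+2).[t] =
  (n.+1%:R + n.+2%:R + alpha - t) * (laguerre n.+1).[t] -
  (n.+1%:R + alpha) * (laguerre n).[t].
Proof.
have := laguerre_rec n; move: (laguerre n.+2) (laguerre n.+1) (laguerre n).
move=> p q r /(congr1 (fun p => p.[t])).
by rewrite -!polyC_natr !(hornerM, hornerD, hornerN, hornerC, hornerX).
Qed.

Lemma horner_laguerre0 (t : R) : (laguerre 0).[t] = 1.
Proof. exact: hornerC. Qed.

Lemma horner_laguerre1 (t : R) : (laguerre 1).[t] = alpha + 1 - t.
Proof.
have := laguerre_up 0; rewrite mul1r => ->.
rewrite /= -[1]/(1%:P) derivC mulr0 add0r mulr1.
by rewrite !(hornerD, hornerN, hornerC, hornerX); ring.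
Qed.

End LaguerrePolynomials.

(** * Moments and orthogonality of Laguerre polynomials *)
Lemma poly_monomial_ind (R : nzRingType) (P : {poly R} -> Prop) : P 0 ->
  (forall p q, P p -> P q -> P (p + q)) -> (forall c i, P (c *: 'X^i)) ->
  forall p, P p.
Proof.
move=> P0 PD PX p; rewrite -[p]coefK poly_def.
by elim/big_ind: _ => // i _; exact: PX.
Qed.

Section LaguerreMoments.
Variables (R : realType) (alpha : R).
Hypothesis alpha_gt0 : 0 < alpha.
Local Notation mu := (@lebesgue_measure R).
Local Notation w := (weight alpha).
Local Notation lag := (laguerre alpha).
Local Notation ip := (wip mu (@Rpos R) w).
Local Notation pf p := (fun x : R => p.[x]).

Lemma measurable_weight (D : set R) : measurable_fun D w.
Proof. exact: measurable_powR_expRN. Qed.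

Lemma weight_gt0 (x : R) : Rpos x -> 0 < w x.
Proof. by move=> x0; rewrite mulr_gt0 ?powR_gt0 ?expR_gt0. Qed.

Definition moment (p : {poly R}) : R := \int[mu]_(x in @Rpos R) (p.[x] * w x).

Let shift_gt0 n : 0 < alpha + n%:R + 1.
Proof. by rewrite addr_gt0// ltr_wpDr. Qed.

Let monomialE c i (x : R) : Rpos x ->
  (c *: 'X^i).[x] * w x = c * (x `^ (alpha + i%:R + 1 - 1) * expR (- x)).
Proof.
move=> x0; rewrite hornerZ hornerXn /weight addrK powRD; last first.
  by rewrite (gt_eqF x0) implybT.
by rewrite powR_mulrn ?ltW//; ring.
Qed.

(** Monomials reduce to the Gamma integrand. *)
Lemma integrable_poly_weight (p : {poly R}) :
  mu.-integrable (@Rpos R) (EFin \o (fun x => p.[x] * w x)).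
Proof.
elim/poly_monomial_ind: p => [|p q Ip Iq|c i].
- have := integrable0 mu (@Rpos R); apply: eq_integrable.
    exact: measurable_Rpos.
  by move=> x _ /=; rewrite horner0 mul0r.
- have := integrableD measurable_Rpos Ip Iq; apply: eq_integrable.
    exact: measurable_Rpos.
  by move=> x _ /=; rewrite hornerD mulrDl EFinD.
- have s0 := shift_gt0 i.
  have := integrableZl measurable_Rpos c (integrable_gamma s0).
  apply: eq_integrable; first exact: measurable_Rpos.
  by move=> x; rewrite inE => x0 /=; rewrite monomialE.
Qed.

Lemma momentXn c i : moment (c *: 'X^i) = c * Gamma (alpha + i%:R + 1).
Proof.
have s0 := shift_gt0 i.
rewrite /Gamma -RintegralZl; [|exact: measurable_Rpos|exact: integrable_gamma].
by apply: eq_Rintegral => x; rewrite inE => x0; rewrite monomialE.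
Qed.

Lemma momentD p q : moment (p + q) = moment p + moment q.
Proof.
rewrite /moment -RintegralD; try exact: integrable_poly_weight; last first.
  exact: measurable_Rpos.
by apply: eq_Rintegral => x _; rewrite hornerD mulrDl.
Qed.

Lemma momentZ c p : moment (c *: p) = c * moment p.
Proof.
rewrite /moment -RintegralZl; [|exact: measurable_Rpos|exact: integrable_poly_weight].
by apply: eq_Rintegral => x _; rewrite hornerZ -mulrA.
Qed.

Lemma moment0 : moment 0 = 0.
Proof. by rewrite -[0 in LHS](scale0r 0) momentZ mul0r. Qed.

(** Integration by parts: the integrand is the derivative of
    [x * p.[x] * weight alpha x], which vanishes at both ends. *)
Lemma moment_derivative p :
  moment ('X * p^`() + (alpha%:P + 1 - 'X) * p) = 0.
Proof.
elim/poly_monomial_ind: p => [|p q Ip Iq|c i].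
- by rewrite deriv0 !mulr0 addr0 moment0.
- by rewrite -[RHS](addr0 0) -{1}Ip -Iq -momentD derivD; congr moment; ring.
have -> : 'X * (c *: 'X^i)^`() + (alpha%:P + 1 - 'X) * (c *: 'X^i) =
    (c * (alpha + i%:R + 1)) *: 'X^i + (- c) *: 'X^(i.+1).
  have dX : 'X * ('X^i)^`() = i%:R * 'X^i :> {poly R}.
    by case: i => [|i]; rewrite derivXn ?mulr0n ?mulr0 ?mul0r// -mulr_natl mulrCA -exprS.
  rewrite derivZ -scalerAr dX exprS -!mul_polyC.
  rewrite (polyCM c) (polyCN c) !(polyCD _ _) polyC_natr polyC1.
  by move: ('X^i : {poly R}) (i%:R : {poly R}) => y z; ring.
rewrite momentD !momentXn.
have -> : alpha + i.+1%:R + 1 = alpha + i%:R + 1 + 1 by rewrite -natr1 addrA.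
by rewrite (GammaS (shift_gt0 i)); ring.
Qed.

Lemma wL2_poly p : wL2 mu (@Rpos R) w (pf p).
Proof.
split; first exact: measurable_poly.
have := integrable_poly_weight (p * p); apply: eq_integrable.
  exact: measurable_Rpos.
by move=> x _ /=; rewrite hornerM expr2.
Qed.

Lemma wip_poly p q : ip (pf p) (pf q) = moment (p * q).
Proof. by apply: eq_Rintegral => x _; rewrite hornerM. Qed.

(** For [p = lag m] the left side is symmetric in [n] and [m]: this is the
    symmetry of the operator of which [lag n] is an eigenvector. *)
Let moment_eigen n p : moment ('X * (lag n)^`() * p^`()) = n%:R * moment (lag n * p).
Proof.
have := moment_derivative (p * (lag n)^`()).
have -> : 'X * (p * (lag n)^`())^`() + (alpha%:P + 1 - 'X) * (p * (lag n)^`()) =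
   'X * (lag n)^`() * p^`() + (- n%:R) *: (lag n * p).
  rewrite -[RHS]addr0 -[X in _ = _ + X](mulr0 p) -(laguerre_ode alpha n).
  by rewrite derivM -mul_polyC polyCN polyC_natr; ring.
by rewrite momentD momentZ mulNr => /eqP; rewrite subr_eq0 => /eqP.
Qed.

Lemma laguerre_orthogonal n m : n != m -> ip (pf (lag n)) (pf (lag m)) = 0.
Proof.
move=> nm; rewrite wip_poly; have := moment_eigen n (lag m).
have := moment_eigen m (lag n); rewrite -mulrA [_ * (lag n)^`()]mulrC mulrA => -> /eqP.
rewrite [lag m * _]mulrC -subr_eq0 -mulrBl mulf_eq0 subr_eq0 eqr_nat.
by rewrite eq_sym (negbTE nm) /= => /eqP.
Qed.

(** The squared norm of the [n]-th Laguerre polynomial, which is also the inverse of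
    the weight in the Bergman space. *)
Definition laguerre_sqn n : R := Gamma (alpha + n%:R + 1) / n`!%:R.

Lemma laguerre_sqn_gt0 n : 0 < laguerre_sqn n.
Proof.
by rewrite divr_gt0 ?ltr0n ?fact_gt0// Gamma_gt0// shift_gt0.
Qed.

Lemma laguerre_sqnS n :
  n.+1%:R * laguerre_sqn n.+1 = (n.+1%:R + alpha) * laguerre_sqn n.
Proof.
rewrite /laguerre_sqn factS natrM.
have -> : alpha + n.+1%:R + 1 = alpha + n%:R + 1 + 1 by rewrite -natr1 addrA.
rewrite (GammaS (shift_gt0 n)).
have : n`!%:R != 0 :> R by rewrite pnatr_eq0 -lt0n fact_gt0.
have : n.+1%:R != 0 :> R by rewrite pnatr_eq0.
by rewrite -natr1; move: n`!%:R n%:R => u v; move=> *; field; apply/andP.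
Qed.

(** The raising and lowering operators turn [moment_derivative], applied to the product
    of two consecutive polynomials, into a relation between their norms. *)
Lemma wip_laguerre n m :
  ip (pf (lag n)) (pf (lag m)) = (n == m)%:R * laguerre_sqn n.
Proof.
have [<-{m}|nm] := eqVneq n m; last by rewrite laguerre_orthogonal// mul0r.
rewrite mul1r; elim: n => [|n IH].
  rewrite wip_poly /= mulr1 -[1]alg_polyC -(expr0 'X) momentXn mul1r.
  by rewrite /laguerre_sqn fact0 divr1 addr0.
have n0 : n.+1%:R != 0 :> R by rewrite pnatr_eq0.
apply: (mulfI n0); rewrite laguerre_sqnS -IH !wip_poly.
have := moment_derivative (lag n * lag n.+1).
have -> : 'X * (lag n * lag n.+1)^`() + (alpha%:P + 1 - 'X) * (lag n * lag n.+1) =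
   n.+1%:R *: (lag n.+1 * lag n.+1) + (- (n.+1%:R + alpha)) *: (lag n * lag n)
     + lag n * lag n.+1.
  rewrite derivM -!mul_polyC !(polyCN, polyCD) !polyC_natr.
  transitivity ('X * (lag n)^`() * lag n.+1 + 'X * (lag n.+1)^`() * lag n +
    (alpha%:P + 1 - 'X) * lag n * lag n.+1); first by ring.
  rewrite laguerre_down.
  have -> : 'X * (lag n)^`() = n.+1%:R * lag n.+1 - (n.+1%:R + alpha%:P - 'X) * lag n.
    by rewrite laguerre_up; ring.
  by ring.
have nS : n != n.+1 by rewrite ltn_eqF.
rewrite !momentD -(wip_poly (lag n)) (laguerre_orthogonal nS) addr0.
by rewrite !momentZ mulNr => /eqP; rewrite subr_eq0 => /eqP.
Qed.

End LaguerreMoments.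

Arguments laguerre : simpl never.

(** * Subexponential sequences *)

Section SubexponentialGrowth.
Variable R : realType.
Implicit Types (u v : nat -> R) (rho : R).

(** The power series with coefficients [u] has radius of convergence at least one. Stated
    with bounds, this passes to products and shifts. *)
Definition subexp u : Prop := forall rho, 0 <= rho < 1 ->
  exists C, forall n, `|u n| * rho ^+ n <= C.

(** From [N] on, the sequence [u n * rho ^+ n] is nonincreasing. *)
Lemma bounded_ratio u rho : (forall n, 0 <= u n) -> 0 <= rho < 1 ->
  (exists N, forall n, (N <= n)%N -> rho * u n.+1 <= u n) ->
  exists C, forall n, u n * rho ^+ n <= C.
Proof.
move=> u0 /andP[r0 r1] [N hN].
have t0 n : 0 <= u n * rho ^+ n by rewrite mulr_ge0 ?exprn_ge0.
exists (\sum_(k < N.+1) u k * rho ^+ k) => n.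
have [nN|/ltnW] := leqP n N.
  by rewrite (bigD1 (Ordinal (nN : (n < N.+1)%N)))//= lerDl sumr_ge0.
elim: n => [|n IH]; first by rewrite big_ord_recl/= lerDl sumr_ge0.
rewrite leq_eqVlt => /orP[/eqP <-|nN].
  by rewrite big_ord_recr/= lerDr sumr_ge0.
apply: le_trans (IH nN); rewrite exprS mulrA ler_wpM2r ?exprn_ge0//.
by rewrite mulrC; exact: hN.
Qed.

Lemma subexp_ratio u : (forall n, 0 <= u n) ->
  (forall rho, 0 <= rho < 1 ->
    exists N, forall n, (N <= n)%N -> rho * u n.+1 <= u n) ->
  subexp u.
Proof.
move=> u0 h rho rho01; have [C hC] := bounded_ratio u0 rho01 (h _ rho01).
by exists C => n; rewrite ger0_norm.
Qed.

Lemma subexp_le u v : (forall n, `|u n| <= v n) -> subexp v -> subexp u.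
Proof.
move=> uv hv rho r01; have [C hC] := hv _ r01; exists C => n.
have /andP[r0 _] := r01.
by apply: le_trans (hC n); rewrite ler_wpM2r ?exprn_ge0// (le_trans (uv n))// ler_norm.
Qed.

Lemma subexp_cst (c : R) : subexp (fun=> c).
Proof.
move=> rho /andP[r0 r1]; exists `|c| => n.
by rewrite ler_piMr// exprn_ile1// ltW.
Qed.

(** Each factor is bounded against a power of [Num.sqrt rho]. *)
Lemma subexpM u v : subexp u -> subexp v -> subexp (fun n => u n * v n).
Proof.
move=> hu hv rho /andP[r0 r1].
have s01 : 0 <= Num.sqrt rho < 1.
  by rewrite sqrtr_ge0 -[ltRHS]sqrtr1 ltr_sqrt.
have [C hC] := hu _ s01; have [C' hC'] := hv _ s01; exists (C * C') => n.
have -> : `|u n * v n| * rho ^+ n =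
    (`|u n| * Num.sqrt rho ^+ n) * (`|v n| * Num.sqrt rho ^+ n).
  have -> : rho ^+ n = Num.sqrt rho ^+ n * Num.sqrt rho ^+ n.
    by rewrite -exprMn -expr2 sqr_sqrtr.
  by rewrite normrM; ring.
by apply: ler_pM; rewrite ?mulr_ge0 ?exprn_ge0 ?sqrtr_ge0.
Qed.

Lemma subexp_shift u : subexp u -> subexp (fun n => u n.+1).
Proof.
move=> hu rho /andP[r0 r1]; pose s := (1 + rho) / 2.
have s01 : 0 <= s < 1 by rewrite /s; lra.
have s0 : 0 < s by rewrite /s; lra.
have [C hC] := hu _ s01; exists (C / s) => n; rewrite ler_pdivlMr//.
apply: le_trans (hC n.+1); rewrite -mulrA ler_wpM2l// exprSr ler_wpM2r ?(ltW s0)//.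
by rewrite lerXn2r ?nnegrE ?(ltW s0)// /s; lra.
Qed.

(** For [rho < s < 1], the ratio [rho / s] absorbs the growth of [u]. *)
Lemma subexp_geometric u rho : subexp u -> 0 <= rho < 1 ->
  exists2 s, 0 <= s < 1 & exists2 C, 0 <= C & forall n, `|u n| * rho ^+ n <= C * s ^+ n.
Proof.
move=> hu /andP[r0 r1]; pose s := (1 + rho) / 2.
have s01 : 0 <= s < 1 by rewrite /s; lra.
have s0 : 0 < s by rewrite /s; lra.
have rs01 : 0 <= rho / s < 1.
  rewrite divr_ge0 ?(ltW s0)//= ltr_pdivrMr// mul1r /s; lra.
have [C hC] := hu _ rs01; exists s => //; exists C => [|n].
  by apply: le_trans (hC 0%N); rewrite expr0 mulr1.
have := hC n; rewrite expr_div_n mulrA ler_pdivrMr ?exprn_gt0//.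
Qed.

Lemma subexp_summable u rho : subexp u -> 0 <= rho < 1 ->
  cvgn (series (fun n => `|u n| * rho ^+ n)).
Proof.
move=> hu r01; have [s /andP[s0 s1] [C C0 hC]] := subexp_geometric hu r01.
have /andP[r0 _] := r01.
have : cvgn (series (geometric C s)).
  by apply: is_cvg_geometric_series; rewrite ger0_norm.
apply: series_le_cvg => n //=; first by rewrite mulr_ge0 ?exprn_ge0.
by rewrite mulr_ge0 ?exprn_ge0.
Qed.

Lemma subexp_cvg0 u rho : subexp u -> 0 <= rho < 1 ->
  `|u n| * rho ^+ n @[n --> \oo] --> (0 : R).
Proof. by move=> hu /(subexp_summable hu)/cvg_series_cvg_0. Qed.

Let large_nat (c e : R) : 0 < e -> exists N, forall n, (N <= n)%N -> c <= n.+1%:R * e.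
Proof.
move=> e0; exists (Num.truncn (c / e)) => n Nn; rewrite -ler_pdivrMr//.
by apply: ltW; apply: lt_le_trans (truncnS_gt _) _; rewrite ler_nat.
Qed.

Lemma subexp_natS : subexp (fun n => n.+1%:R).
Proof.
apply: subexp_ratio => // rho /andP[r0 r1].
have [|N hN] := @large_nat 1 (1 - rho); first by rewrite subr_gt0.
exists N => n /hN; rewrite -[n.+2%:R]natr1; move: n.+1%:R => x; nra.
Qed.

Variable alpha : R.
Hypothesis alpha_gt0 : 0 < alpha.
Local Notation lag := (laguerre alpha).
Local Notation sqn := (laguerre_sqn alpha).

Lemma subexp_laguerre_sqn : subexp sqn.
Proof.
apply: subexp_ratio => [n|rho /andP[r0 r1]]; first exact/ltW/laguerre_sqn_gt0.
have [|N hN] := @large_nat alpha (1 - rho); first by rewrite subr_gt0.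
exists N => n /hN Nn; have n0 : 0 < n.+1%:R :> R by [].
rewrite -(ler_pM2l n0) mulrCA (laguerre_sqnS alpha_gt0) mulrA.
rewrite ler_wpM2r ?(ltW (laguerre_sqn_gt0 _ _))//.
move: n.+1%:R n0 Nn => x x0 Nx.
have : rho * alpha <= alpha by rewrite ler_piMl ?(ltW alpha_gt0)// ltW.
by nra.
Qed.

Lemma subexp_laguerre_norm : subexp (fun n => Num.sqrt (sqn n)).
Proof.
move=> rho /andP[r0 r1].
have [|C hC] := subexp_laguerre_sqn (_ : 0 <= rho ^+ 2 < 1).
  by rewrite exprn_ge0//= exprn_ilt1.
exists (Num.sqrt C) => n; rewrite ger0_norm ?sqrtr_ge0//.
have := hC n; rewrite ger0_norm; last exact/ltW/laguerre_sqn_gt0.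
move=> h; have -> : rho ^+ n = Num.sqrt ((rho ^+ 2) ^+ n).
  by rewrite -exprM mulnC exprM sqrtr_sqr ger0_norm ?exprn_ge0.
by rewrite -sqrtrM ?(ltW (laguerre_sqn_gt0 _ _))// ler_wsqrtr.
Qed.

(** The norms are nondecreasing in [n], because [alpha] is positive. *)
Lemma subexp_laguerre_normV : subexp (fun n => (Num.sqrt (sqn n))^-1).
Proof.
apply: subexp_le (subexp_cst (Num.sqrt (sqn 0))^-1) => n.
rewrite ger0_norm ?invr_ge0 ?sqrtr_ge0//.
rewrite lef_pV2 ?posrE ?sqrtr_gt0 ?laguerre_sqn_gt0//; apply: ler_wsqrtr.
elim: n => // n; move=> /le_trans; apply.
have n0 : 0 < n.+1%:R :> R by [].
rewrite -(ler_pM2l n0) (laguerre_sqnS alpha_gt0); apply: ler_wpM2r.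
  exact/ltW/laguerre_sqn_gt0.
by rewrite lerDl ltW.
Qed.

(** One step of the recurrence for the differences of consecutive values. Here [x] is
    [n.+1], [z] is [|t|], [p] and [q] are the sizes of the value and of the difference, and
    [y] that of the coefficient of the latter. The bound [e] holds once the degree
    is large. *)
Let difference_bound (x e y z p q : R) : 0 <= x -> 0 < e -> 0 <= z ->
  0 <= p -> 0 <= q -> alpha + z <= x * e -> y <= x + alpha + z ->
  y * q + z * p <= (x + 1) * ((1 + e) * q + e * p).
Proof.
move=> x0 e0 z0 p0 q0 xe yx.
have h1 : y * q <= (x + alpha + z) * q by rewrite ler_wpM2r.
have h2 : (alpha + z) * q <= x * e * q by rewrite ler_wpM2r.
have h3 : z * p <= x * e * p.
  by rewrite ler_wpM2r//; apply: le_trans xe; rewrite lerDr ltW.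
have h4 : 0 <= e * p by rewrite mulr_ge0// ltW.
have h5 : 0 <= e * q by rewrite mulr_ge0// ltW.
have -> : (x + 1) * ((1 + e) * q + e * p) =
  x * q + x * e * q + q + e * q + x * e * p + e * p by ring.
have e1 : (x + alpha + z) * q = x * q + (alpha + z) * q by ring.
lra.
Qed.

(** For the weighted norm [p + k * q], the matrix with rows [(1, 1)] and [(e, 1 + e)] has norm
    at most [rho^-1]. The choices [k = 2 / (1 - rho)] and [e = (1 - rho) / k] make both
    coefficients of the right side minus the left side nonnegative. *)
Let contraction_bound (rho k e p q p1 q1 : R) : 0 <= rho -> rho < 1 -> 0 < k ->
  k * (1 - rho) = 2 -> k * e = 1 - rho -> 0 <= p -> 0 <= q ->
  p1 <= p + q -> q1 <= (1 + e) * q + e * p ->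
  rho * (p1 + k * q1) <= p + k * q.
Proof.
move=> r0 r1 k0 kr ke p0 q0 pp qq.
have h1 : k * q1 <= k * ((1 + e) * q + e * p) by rewrite ler_wpM2l// ltW.
have h2 : rho * (p1 + k * q1) <= rho * (p + q + k * ((1 + e) * q + e * p)).
  by rewrite ler_wpM2l// lerD.
apply: le_trans h2 _; rewrite -subr_ge0.
have -> : p + k * q - rho * (p + q + k * ((1 + e) * q + e * p)) =
  (1 - rho * (1 + k * e)) * p + (k * (1 - rho) - rho * (1 + k * e)) * q by ring.
have h3 : rho * (1 + k * e) <= 1.
  by rewrite ke -subr_ge0 (_ : _ - _ = (1 - rho) ^+ 2) ?sqr_ge0//; ring.
by rewrite kr addr_ge0// mulr_ge0//; lra.
Qed.

(** A bound on the ratio of consecutive values is out of reach, since they may vanish.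
    The recurrence acts on the pair made of a value and the difference with the next
    one by a matrix that tends to a unipotent one, so a weighted norm of
    this pair eventually grows by a factor at most [rho^-1]. *)
Lemma subexp_laguerre (t : R) : subexp (fun n => (lag n).[t]).
Proof.
pose l n := (lag n).[t]; pose D n := l n.+1 - l n.
have DE n : n.+2%:R * D n.+1 = (n.+1%:R + alpha - t) * D n - t * l n.
  have := horner_laguerre_rec alpha n t; rewrite -/(l n) -/(l n.+1) -/(l n.+2).
  by rewrite /D mulrBr => ->; rewrite -[n.+2%:R]natr1; ring.
move=> rho rho01; have /andP[r0 r1] := rho01.
have r1' : 1 - rho != 0 by rewrite gt_eqF ?subr_gt0.
have [k k0 kr] : exists2 k : R, 0 < k & k * (1 - rho) = 2.
  by exists (2 / (1 - rho)); [rewrite divr_gt0// subr_gt0 | rewrite divfK].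
have [e e0 ke] : exists2 e : R, 0 < e & k * e = 1 - rho.
  exists ((1 - rho) / k); first by rewrite divr_gt0// subr_gt0.
  by rewrite mulrC divfK// gt_eqF.
pose V n := `|l n| + k * `|D n|.
have V0 n : 0 <= V n by rewrite addr_ge0// mulr_ge0// ltW.
have [N hN] := @large_nat (alpha + `|t|) e e0.
have step n : (N <= n)%N -> rho * V n.+1 <= V n.
  move=> /hN Nn.
  have l1 : `|l n.+1| <= `|l n| + `|D n|.
    by apply: le_trans (ler_normD _ _); rewrite /D addrC subrK.
  have D1 : `|D n.+1| <= (1 + e) * `|D n| + e * `|l n|.
    have n0 : 0 < n.+2%:R :> R by [].
    rewrite -(ler_pM2l n0) -[X in X * `|_|](ger0_norm (ltW n0)) -normrM DE.
    apply: le_trans (ler_normB _ _) _; rewrite !normrM.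
    have : `|n.+1%:R + alpha - t| <= n.+1%:R + alpha + `|t|.
      apply: le_trans (ler_normB _ _) _.
      by rewrite lerD2r ger0_norm// addr_ge0// ltW.
    by move=> xt; rewrite -[n.+2%:R]natr1; apply: difference_bound.
  exact: (contraction_bound r0 r1 k0 kr ke _ _ l1 D1).
have [C hC] := bounded_ratio V0 rho01 (ex_intro _ N step).
exists C => n; apply: le_trans (hC n); rewrite ler_wpM2r ?exprn_ge0//.
by rewrite lerDl mulr_ge0// ltW.
Qed.

End SubexponentialGrowth.

(** * Complex valued functions of a real variable *)

Section ComplexDerivative.
Variable R : realType.
Implicit Types (f g : R -> R) (r : R).

Let C := R[i].

(** The rules of differentiation, for functions given by their values. *)
Lemma is_derive1D f g r df dg : is_derive r 1 f df -> is_derive r 1 g dg ->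
  is_derive r 1 (fun s => f s + g s) (df + dg).
Proof. exact: is_deriveD. Qed.

Lemma is_derive1B f g r df dg : is_derive r 1 f df -> is_derive r 1 g dg ->
  is_derive r 1 (fun s => f s - g s) (df - dg).
Proof. exact: is_deriveB. Qed.

Lemma is_derive1M f g r df dg : is_derive r 1 f df -> is_derive r 1 g dg ->
  is_derive r 1 (fun s => f s * g s) (f r * dg + g r * df).
Proof. exact: is_deriveM. Qed.

Lemma is_derive1_cst (c r : R) : is_derive r 1 (fun=> c) 0.
Proof. exact: is_derive_cst. Qed.

Lemma is_derive1_idfun (r : R) : is_derive r 1 (fun s : R => s) 1.
Proof. exact: is_derive_id. Qed.

Lemma is_derive1Z (c r : R) f df : is_derive r 1 f df ->
  is_derive r 1 (fun s => c * f s) (c * df).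
Proof. by move=> h; apply: is_deriveZ. Qed.

Lemma is_derive1_eq f r d d' : is_derive r 1 f d -> d = d' -> is_derive r 1 f d'.
Proof. by move=> h <-. Qed.

(** Only derivatives along a segment are used, so the two components are
    differentiated separately. *)
Definition is_cderive (h : R -> C) (r : R) (d : C) : Prop :=
  is_derive r 1 (fun s => complex.Re (h s)) (complex.Re d) /\
  is_derive r 1 (fun s => complex.Im (h s)) (complex.Im d).

Lemma is_cderive_eq h r d d' : is_cderive h r d -> d = d' -> is_cderive h r d'.
Proof. by move=> hd <-. Qed.

Lemma is_cderive_cst (c : C) r : is_cderive (fun=> c) r 0.
Proof. by split; exact: is_derive1_cst. Qed.

Lemma is_cderiveD h k r dh dk : is_cderive h r dh -> is_cderive k r dk ->
  is_cderive (fun s => h s + k s) r (dh + dk).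
Proof.
move=> [h1 h2] [k1 k2]; split.
  rewrite (_ : (fun _ => _) = fun s => complex.Re (h s) + complex.Re (k s)).
    apply: is_derive1_eq (is_derive1D h1 k1) _.
    by case: dh {h1 h2} => ? ?; case: dk {k1 k2}.
  by apply/funext => s; case: (h s) (k s) => ? ? [].
rewrite (_ : (fun _ => _) = fun s => complex.Im (h s) + complex.Im (k s)).
  apply: is_derive1_eq (is_derive1D h2 k2) _.
  by case: dh {h1 h2} => ? ?; case: dk {k1 k2}.
by apply/funext => s; case: (h s) (k s) => ? ? [].
Qed.

Let RemE (x y : C) : complex.Re (x * y) =
  complex.Re x * complex.Re y - complex.Im x * complex.Im y.
Proof. by case: x y => ? ? []. Qed.

Let ImmE (x y : C) : complex.Im (x * y) =
  complex.Re x * complex.Im y + complex.Im x * complex.Re y.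
Proof. by case: x y => ? ? []. Qed.

Let ReaE (x y : C) : complex.Re (x + y) = complex.Re x + complex.Re y.
Proof. by case: x y => ? ? []. Qed.

Let ImaE (x y : C) : complex.Im (x + y) = complex.Im x + complex.Im y.
Proof. by case: x y => ? ? []. Qed.

Lemma is_cderiveM h k r dh dk : is_cderive h r dh -> is_cderive k r dk ->
  is_cderive (fun s => h s * k s) r (h r * dk + dh * k r).
Proof.
move=> [h1 h2] [k1 k2]; split.
  under eq_fun do rewrite RemE.
  apply: is_derive1_eq (is_derive1B (is_derive1M h1 k1) (is_derive1M h2 k2)) _.
  by rewrite !(ReaE, RemE); ring.
under eq_fun do rewrite ImmE.
apply: is_derive1_eq (is_derive1D (is_derive1M h1 k2) (is_derive1M h2 k1)) _.
by rewrite !(ImaE, ImmE); ring.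
Qed.

Definition cpoly (p : {poly R}) : {poly C} := map_poly (real_complex R) p.

Lemma is_cderive_line (z : C) r : is_cderive (fun s => (s%:C)%C * z) r z.
Proof.
have L c : is_derive r 1 (fun s : R => s * c) c.
  apply: is_derive1_eq (is_derive1M (is_derive1_idfun r) (is_derive1_cst c r)) _.
  by rewrite mulr0 add0r mulr1.
split.
  under eq_fun do rewrite RemE /= mul0r subr0.
  exact: L.
under eq_fun do rewrite ImmE /= mul0r addr0.
exact: L.
Qed.

Lemma is_cderive_poly (p : {poly R}) (z : C) r :
  is_cderive (fun s => (cpoly p).[(s%:C)%C * z]) r
    (z * (cpoly p^`()).[(r%:C)%C * z]).
Proof.
elim/poly_ind: p => [|p c IH].
  rewrite deriv0 /cpoly rmorph0 horner0 mulr0.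
  under eq_fun do rewrite horner0.
  exact: is_cderive_cst.
have -> : cpoly (p * 'X + c%:P) = cpoly p * 'X + ((c%:C)%C)%:P.
  by rewrite /cpoly rmorphD rmorphM /= map_polyX map_polyC.
under eq_fun do rewrite hornerD hornerC hornerMX.
apply: is_cderive_eq (is_cderiveD (is_cderiveM IH (is_cderive_line z r))
  (is_cderive_cst _ r)) _.
rewrite derivD derivM derivX derivC mulr1 !addr0 /cpoly.
rewrite rmorphD rmorphM /=.
by rewrite map_polyX hornerD hornerMX; ring.
Qed.

End ComplexDerivative.

(** * The generating function on the complex disc *)

Section GeneratingFunction.
Variables (R : realType) (alpha t : R).
Hypothesis alpha_gt0 : 0 < alpha.
Local Notation C := R[i].
Local Notation l := (fun n => (laguerre alpha n).[t]).

(** A partial sum of the generating function, as a polynomial in its variable. *)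
Definition laguerre_gf N : {poly R} := \sum_(0 <= n < N) l n *: 'X^n.

(** The closed form [(1 - X) ^ (- alpha - 1) * exp (- t X / (1 - X))] solves this
    equation with right side [0]; by the recurrence, truncation leaves two boundary
    terms. *)
Lemma laguerre_gf_ode N : (1 - 'X) ^+ 2 * (laguerre_gf N.+1)^`() -
    ((alpha + 1)%:P * (1 - 'X) - t%:P) * laguerre_gf N.+1 =
  (N.+1%:R + alpha) * l N *: 'X^(N.+1) - N.+1%:R * l N.+1 *: 'X^N.
Proof.
elim: N => [|N IH].
  rewrite /laguerre_gf big_nat1 horner_laguerre0 horner_laguerre1 scale1r expr0.
  rewrite -[1]/(1%:P) derivC mulr0 sub0r !mulr1 mul1r -!mul_polyC.
  by rewrite !(polyCD, polyCN, polyCM); ring.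
have -> : laguerre_gf N.+2 = laguerre_gf N.+1 + l N.+1 *: 'X^(N.+1).
  by rewrite /laguerre_gf big_nat_recr.
have dX : ('X^(N.+1))^`() = (N.+1%:R)%:P * 'X^N :> {poly R}.
  by rewrite derivXn polyC_natr mulr_natl.
rewrite derivD mulrDr mulrDr opprD addrACA IH derivZ dX -!mul_polyC !exprS.
have rec : N.+2%:R * l N.+2 = (N.+1%:R + N.+2%:R + alpha - t) * l N.+1 -
  (N.+1%:R + alpha) * l N by exact: horner_laguerre_rec.
rewrite rec -[N.+2%:R]natr1.
move: (l N.+1) (l N) N.+1%:R 'X^N => u v x y.
by rewrite !(polyCD, polyCN, polyCM) polyC1; ring.
Qed.

Variable z : C.
Hypothesis z_lt1 : Normc.normc z < 1.
Let nz := Normc.normc z.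
Let a := complex.Re z.
Let b := complex.Im z.
(* The point [1 - s * z] is [x s - i * y s], and [m s] is its squared modulus. *)
Let x (s : R) : R := 1 - s * a.
Let y (s : R) : R := s * b.
Let m (s : R) : R := x s ^+ 2 + y s ^+ 2.

Let nz_ge0 : 0 <= nz.
Proof. by rewrite /nz; case: z => ? ?; exact: sqrtr_ge0. Qed.

Let nz2 : nz ^+ 2 = a ^+ 2 + b ^+ 2.
Proof.
by rewrite /nz /a /b; case: z => ? ?; rewrite /= sqr_sqrtr// addr_ge0// sqr_ge0.
Qed.

Let a_le : `|a| <= nz.
Proof.
by rewrite -ler_sqr ?nnegrE// real_normK ?num_real// nz2 lerDl sqr_ge0.
Qed.

Let x_ge (s : R) : 0 <= s <= 1 -> 1 - nz <= x s.
Proof.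
move=> /andP[s0 s1]; rewrite /x lerD2l lerN2; apply: le_trans (ler_norm _) _.
rewrite normrM ger0_norm//; apply: le_trans (_ : `|a| <= nz) => //.
by rewrite ler_piMl.
Qed.

Let x_gt0 (s : R) : 0 <= s <= 1 -> 0 < x s.
Proof. by move=> /x_ge; apply: lt_le_trans; rewrite subr_gt0. Qed.

Let m_ge (s : R) : 0 <= s <= 1 -> (1 - nz) ^+ 2 <= m s.
Proof.
move=> s01; apply: le_trans (_ : x s ^+ 2 <= _); last by rewrite lerDl sqr_ge0.
by rewrite lerXn2r ?nnegrE ?x_ge ?(ltW (x_gt0 s01)) ?subr_ge0 ?(ltW z_lt1).
Qed.

Let m_gt0 (s : R) : 0 <= s <= 1 -> 0 < m s.
Proof.
by move=> /m_ge; apply: lt_le_trans; rewrite exprn_gt0// subr_gt0.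
Qed.

Let sa_le (s : R) : 0 <= s <= 1 -> `|s * a| <= 1.
Proof.
move=> /andP[s0 s1]; rewrite normrM (ger0_norm s0) mulr_ile1//.
by apply: le_trans a_le _; exact: ltW.
Qed.

Let m_le (s : R) : 0 <= s <= 1 -> m s <= 4.
Proof.
move=> s01; have /andP[s0 s1] := s01.
have -> : m s = 1 - 2 * (s * a) + s ^+ 2 * nz ^+ 2 by rewrite nz2 /m /x /y; ring.
have s2 : s ^+ 2 * nz ^+ 2 <= 1.
  by rewrite -exprMn exprn_ile1// ?mulr_ge0// mulr_ile1// ltW.
by have := sa_le s01; rewrite ler_norml => /andP[]; lra.
Qed.

(** [U + i * V] is [(alpha + 1) * log (1 - s * z) + t / (1 - s * z) - t]. The argument
    is an arctangent because [1 - s * z] has positive real part. *)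
Let U s : R := (alpha + 1) / 2 * ln (m s) + t * (x s * (m s)^-1) - t.
Let V s : R := t * (y s * (m s)^-1) - (alpha + 1) * atan (y s * (x s)^-1).

(** The inverse of the generating function at [s * z]. *)
Let E s : C := ((expR (U s) * cos (V s)) +i* (expR (U s) * sin (V s)))%C.

Let U' s : R := (alpha + 1) * (b * y s - a * x s) / m s +
  t * (a * (x s ^+ 2 - y s ^+ 2) - 2 * b * x s * y s) / m s ^+ 2.
Let V' s : R := t * (b * (x s ^+ 2 - y s ^+ 2) + 2 * a * x s * y s) / m s ^+ 2 -
  (alpha + 1) * (b * x s + a * y s) / m s.

Let dx (s : R) : is_derive s 1 x (- a).
Proof.
apply: is_derive1_eq (is_derive1B (is_derive1_cst 1 s)
  (is_derive1M (is_derive1_idfun s) (is_derive1_cst a s))) _.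
by ring.
Qed.

Let dy (s : R) : is_derive s 1 y b.
Proof.
apply: is_derive1_eq (is_derive1M (is_derive1_idfun s) (is_derive1_cst b s)) _.
by ring.
Qed.

Let dm (s : R) : is_derive s 1 m (2 * (b * y s - a * x s)).
Proof.
apply: is_derive1_eq (is_derive1D (is_derive1M (dx s) (dx s)) (is_derive1M (dy s) (dy s))) _.
by ring.
Qed.

Let dU (s : R) : 0 <= s <= 1 -> is_derive s 1 U (U' s).
Proof.
move=> s01; have m0 : m s != 0 by rewrite gt_eqF// m_gt0.
have H := is_derive1B (is_derive1D
   (is_derive1Z ((alpha + 1) / 2) (is_derive1_comp (is_derive1_ln (m_gt0 s01)) (dm s)))
   (is_derive1Z t (is_derive1M (dx s) (is_deriveV m0 (dm s)))))
   (is_derive1_cst t s).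
apply: (is_derive1_eq (H : is_derive s 1 U _)).
rewrite /U' /GRing.scale /= subr0; congr (_ + _); first by field.
by move: m0; rewrite /m => m0; field.
Qed.

Let dV (s : R) : 0 <= s <= 1 -> is_derive s 1 V (V' s).
Proof.
move=> s01; have m0 : m s != 0 by rewrite gt_eqF// m_gt0.
have x0 : x s != 0 by rewrite gt_eqF// x_gt0.
have H := is_derive1B
   (is_derive1Z t (is_derive1M (dy s) (is_deriveV m0 (dm s))))
   (is_derive1Z (alpha + 1) (is_derive1_comp (g := fun s => y s * (x s)^-1) (is_derive1_atan _)
     (is_derive1M (dy s) (is_deriveV x0 (dx s))))).
apply: (is_derive1_eq (H : is_derive s 1 V _)).
rewrite /V' /GRing.scale /=; congr (_ - _).
  by move: m0; rewrite /m => m0; field.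
by move: m0; rewrite /m => m0; field; rewrite x0 m0.
Qed.

Let dE (s : R) : 0 <= s <= 1 -> is_cderive E s (E s * (U' s +i* V' s)%C).
Proof.
move=> s01; have hU := dU s01; have hV := dV s01.
have eU := is_derive1_comp (is_derive_expR (U s)) hU.
have cV := is_derive1_comp (is_derive_cos (V s)) hV.
have sV := is_derive1_comp (is_derive_sin (V s)) hV.
split.
  by apply: is_derive1_eq (is_derive1M eU cV) _; rewrite /=; ring.
by apply: is_derive1_eq (is_derive1M eU sV) _; rewrite /=; ring.
Qed.

Let zeta (s : R) : C := (s%:C)%C * z.
(* The logarithmic derivative of [E]. *)
Let Q (s : R) : C := (U' s +i* V' s)%C.

Let one_sub_zeta (s : R) : 1 - zeta s = (x s +i* (- y s))%C.
Proof.
apply/eqP; rewrite eq_complex /zeta /x /y /a /b; case: z => ? ? /=.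
by apply/andP; split; apply/eqP; ring.
Qed.

Let Q_eq (s : R) : 0 <= s <= 1 -> (1 - zeta s) ^+ 2 * Q s =
  z * ((t%:C)%C - ((alpha + 1)%:C)%C * (1 - zeta s)).
Proof.
move=> s01; have m0 : m s != 0 by rewrite gt_eqF// m_gt0.
rewrite one_sub_zeta expr2; have -> : z = (a +i* b)%C by rewrite /a /b; case: z.
apply/eqP; rewrite eq_complex /Q /= /U' /V'; move: m0; rewrite /m => m0.
by apply/andP; split; apply/eqP; field.
Qed.

(* The quotient of the partial sum by the closed form, and its derivative. *)
Let h N (s : R) : C := E s * (cpoly (laguerre_gf N.+1)).[zeta s].
Let h' N (s : R) : C := E s * (z * (cpoly (laguerre_gf N.+1)^`()).[zeta s]) +
  E s * Q s * (cpoly (laguerre_gf N.+1)).[zeta s].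

Let dh N (s : R) : 0 <= s <= 1 -> is_cderive (h N) s (h' N s).
Proof. by move=> s01; apply: is_cderiveM (dE s01) (is_cderive_poly _ z s). Qed.

Let h'_eq N (s : R) : 0 <= s <= 1 -> (1 - zeta s) ^+ 2 * h' N s =
  E s * z * ((((N.+1%:R + alpha) * l N)%:C)%C * zeta s ^+ N.+1 -
             ((N.+1%:R * l N.+1)%:C)%C * zeta s ^+ N).
Proof.
move=> s01; have := congr1 (fun p => (cpoly p).[zeta s]) (laguerre_gf_ode N).
rewrite /cpoly -!mul_polyC !(rmorphB, rmorphM, rmorphXn) /= !map_polyC /= map_polyX rmorph1.
rewrite !(hornerM, hornerD, hornerN, horner_exp, hornerC, hornerX) => ode.
rewrite -{}ode /h'; move: (Q_eq s01); rewrite /cpoly.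
move: (Q s) (E s) (map_poly _ _).[_] (map_poly _ _).[_] => q e p2 p1 qe.
transitivity (e * z * (1 - zeta s) ^+ 2 * p1 + e * ((1 - zeta s) ^+ 2 * q) * p2).
  by ring.
by rewrite qe; ring.
Qed.

Let normc_ge (w : C) : `|complex.Re w| <= Normc.normc w /\ `|complex.Im w| <= Normc.normc w.
Proof.
case: w => p q /=; split; rewrite -sqrtr_sqr ler_wsqrtr//.
  by rewrite lerDl sqr_ge0.
by rewrite lerDr sqr_ge0.
Qed.

Let normc_real (c : R) : Normc.normc (c%:C)%C = `|c|.
Proof. by rewrite /= expr0n /= addr0 sqrtr_sqr. Qed.

Let normcX (w : C) n : Normc.normc (w ^+ n) = Normc.normc w ^+ n.
Proof.
by elim: n => [|n IH]; rewrite ?expr0 ?Normc.normc1// !exprS Normc.normcM IH.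
Qed.

Let normc_ge0 (w : C) : 0 <= Normc.normc w.
Proof. by case: w => p q; exact: sqrtr_ge0. Qed.

(* [K] bounds [U], because [m] is between [(1 - nz) ^+ 2] and [4], and [x] is at most [2]. *)
Let K : R := (alpha + 1) / 2 * ln 4 + `|t| * (2 / (1 - nz) ^+ 2) - t.

Let nz1 : 0 < 1 - nz. Proof. by rewrite subr_gt0. Qed.

Let normcE_le (s : R) : 0 <= s <= 1 -> Normc.normc (E s) <= expR K.
Proof.
move=> s01; have -> : Normc.normc (E s) = expR (U s).
  by rewrite /= !exprMn -mulrDr cos2Dsin2 mulr1 sqrtr_sqr ger0_norm// expR_ge0.
rewrite ler_expR /U /K lerD2r lerD//.
  by rewrite ler_wpM2l ?divr_ge0 ?addr_ge0 ?(ltW alpha_gt0)// ler_ln ?posrE ?m_gt0 ?m_le.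
have x2 : x s <= 2 by have := sa_le s01; rewrite ler_norml /x => /andP[]; lra.
apply: le_trans (ler_norm _) _; rewrite normrM ler_wpM2l//.
rewrite ger0_norm ?divr_ge0 ?(ltW (x_gt0 s01)) ?(ltW (m_gt0 s01))//.
rewrite ler_pM ?invr_ge0 ?(ltW (x_gt0 s01)) ?(ltW (m_gt0 s01))//.
by rewrite lef_pV2 ?posrE ?m_ge ?m_gt0// exprn_gt0.
Qed.

Let B N : R := expR K / (1 - nz) ^+ 2 *
  ((N.+1%:R + alpha) * `|l N| * nz ^+ N + N.+1%:R * `|l N.+1| * nz ^+ N).

Let cvgB0 : B N @[N --> \oo] --> (0 : R).
Proof.
have nz01 : 0 <= nz < 1 by rewrite nz_ge0.
have sl := subexp_laguerre alpha_gt0 t; have sn := @subexp_natS R.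
have c1 := subexp_cvg0 (subexpM sn sl) nz01.
have c2 := subexp_cvg0 (subexpM (subexp_cst alpha) sl) nz01.
have c3 := subexp_cvg0 (subexpM sn (subexp_shift sl)) nz01.
pose c0 := expR K / (1 - nz) ^+ 2.
rewrite [X in X @ _ --> _](_ : _ = fun N => c0 *
    (`|N.+1%:R * l N| * nz ^+ N + `|alpha * l N| * nz ^+ N +
     `|N.+1%:R * l N.+1| * nz ^+ N)); last first.
  apply/funext => N; rewrite /B -/c0; congr (_ * _).
  by rewrite !normrM !normr_nat (gtr0_norm alpha_gt0); ring.
rewrite -(mulr0 c0); apply: cvgM; first exact: cvg_cst.
rewrite -[X in _ --> X](addr0 0) -[X in _ --> X + _](addr0 0).
by apply: cvgD => //; exact: cvgD.
Qed.

Let h'_le N (s : R) : 0 <= s <= 1 -> Normc.normc (h' N s) <= B N.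
Proof.
move=> s01; have /andP[s0 s1] := s01.
have n2 : Normc.normc ((1 - zeta s) ^+ 2) = m s.
  by rewrite normcX one_sub_zeta /= sqr_sqrtr sqrrN // addr_ge0// sqr_ge0.
have zs : Normc.normc (zeta s) <= nz.
  by rewrite Normc.normcM normc_real ger0_norm// ler_piMl.
have zsN k : Normc.normc (zeta s) ^+ k <= nz ^+ k.
  by rewrite lerXn2r ?nnegrE// normc_ge0.
have key : (1 - nz) ^+ 2 * Normc.normc (h' N s) <= expR K *
    ((N.+1%:R + alpha) * `|l N| * nz ^+ N + N.+1%:R * `|l N.+1| * nz ^+ N).
  apply: le_trans (_ : m s * Normc.normc (h' N s) <= _).
    by rewrite ler_wpM2r ?normc_ge0 ?m_ge.
  rewrite -n2 -Normc.normcM h'_eq// -mulrA Normc.normcM.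
  apply: ler_pM; rewrite ?normc_ge0 ?normcE_le// Normc.normcM.
  apply: le_trans (ler_wpM2r (normc_ge0 _) (ltW z_lt1)) _.
  rewrite mul1r; apply: le_trans (le_normcD _ _) _; rewrite normcN.
  rewrite !Normc.normcM !normc_real !normcX !normrM normr_nat.
  rewrite (ger0_norm (_ : 0 <= N.+1%:R + alpha)) ?addr_ge0 ?(ltW alpha_gt0)//.
  apply: lerD; last by rewrite ler_wpM2l ?mulr_ge0.
  rewrite ler_wpM2l ?mulr_ge0 ?addr_ge0 ?(ltW alpha_gt0)//.
  by apply: le_trans (zsN _) _; rewrite exprS ler_piMl ?exprn_ge0 ?(ltW z_lt1).
by rewrite /B mulrAC ler_pdivlMr ?exprn_gt0// mulrC.
Qed.

Let h0 N : h N 0 = 1.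
Proof.
have m0 : m 0 = 1 by rewrite /m /x /y; ring.
have x0 : x 0 = 1 by rewrite /x; ring.
have y0 : y 0 = 0 by rewrite /y; ring.
have -> : h N 0 = E 0 * (((laguerre_gf N.+1).[0])%:C)%C.
  rewrite /h /zeta; have -> : (0%:C)%C * z = ((0 : R)%:C)%C by rewrite mul0r.
  by rewrite /cpoly horner_map.
have -> : (laguerre_gf N.+1).[0] = 1.
  rewrite /laguerre_gf horner_sum big_nat_recl// big1 => [|i _].
    by rewrite hornerZ hornerXn expr0 mulr1 addr0 horner_laguerre0.
  by rewrite hornerZ hornerXn exprS mul0r mulr0.
rewrite mulr1 /E /U /V m0 x0 y0 ln1 invr1 !mul0r atan0 !mulr0 !mulr1 add0r !subrr.
by rewrite expR0 cos0 sin0 mulr1 mulr0.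
Qed.

Let cvg_h1 : complex.Re (h N 1) @[N --> \oo] --> (1 : R) /\
  complex.Im (h N 1) @[N --> \oo] --> (0 : R).
Proof.
have mvt (f df : R -> R) M : (forall s : R, 0 <= s <= 1 -> is_derive s 1 f (df s)) ->
    (forall s, 0 <= s <= 1 -> `|df s| <= M) -> `|f 1 - f 0| <= M.
  move=> fd dM; have [//|//||c c01 ->] := @MVT _ f df 0 1 _.
  - by move=> s; rewrite in_itv/= => /andP[/ltW s0 /ltW s1]; apply: fd; rewrite s0.
  - apply: derivable_within_continuous => s; rewrite in_itv/= => s01.
    by have [] := fd s s01.
  - rewrite subr0 mulr1; apply: dM; move: c01.
    by rewrite in_itv/= => /andP[/ltW -> /ltW ->].
have re N : `|complex.Re (h N 1) - 1| <= B N.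
  rewrite -[X in _ - X]/(complex.Re (1 : C)) -(h0 N).
  apply: (mvt (fun s => complex.Re (h N s)) (fun s => complex.Re (h' N s))).
    by move=> s /(dh N)[].
  by move=> s /(h'_le N); apply: le_trans; have [] := normc_ge (h' N s).
have im N : `|complex.Im (h N 1) - 0| <= B N.
  rewrite -[X in _ - X]/(complex.Im (1 : C)) -(h0 N).
  apply: (mvt (fun s => complex.Im (h N s)) (fun s => complex.Im (h' N s))).
    by move=> s /(dh N)[].
  by move=> s /(h'_le N); apply: le_trans; have [] := normc_ge (h' N s).
have sq (u : nat -> R) c : (forall N, `|u N - c| <= B N) -> u N @[N --> \oo] --> c.
  move=> uB; apply/subr_cvg0; apply/norm_cvg0P.
  apply: (squeeze_cvgr _ (cvg_cst 0) cvgB0); apply: nearW => N.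
  by rewrite normr_ge0 uB.
by split; exact: sq.
Qed.

(** The generating function is continued from [0] to [z] along a segment: the
    quotient of the partial sum by the closed form is [1] at [0], and its
    derivative tends to [0] uniformly, because both solve the same first order
    equation up to the two last terms of the partial sum. *)
Theorem laguerre_generating_function :
  let u := t - (alpha + 1) / 2 * ln (m 1) - t * (x 1 / m 1) in
  let v := (alpha + 1) * atan (y 1 / x 1) - t * (y 1 / m 1) in
  complex.Re ((cpoly (laguerre_gf N)).[z]) @[N --> \oo] --> expR u * cos v /\
  complex.Im ((cpoly (laguerre_gf N)).[z]) @[N --> \oo] --> expR u * sin v.
Proof.
move=> u v; pose F : C := ((expR u * cos v) +i* (expR u * sin v))%C.
have uU : u = - U 1 by rewrite /u /U; ring.
have vV : v = - V 1 by rewrite /v /V; ring.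
have FE : F * E 1 = 1.
  apply/eqP; rewrite eq_complex /F /E uU vV cosN sinN /=.
  have eU : expR (- U 1) * expR (U 1) = 1 by rewrite -expRD addNr expR0.
  have cs := cos2Dsin2 (V 1).
  apply/andP; split; apply/eqP; last by ring.
  transitivity (expR (- U 1) * expR (U 1) * (cos (V 1) ^+ 2 + sin (V 1) ^+ 2)).
    by ring.
  by rewrite eU cs mulr1.
have GE N : (cpoly (laguerre_gf N.+1)).[z] = F * h N 1.
  by rewrite /h mulrA FE mul1r /zeta -[1%:C%C]/(1 : C) mul1r.
have [hr hi] := cvg_h1.
split; rewrite -cvg_shiftS.
  rewrite [X in X @ _ --> _](_ : _ = fun N => expR u * cos v * complex.Re (h N 1) -
    expR u * sin v * complex.Im (h N 1)); last first.
    by apply/funext => N; rewrite /= GE; case: (h N 1).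
  have : expR u * cos v * complex.Re (h N 1) - expR u * sin v * complex.Im (h N 1)
      @[N --> \oo] --> expR u * cos v * 1 - expR u * sin v * 0.
    by apply: cvgB; (apply: cvgM => //; exact: cvg_cst).
  by rewrite mulr1 mulr0 subr0.
rewrite [X in X @ _ --> _](_ : _ = fun N => expR u * cos v * complex.Im (h N 1) +
  expR u * sin v * complex.Re (h N 1)); last first.
  by apply/funext => N; rewrite /= GE; case: (h N 1).
have : expR u * cos v * complex.Im (h N 1) + expR u * sin v * complex.Re (h N 1)
    @[N --> \oo] --> expR u * cos v * 0 + expR u * sin v * 1.
  by apply: cvgD; (apply: cvgM => //; exact: cvg_cst).
by rewrite mulr1 mulr0 add0r.
Qed.

End GeneratingFunction.

Section RealGeneratingFunction.
Variables (R : realType) (alpha : R).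
Hypothesis alpha_gt0 : 0 < alpha.

(** This is [(1 - q) ^ (- alpha - 1)], as the modulus in the complex formula. *)
Definition gf_scale (q : R) : R := expR (- ((alpha + 1) / 2 * ln ((1 - q) ^+ 2))).

Lemma laguerre_generating_function_real (t q : R) : `|q| < 1 ->
  series (fun n => (laguerre alpha n).[t] * q ^+ n) N @[N --> \oo] -->
  gf_scale q * expR (- (q / (1 - q) * t)).
Proof.
move=> q1; have z1 : Normc.normc (q%:C)%C < 1.
  by rewrite /= expr0n /= addr0 sqrtr_sqr.
have [+ _] := laguerre_generating_function t alpha_gt0 z1.
rewrite /= !mulr0 !mul0r expr0n /= !addr0 atan0 !mulr0 subrr cos0 mulr1 mul1r.
have -> : expR (t - (alpha + 1) / 2 * ln ((1 - q) ^+ 2) - t * ((1 - q) / (1 - q) ^+ 2)) =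
    gf_scale q * expR (- (q / (1 - q) * t)).
  rewrite -expRD; congr expR.
  have q0 : 1 - q != 0.
    by rewrite gt_eqF// subr_gt0; apply: le_lt_trans q1; exact: ler_norm.
  by move: (ln _) => L; field.
apply: cvg_trans; apply: near_eq_cvg; apply: nearW => N.
rewrite /cpoly horner_map /= /laguerre_gf horner_sum.
by apply: eq_bigr => n _; rewrite hornerZ hornerXn.
Qed.

End RealGeneratingFunction.

(** * Totality of the Laguerre polynomials *)

Section LaguerreTotal.
Variables (R : realType) (alpha : R).
Hypothesis alpha_gt0 : 0 < alpha.
Local Notation mu := (@lebesgue_measure R).
Local Notation w := (weight alpha).
Local Notation L2w := (wL2 mu (@Rpos R) w).
Local Notation ip := (wip mu (@Rpos R) w).
Local Notation nrm := (wnorm mu (@Rpos R) w).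
Local Notation lag := (laguerre alpha).
Local Notation sqn := (laguerre_sqn alpha).

Let mD := @measurable_Rpos R.
Let mw : measurable_fun (@Rpos R) w := @measurable_weight R alpha _.
Let w_gt0 := @weight_gt0 R alpha.

Definition laguerre_on n (x : R) : R := (Num.sqrt (sqn n))^-1 * (lag n).[x].

Lemma wL2_laguerre_on n : L2w (laguerre_on n).
Proof. by apply: wL2Z => //; exact: wL2_poly. Qed.

Lemma laguerre_on_orth n m : ip (laguerre_on n) (laguerre_on m) = (n == m)%:R.
Proof.
have Ln k := wL2_poly alpha_gt0 (lag k).
rewrite wipZl ?wipZr ?wip_laguerre//; last exact: wL2Z.
have [->|nm] := eqVneq n m; last by rewrite mul0r !mulr0.
have h0 := laguerre_sqn_gt0 alpha_gt0 m.
rewrite mul1r -[X in _ * (_ * X)](sqr_sqrtr (ltW h0)).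
by rewrite -[RHS]/(1 : R); field; rewrite sqrtr_eq0 -ltNge.
Qed.

Lemma laguerreE n (x : R) : (lag n).[x] = Num.sqrt (sqn n) * laguerre_on n x.
Proof.
by rewrite mulrA divff ?mul1r// sqrtr_eq0 -ltNge laguerre_sqn_gt0.
Qed.

Lemma wnorm_laguerre_on n : nrm (laguerre_on n) = 1.
Proof. by rewrite /wnorm laguerre_on_orth eqxx sqrtr1. Qed.

Lemma subexp_laguerre_on (t : R) : subexp (fun n => laguerre_on n t).
Proof.
exact: subexpM (subexp_laguerre_normV alpha_gt0) (subexp_laguerre alpha_gt0 t).
Qed.

(** The [laguerre_on n] are unit vectors, so the geometric bound makes the norms of the
    terms summable: the pointwise sum can be paired term by term. *)
Lemma laguerre_on_series (c : nat -> R) (C s : R) (S : R -> R) :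
  0 <= s < 1 -> (forall n, `|c n| <= C * s ^+ n) -> measurable_fun (@Rpos R) S ->
  (forall t, Rpos t -> series (fun n => c n * laguerre_on n t) N @[N --> \oo] --> S t) ->
  L2w S /\ forall h, L2w h ->
    series (fun n => c n * ip (laguerre_on n) h) N @[N --> \oo] --> ip S h.
Proof.
move=> /andP[s0 s1] cC mS cS.
have Lg n : L2w (fun x => c n * laguerre_on n x).
  by apply: wL2Z => //; exact: wL2_laguerre_on.
have sg : cvgn (series (fun n => nrm (fun x => c n * laguerre_on n x))).
  have : cvgn (series (geometric C s)).
    by apply: is_cvg_geometric_series; rewrite ger0_norm.
  apply: series_le_cvg => n; first exact: wnorm_ge0.
    by apply: le_trans (cC n).
  by rewrite wnormZ ?wnorm_laguerre_on ?mulr1//; exact: wL2_laguerre_on.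
have aS : {ae mu, forall t, Rpos t ->
    series (fun n => c n * laguerre_on n t) N @[N --> \oo] --> S t}.
  exact: aeW.
split; first exact: (wL2_series_lim mD mw w_gt0 Lg sg mS aS).
move=> h Lh; have := wip_series_lim mD mw w_gt0 Lg sg mS aS Lh.
apply: cvg_trans; apply: near_eq_cvg; apply: nearW => N.
by apply: eq_bigr => n _; rewrite wipZl//; exact: wL2_laguerre_on.
Qed.

Let expfun (s t : R) : R := expR (- (s * t)).

(** For [q = s / (1 + s)] one has [q / (1 - q) = s], so that [expfun s] is proportional to the
    sum of a Laguerre series, by the generating function. *)
Let expfun_total (s : R) : 0 <= s -> L2w (expfun s) /\
  forall f, L2w f -> (forall n, ip (laguerre_on n) f = 0) -> ip (expfun s) f = 0.
Proof.
move=> s0; pose q := s / (1 + s).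
have s1 : 1 + s != 0 by rewrite gt_eqF// ltr_wpDr.
have q0 : 0 <= q by rewrite divr_ge0// addr_ge0.
have q1 : q < 1 by rewrite ltr_pdivrMr ?mul1r ?ltrDr// ltr_wpDr.
have qs : q / (1 - q) = s by rewrite /q; field; rewrite s1 addrK oner_eq0.
have [r r01 [C C0 hC]] := subexp_geometric (subexp_laguerre_norm alpha_gt0)
  (introT andP (conj q0 q1)).
have mE : measurable_fun (@Rpos R) (expfun s).
  apply: measurable_funTS; apply: measurableT_comp => //.
  by apply: measurableT_comp => //; exact: measurable_funM.
have [|||LS ipS] := @laguerre_on_series (fun n => Num.sqrt (sqn n) * q ^+ n) C r
  (fun t => gf_scale alpha q * expfun s t) r01.
- by move=> n; rewrite normrM [`|q ^+ n|]ger0_norm ?exprn_ge0.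
- by apply: measurable_funM.
- move=> t _; have := @laguerre_generating_function_real _ _ alpha_gt0 t q.
  rewrite ger0_norm// qs => /(_ q1); apply: cvg_trans; apply: near_eq_cvg.
  apply: nearW => N; apply: eq_bigr => n _.
  by rewrite laguerreE mulrAC.
have c0 : gf_scale alpha q != 0 by rewrite gt_eqF ?expR_gt0.
have LE : L2w (expfun s).
  have := wL2Z mD mw (gf_scale alpha q)^-1 LS; congr wL2.
  by apply/funext => t; rewrite mulrA mulVf ?mul1r.
split=> // f Lf f0; have := ipS f Lf.
rewrite wipZl// => /cvg_lim; rewrite (_ : series _ = cst 0).
  rewrite lim_cst// => /(_ (@Rhausdorff R))/esym/eqP.
  by rewrite mulf_eq0 (negbTE c0) => /eqP.
by apply/funext => N; rewrite /series /= big1// => n _; rewrite f0 mulr0.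
Qed.

Variable f : R -> R.
Hypotheses (Lf : L2w f) (f_orth : forall n, ip (laguerre_on n) f = 0).

Let u (t : R) : R := f t * w t.

Let mu_u : measurable_fun (@Rpos R) u.
Proof. by apply: measurable_funM => //; case: Lf. Qed.

Let integrable_u : mu.-integrable (@Rpos R) (EFin \o u).
Proof.
have [L0 _] := expfun_total (lexx 0).
have := wL2_integrable mD mw L0 Lf; apply: eq_integrable => // x _ /=.
by rewrite /expfun mul0r oppr0 expR0 mul1r.
Qed.

(** The outer exponential is expanded in powers of [exp (N * (a - t))]: each term is a
    multiple of an [expfun], and the partial sums are at most [exp (exp (N * a))]. *)
Let int_double_exp (a : R) (N : nat) :
  \int[mu]_(t in @Rpos R) (expR (- expR (N%:R * (a - t))) * u t) = 0.
Proof.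
pose c := - expR (N%:R * a).
pose e (J : nat) (t : R) : R := series (exp_coeff (- expR (N%:R * (a - t)))) J.
have eE J t : e J t = \sum_(0 <= j < J) (c ^+ j / j`!%:R) * expfun (N%:R * j%:R) t.
  rewrite /e /series; apply: eq_bigr => j _.
  have -> : - expR (N%:R * (a - t)) = c * expR (- (N%:R * t)).
    by rewrite mulrBr expRD mulNr.
  rewrite /exp_coeff /= exprMn -expRM_natl [RHS]mulrAC; congr (_ * _ / _).
  by rewrite /expfun; congr expR; ring.
have Lterm j : L2w (fun t => (c ^+ j / j`!%:R) * expfun (N%:R * j%:R) t).
  by apply: wL2Z => //; have [] := expfun_total (_ : 0 <= N%:R * j%:R :> R).
have Le J : L2w (e J).
  have := wL2_sum mD mw (index_iota 0 J) Lterm; congr wL2.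
  by apply/funext => t; rewrite eE.
have ip0 J : ip (e J) f = 0.
  rewrite (_ : e J = fun t => \sum_(0 <= j < J) (c ^+ j / j`!%:R) * expfun (N%:R * j%:R) t).
    rewrite wip_suml// big1// => j _; rewrite wipZl//; last first.
      by have [] := expfun_total (_ : 0 <= N%:R * j%:R :> R).
    have [|_ h] := expfun_total (_ : 0 <= N%:R * j%:R :> R); first exact: mulr_ge0.
    by rewrite h ?mulr0.
  by apply/funext => t; rewrite eE.
have me J : measurable_fun (@Rpos R) (fun t => (e J t * u t)%:E).
  apply/measurable_EFinP; apply: measurable_funM => //.
  by case: (Le J).
have [||||_ _ +] := @dominated_convergence _ _ _ mu _ mD _
  (EFin \o (fun t => expR (- expR (N%:R * (a - t))) * u t))
  (fun t => (expR (expR (N%:R * a)))%:E * `|(EFin \o u) t|)%E me.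
- apply/measurable_EFinP; apply: measurable_funM => //.
  apply: measurable_funTS; do 3 (apply: measurableT_comp => //).
  by apply: measurable_funM => //; exact: measurable_funB.
- apply/aeW => t _; apply: cvg_EFin; first exact: nearW.
  by apply: cvgM; [exact: is_cvg_series_exp_coeff | exact: cvg_cst].
- by apply: integrableZl => //; exact: integrable_abse.
- apply/aeW => t J t0 /=; rewrite -EFinM lee_fin normrM ler_wpM2r//.
  apply: le_trans (_ : series (exp_coeff (expR (N%:R * (a - t)))) J <= _).
    have := normed_series_exp_coeff (- expR (N%:R * (a - t))).
    rewrite normrN (ger0_norm (expR_ge0 (N%:R * (a - t)))) => <-.
    exact: ler_norm_sum.
  apply: le_trans (_ : expR (expR (N%:R * (a - t))) <= _).
    apply: nondecreasing_cvgn_le; last exact: is_cvg_series_exp_coeff.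
    move=> i j ij; rewrite -subr_ge0 sub_series_geq// sumr_ge0// => k _.
    by rewrite /exp_coeff /= divr_ge0// exprn_ge0// expR_ge0.
  by rewrite !ler_expR ler_wpM2l// lerBlDr lerDl ltW.
move=> cv; rewrite /Rintegral.
have : (fun n => \int[mu]_(t in @Rpos R) (e n t * u t)%:E)%E = cst 0%E.
  apply/funext => J.
  rewrite -[LHS]fineK.
    congr EFin; rewrite -[RHS](ip0 J) /wip /Rintegral; congr fine.
    by apply: eq_integral => t _; rewrite mulrA.
  apply: integrable_fin_num => //.
  have := wL2_integrable mD mw (Le J) Lf; apply: eq_integrable => // t _ /=.
  by rewrite -mulrA.
move=> eq0; move: cv; rewrite eq0 => /cvg_lim; rewrite lim_cst// => <-//.
Qed.

Let half_indic (a t : R) : R := ((t <= a)%R : nat)%:R.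

Let cvg_double_exp (a t : R) : t != a ->
  1 - expR (- expR (N%:R * (a - t))) @[N --> \oo] --> half_indic a t.
Proof.
rewrite /half_indic; case: ltgtP => // [ta|at_] _.
  rewrite -[X in _ --> X]subr0; apply: cvgB; first exact: cvg_cst.
  apply: (@squeeze_cvgr _ _ _ _ (cst 0) (fun N : nat => expR (- (a - t)) ^+ N)).
  - apply: nearW => N; rewrite expR_ge0/= -expRM_natl ler_expR mulrN lerN2.
    by apply: le_trans (expR_ge1Dx _); rewrite lerDr.
  - exact: cvg_cst.
  - have := @cvg_geometric R 1 (expR (- (a - t))); rewrite /geometric /=.
    under eq_fun do rewrite mul1r.
    by apply; rewrite ger0_norm ?expR_ge0// expR_lt1 oppr_lt0 subr_gt0.
rewrite -[X in _ --> X](subrr 1); apply: cvgB; first exact: cvg_cst.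
have c0 : {for 0, continuous (fun x : R => expR (- x))}.
  by apply: continuous_comp; [exact: opp_continuous | exact: continuous_expR].
have h : expR (N%:R * (a - t)) @[N --> \oo] --> (0 : R).
  have := @cvg_geometric R 1 (expR (a - t)); rewrite /geometric /=.
  under eq_fun do rewrite mul1r -expRM_natl.
  by apply; rewrite ger0_norm ?expR_ge0// expR_lt1 subr_lt0.
have := cvg_comp _ _ h c0; rewrite oppr0 expR0; exact.
Qed.

Let int_half (a : R) : \int[mu]_(t in @Rpos R) (half_indic a t * u t) = 0.
Proof.
pose e (N : nat) (t : R) : R := (1 - expR (- expR (N%:R * (a - t)))) * u t.
have mexp N : measurable_fun (@Rpos R) (fun t => expR (- expR (N%:R * (a - t)))).
  apply: measurable_funTS; do 3 (apply: measurableT_comp => //).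
  by apply: measurable_funM => //; exact: measurable_funB.
have me N : measurable_fun (@Rpos R) (fun t => (e N t)%:E).
  by apply/measurable_EFinP; apply: measurable_funM => //; exact: measurable_funB.
have e01 (N : nat) (t : R) : 0 <= expR (- expR (N%:R * (a - t))) <= 1.
  by rewrite expR_ge0 -[leRHS]expR0 ler_expR oppr_le0 expR_ge0.
have Ie N : mu.-integrable (@Rpos R) (EFin \o (fun t => expR (- expR (N%:R * (a - t))) * u t)).
  apply: le_integrable integrable_u => //.
    by apply/measurable_EFinP; apply: measurable_funM; [exact: mexp | exact: mu_u].
  move=> t t0 /=; rewrite lee_fin normrM ler_piMl//.
  by have /andP[? ?] := e01 N t; rewrite ger0_norm.
have int0 : \int[mu]_(t in @Rpos R) u t = 0.
  have := int_double_exp 0 0; under eq_Rintegral do rewrite mul0r expR0.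
  by rewrite RintegralZl// => /eqP; rewrite mulf_eq0 (gt_eqF (expR_gt0 _)) => /eqP.
have inte N : \int[mu]_(t in @Rpos R) (e N t) = 0.
  rewrite /e; under eq_Rintegral do rewrite mulrBl mul1r.
  by rewrite RintegralB// int0 int_double_exp subrr.
have [||||I _ +] := @dominated_convergence _ _ _ mu _ mD _
  (EFin \o (fun t => half_indic a t * u t))
  (fun t => `|(EFin \o u) t|)%E me.
- apply/measurable_EFinP; apply: measurable_funM => //.
  rewrite (_ : half_indic a = \1_(`]-oo, a]%classic : set R)).
    by apply: measurable_funTS; apply: measurable_indic; exact: measurable_itv.
  apply/funext => t; rewrite /half_indic indicE; congr (_%:R); congr nat_of_bool.
  by apply/idP/idP => [ta|]; rewrite ?inE//= in_itv.
- have : {ae mu, forall t, t != a}.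
    exists [set a]; split; [exact: measurable_set1 | exact: lebesgue_measure_set1|].
    by move=> t /= /negP; rewrite negbK => /eqP.
  apply: (@filterS _ _ (ae_filter_ringOfSetsType mu)) => t ta _.
  apply: cvg_EFin; first exact: nearW.
  by apply: cvgM; [exact: cvg_double_exp | exact: cvg_cst].
- exact: integrable_abse.
- apply/aeW => t N t0 /=; rewrite lee_fin normrM ler_piMl//.
  by have /andP[? ?] := e01 N t; rewrite ger0_norm ?subr_ge0// gerBl.
move=> cv; rewrite /Rintegral.
have eq0 : (fun n => \int[mu]_(t in @Rpos R) (e n t)%:E)%E = cst 0%E.
  apply/funext => N; rewrite -[LHS]fineK; first by congr EFin; exact: inte.
  apply: integrable_fin_num => //.
  have := integrableB mD integrable_u (Ie N); apply: eq_integrable => // t _ /=.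
  by rewrite -EFinB /e mulrBl mul1r.
by move: cv; rewrite eq0 => /cvg_lim; rewrite lim_cst// => <-.
Qed.

(* The extension by zero, to which the differentiation theorem applies. *)
Let v : R -> R := u \_ (@Rpos R).

Let integrable_v (A : set R) : measurable (A : set (measurableTypeR R)) ->
  mu.-integrable A (EFin \o v).
Proof.
move=> mA; have : mu.-integrable setT (EFin \o v).
  by rewrite -restrict_EFin -integrable_mkcond.
by apply: integrableS => //; exact: measurableT.
Qed.

Let int_v (a : R) : \int[mu]_(t in `]-oo, a]) v t = 0.
Proof.
rewrite Rintegral_mkcond -(int_half a) [RHS]Rintegral_mkcond.
apply: eq_Rintegral => t _; rewrite /v !patchE /half_indic.
have -> : (t \in `]-oo, a]%classic) = (t <= a) by rewrite mem_setE in_itv.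
by case: (t \in @Rpos R); case: (t <= a); rewrite ?mul1r ?mul0r.
Qed.

(** The indefinite integral of [f * w] vanishes, hence so does its derivative, which is
    [f * w] almost everywhere. *)
Theorem laguerre_on_total : {ae mu, forall t, Rpos t -> f t = 0}.
Proof.
have loc : locally_integrable [set: R] v.
  exact: integrable_locally mD integrable_u.
have Iv y : mu.-integrable `]-oo, y] (EFin \o v).
  by apply: integrable_v; exact: measurable_itv.
apply: (@filterS _ _ (ae_filter_ringOfSetsType mu) _ _ _ (FTC1Ny Iv loc)) => t /= [_ +] t0.
rewrite (_ : (fun x : R => _) = cst 0); last by apply/funext => x; exact: int_v.
rewrite derive1_cst /v patchE mem_set// => /esym/eqP.
by rewrite mulf_eq0 [w t == 0]gt_eqF ?w_gt0// orbF => /eqP.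
Qed.

End LaguerreTotal.

(** * Norm and convergence in the quaternions *)

Section QuaternionNorm.
Variable R : realType.
Local Notation H := (quat R).
Implicit Types p q r : H.

Lemma qsqnE q : `|q| ^+ 2 = qsqn q.
Proof. by rewrite [`|q|]/(qnorm q) sqr_sqrtr// qsqn_ge0. Qed.

Lemma qsqnM p q : qsqn (p * q) = qsqn p * qsqn q.
Proof. by rewrite /qsqn /=; ring. Qed.

Lemma qnormM p q : `|p * q| = `|p| * `|q|.
Proof.
by rewrite -[LHS]/(qnorm _) /qnorm qsqnM sqrtrM// qsqn_ge0.
Qed.

Lemma qnorm1 : `|1 : H| = 1.
Proof. by rewrite -[LHS]/(Num.sqrt _) /qsqn /= expr1n expr0n /= !addr0 sqrtr1. Qed.

Lemma qnormX q n : `|q ^+ n| = `|q| ^+ n.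
Proof.
by elim: n => [|n IH]; rewrite ?expr0 ?qnorm1// !exprS qnormM IH.
Qed.

Lemma qnorm_conj q : `|qconj q| = `|q|.
Proof. by congr Num.sqrt; rewrite /qsqn /= !sqrrN. Qed.

Lemma qconjM p q : qconj (p * q) = qconj q * qconj p.
Proof. by congr Quat; rewrite /=; ring. Qed.

Lemma qconj_mul q : qconj q * q = (`|q| ^+ 2)%:A.
Proof. by rewrite qsqnE; congr Quat; rewrite /qsqn /=; ring. Qed.

Lemma qcomp_le q : [/\ `|qre q| <= `|q|, `|qi q| <= `|q|, `|qj q| <= `|q| & `|qk q| <= `|q|].
Proof.
have h (x : R) : x ^+ 2 <= qsqn q -> `|x| <= `|q|.
  by rewrite -sqrtr_sqr; exact: ler_wsqrtr.
have := sqr_ge0 (qre q); have := sqr_ge0 (qi q).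
have := sqr_ge0 (qj q); have := sqr_ge0 (qk q).
by split; apply: h; rewrite /qsqn; lra.
Qed.

Lemma qnorm_le_sum q : `|q| <= `|qre q| + `|qi q| + `|qj q| + `|qk q|.
Proof.
have n0 := normr_ge0; rewrite -ler_sqr ?nnegrE ?addr_ge0// qsqnE /qsqn.
rewrite -(real_normK (num_real (qre q))) -(real_normK (num_real (qi q))).
rewrite -(real_normK (num_real (qj q))) -(real_normK (num_real (qk q))).
move: (n0 _ _ (qre q)) (n0 _ _ (qi q)) (n0 _ _ (qj q)) (n0 _ _ (qk q)).
move: `|_| `|_| `|_| `|_| => a b c d a0 b0 c0 d0.
by have := mulr_ge0 a0 b0; have := mulr_ge0 a0 c0; have := mulr_ge0 a0 d0;
  have := mulr_ge0 b0 c0; have := mulr_ge0 b0 d0; have := mulr_ge0 c0 d0; nra.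
Qed.

Lemma qcvg_comp (u : nat -> H) (l : H) :
  qre (u n) @[n --> \oo] --> qre l -> qi (u n) @[n --> \oo] --> qi l ->
  qj (u n) @[n --> \oo] --> qj l -> qk (u n) @[n --> \oo] --> qk l ->
  u n @[n --> \oo] --> l.
Proof.
move=> c0 c1 c2 c3; apply/subr_cvg0; apply/norm_cvg0P.
have d (f : nat -> R) (c : R) : f n @[n --> \oo] --> c -> `|f n - c| @[n --> \oo] --> (0 : R).
  by move=> /subr_cvg0/cvg_norm; rewrite normr0.
apply: (@squeeze_cvgr _ _ _ _ (cst 0) (fun n => `|qre (u n) - qre l| +
  `|qi (u n) - qi l| + `|qj (u n) - qj l| + `|qk (u n) - qk l|)).
- by apply: nearW => n; rewrite normr_ge0/=; exact: qnorm_le_sum.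
- exact: cvg_cst.
- rewrite -[X in _ --> X](addr0 0) -[X in _ --> X + _](addr0 0) -[X in _ --> X + _ + _](addr0 0).
  by do 3 (apply: cvgD; last exact: d); exact: d.
Qed.

Lemma qcvg_compP (u : nat -> H) (l : H) : u n @[n --> \oo] --> l ->
  [/\ qre (u n) @[n --> \oo] --> qre l, qi (u n) @[n --> \oo] --> qi l,
      qj (u n) @[n --> \oo] --> qj l & qk (u n) @[n --> \oo] --> qk l].
Proof.
move=> /subr_cvg0/cvg_norm; rewrite normr0 => ul.
have d (f : nat -> R) (c : R) : (forall n, `|f n - c| <= `|u n - l|) -> f n @[n --> \oo] --> c.
  move=> h; apply/subr_cvg0; apply/norm_cvg0P.
  by apply: (squeeze_cvgr _ (cvg_cst 0) ul); apply: nearW => n; rewrite normr_ge0 h.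
by split; apply: d => n; have [] := qcomp_le (u n - l).
Qed.

Lemma qcvg_unique (u : nat -> H) (l m : H) :
  u n @[n --> \oo] --> l -> u n @[n --> \oo] --> m -> l = m.
Proof.
move=> /qcvg_compP[a0 a1 a2 a3] /qcvg_compP[b0 b1 b2 b3].
have un (f : nat -> R) (c d : R) : f n @[n --> \oo] --> c -> f n @[n --> \oo] --> d -> c = d.
  by move=> /cvg_lim <- // /cvg_lim <-.
move: (un _ _ _ a0 b0) (un _ _ _ a1 b1) (un _ _ _ a2 b2) (un _ _ _ a3 b3).
by case: l {a0 a1 a2 a3} => ? ? ? ?; case: m {b0 b1 b2 b3} => ? ? ? ? /= -> -> -> ->.
Qed.

Lemma qcvgMl (p : H) (u : nat -> H) (l : H) :
  u n @[n --> \oo] --> l -> p * u n @[n --> \oo] --> p * l.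
Proof.
move=> /subr_cvg0/cvg_norm; rewrite normr0 => ul.
apply/subr_cvg0/norm_cvg0P.
under eq_fun do rewrite -mulrBr qnormM.
by rewrite -(mulr0 `|p|); apply: cvgM; first exact: cvg_cst.
Qed.

Lemma qre_sum (u : nat -> H) n : qre (series u n) = series (qre \o u) n.
Proof. exact: (big_morph (@qre R) (id1 := 0) (op1 := +%R)). Qed.
Lemma qi_sum (u : nat -> H) n : qi (series u n) = series (qi \o u) n.
Proof. exact: (big_morph (@qi R) (id1 := 0) (op1 := +%R)). Qed.
Lemma qj_sum (u : nat -> H) n : qj (series u n) = series (qj \o u) n.
Proof. exact: (big_morph (@qj R) (id1 := 0) (op1 := +%R)). Qed.
Lemma qk_sum (u : nat -> H) n : qk (series u n) = series (qk \o u) n.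
Proof. exact: (big_morph (@qk R) (id1 := 0) (op1 := +%R)). Qed.

Lemma qseries_cvg (u : nat -> H) (l : H) :
  series (qre \o u) n @[n --> \oo] --> qre l -> series (qi \o u) n @[n --> \oo] --> qi l ->
  series (qj \o u) n @[n --> \oo] --> qj l -> series (qk \o u) n @[n --> \oo] --> qk l ->
  series u n @[n --> \oo] --> l.
Proof.
move=> c0 c1 c2 c3; apply: qcvg_comp.
- by under eq_fun do rewrite qre_sum.
- by under eq_fun do rewrite qi_sum.
- by under eq_fun do rewrite qj_sum.
- by under eq_fun do rewrite qk_sum.
Qed.

Lemma qseries_cvgP (u : nat -> H) (l : H) : series u n @[n --> \oo] --> l ->
  [/\ series (qre \o u) n @[n --> \oo] --> qre l, series (qi \o u) n @[n --> \oo] --> qi l,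
      series (qj \o u) n @[n --> \oo] --> qj l & series (qk \o u) n @[n --> \oo] --> qk l].
Proof.
move=> /qcvg_compP[]; under eq_fun do rewrite qre_sum.
under [in X in _ -> X -> _]eq_fun do rewrite qi_sum.
under [in X in _ -> _ -> X -> _]eq_fun do rewrite qj_sum.
under [in X in _ -> _ -> _ -> X -> _]eq_fun do rewrite qk_sum.
by [].
Qed.

End QuaternionNorm.

(** * Identity theorem for real power series *)

Section PowerSeriesUniqueness.
Variable R : realType.

(** Convergence at [1 / 2] bounds [b n] by [M * 2 ^+ n]. For [r <= 1 / 4] the terms other
    than [b 0] then add up to at most [4 * M * r], and [r] tends to [0]. *)
Let coef0 (b : nat -> R) :
  (forall r : R, 0 < r < 1 -> series (fun n => b n * r ^+ n) N @[N --> \oo] --> (0 : R)) ->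
  b 0%N = 0.
Proof.
move=> hb; have half01 : 0 < (2^-1 : R) < 1 by lra.
have c0 : cvgn (series (fun n => b n * 2^-1 ^+ n)).
  by apply/cvg_ex; exists 0; exact: hb half01.
have /cvg_seq_bounded[M0 [_ /(_ (M0 + 1))]] : cvgn (fun n => b n * 2^-1 ^+ n).
  by apply/cvg_ex; exists 0; exact: cvg_series_cvg_0 c0.
rewrite ltrDl ltr01 => /(_ isT) hM; set M := M0 + 1 in hM.
have bM n : `|b n| <= M * 2 ^+ n.
  have : `|b n * 2^-1 ^+ n| <= M by exact: (hM n I).
  rewrite normrM exprVn normrV ?unitfE ?expf_neq0// (ger0_norm (exprn_ge0 _ _))//.
  by rewrite ler_pdivrMr ?exprn_gt0.
have M0' : 0 <= M by have := bM 0%N; rewrite expr0 mulr1; exact: le_trans.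
have small (r : R) : 0 < r <= 4^-1 -> `|b 0%N| <= 4 * M * r.
  move=> /andP[r0 r4]; have r01 : 0 < r < 1 by rewrite r0/=; lra.
  have part N : `|series (fun n => b n * r ^+ n) N.+1 - b 0%N| <= 4 * M * r.
    rewrite /series /= big_nat_recl// expr0 mulr1 addrC addKr.
    apply: le_trans (ler_norm_sum _ _ _) _.
    apply: le_trans (_ : \sum_(0 <= n < N) (2 * M * r) * (2 * r) ^+ n <= _).
      apply: ler_sum => n _; rewrite normrM (ger0_norm (exprn_ge0 _ (ltW r0))).
      apply: le_trans (ler_wpM2r (exprn_ge0 _ (ltW r0)) (bM _)) _.
      by rewrite le_eqVlt; apply/orP; left; apply/eqP; rewrite exprMn !exprS; ring.
    rewrite -mulr_sumr (_ : 4 * M * r = 2 * M * r * 2); last by ring.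
    rewrite ler_wpM2l ?mulr_ge0 ?(ltW r0)// big_mkord.
    have /esym := subrX1 (2 * r) N => geo.
    have g : (1 - 2 * r) * (\sum_(i < N) (2 * r) ^+ i) = 1 - (2 * r) ^+ N.
      by rewrite -[RHS]opprB -geo; ring.
    have : (1 - 2 * r) * (\sum_(i < N) (2 * r) ^+ i) <= 1.
      by rewrite g gerBl exprn_ge0// mulr_ge0// ltW.
    have : 0 <= \sum_(i < N) (2 * r) ^+ i.
      by apply: sumr_ge0 => i _; rewrite exprn_ge0// mulr_ge0// ltW.
    by move: (\sum_(i < N) _) => S; nra.
  have cv : `|series (fun n => b n * r ^+ n) N.+1 - b 0%N| @[N --> \oo] --> `|0 - b 0%N|.
    apply: cvg_norm; apply: cvgB; last exact: cvg_cst.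
    by have := hb r r01; rewrite -cvg_shiftS.
  rewrite -(normrN (b 0%N)) -(sub0r (b 0%N)) -(cvg_lim _ cv)//; apply: limr_le.
    by apply/cvg_ex; eexists; exact: cv.
  by apply: nearW => N; exact: part.
apply/eqP; rewrite -normr_le0; apply/ler_addgt0Pr => e e0; rewrite add0r.
pose r := Num.min 4^-1 (e / (4 * M + 1)).
have d0 : 0 < 4 * M + 1 by lra.
have r0 : 0 < r by rewrite lt_min invr_gt0 ltr0n /= divr_gt0.
have : r <= e / (4 * M + 1) by rewrite ge_min lexx orbT.
rewrite ler_pdivlMr// => re.
by apply: le_trans (small r _) _; [rewrite r0 ge_min lexx | nra].
Qed.

Lemma power_series_eq0 (b : nat -> R) :
  (forall r : R, 0 < r < 1 -> series (fun n => b n * r ^+ n) N @[N --> \oo] --> (0 : R)) ->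
  forall n, b n = 0.
Proof.
move=> hb n; elim: n b hb => [|n IH] b hb; first exact: coef0.
apply: (IH (fun n => b n.+1)) => r r01; have b0 := coef0 hb.
have r0 : r != 0 by case/andP: r01 => /gt_eqF ->.
have := hb r r01; rewrite -cvg_shiftS => /(cvgM (cvg_cst r^-1)).
rewrite mulr0; apply: cvg_trans; apply: near_eq_cvg; apply: nearW => N.
rewrite /= /series /= big_nat_recl// b0 mul0r add0r mulr_sumr.
by apply: eq_bigr => i _; rewrite exprS mulrCA mulKf.
Qed.

End PowerSeriesUniqueness.

(** * Complex slices of the quaternions *)

Section Slice.
Variable R : realType.
Local Notation H := (quat R).
Local Notation C := R[i].
Variables (j1 j2 j3 : R).
Hypothesis j_unit : j1 ^+ 2 + j2 ^+ 2 + j3 ^+ 2 = 1.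

(** The copy of the complex plane spanned by [1] and the imaginary unit with
    coordinates [j1], [j2], [j3]. *)
Definition slice (z : C) : H :=
  Quat (complex.Re z) (complex.Im z * j1) (complex.Im z * j2) (complex.Im z * j3).

Lemma sliceD z z' : slice (z + z') = slice z + slice z'.
Proof. by case: z z' => a b [c d]; congr Quat; rewrite /= ?mulrDl. Qed.

Lemma sliceM z z' : slice (z * z') = slice z * slice z'.
Proof.
case: z z' => a b [c d]; congr Quat; rewrite /=; last 3 first; try by ring.
transitivity (a * c - b * d * (j1 ^+ 2 + j2 ^+ 2 + j3 ^+ 2)); last by ring.
by rewrite j_unit mulr1.
Qed.

Lemma slice_real (c : R) : slice (c%:C)%C = c%:A.
Proof. by congr Quat; rewrite /= ?mul0r ?mulr0 ?mulr1. Qed.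

Lemma slice1 : slice 1 = 1.
Proof. by rewrite -[1]/((1%:C)%C) slice_real scale1r. Qed.

Lemma sliceX z n : slice (z ^+ n) = slice z ^+ n.
Proof.
by elim: n => [|n IH]; rewrite ?expr0 ?slice1// !exprS sliceM IH.
Qed.

Lemma sliceZ (c : R) z : slice ((c%:C)%C * z) = c *: slice z.
Proof. by rewrite sliceM slice_real mulr_algl. Qed.

Lemma slice_sum (I : Type) (s : seq I) (F : I -> C) :
  slice (\sum_(i <- s) F i) = \sum_(i <- s) slice (F i).
Proof.
apply: (big_morph slice sliceD).
by congr Quat; rewrite /= mul0r.
Qed.

Lemma slice_norm z : `|slice z| = Normc.normc z.
Proof.
case: z => a b /=; congr Num.sqrt; rewrite /qsqn /=.
transitivity (a ^+ 2 + b ^+ 2 * (j1 ^+ 2 + j2 ^+ 2 + j3 ^+ 2)); first by ring.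
by rewrite j_unit mulr1.
Qed.

Lemma slice_imnorm z : `|qim (slice z)| = `|complex.Im z|.
Proof.
have -> : qim (slice z) = slice (0 +i* complex.Im z)%C by [].
by rewrite slice_norm /= expr0n /= add0r sqrtr_sqr.
Qed.

(** The sign of the imaginary part cancels, the cosine being even and the sine odd; a real
    argument relies on [0^-1 = 0]. *)
Lemma qexp_slice z : qexp (slice z) = slice
  ((expR (complex.Re z) * cos (complex.Im z)) +i*
   (expR (complex.Re z) * sin (complex.Im z)))%C.
Proof.
rewrite /qexp slice_imnorm; case: z => a b /=.
have cb : cos `|b| = cos b by case: (ger0P b) => _; rewrite ?cosN.
have sb : sin `|b| / `|b| * b = sin b.
  have [->|b0] := eqVneq b 0; first by rewrite normr0 mulr0 sin0.
  case: (ger0P b) => _; first by rewrite divfK.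
  by rewrite sinN invrN mulrNN divfK.
congr Quat; rewrite /= ?cb ?mulr0 ?addr0 ?add0r ?mulr1//.
- by rewrite -sb; ring.
- by rewrite -sb; ring.
- by rewrite -sb; ring.
Qed.

Lemma acos_atan (x y : R) : 0 < x -> 0 <= y ->
  acos (x / Num.sqrt (x ^+ 2 + y ^+ 2)) = atan (y / x).
Proof.
move=> x0 y0; have yx0 : 0 <= y / x by rewrite divr_ge0// ltW.
have -> : x / Num.sqrt (x ^+ 2 + y ^+ 2) = cos (atan (y / x)).
  rewrite cos_atan; have -> : x ^+ 2 + y ^+ 2 = x ^+ 2 * (1 + (y / x) ^+ 2).
    by field; rewrite gt_eqF.
  rewrite sqrtrM ?sqr_ge0// sqrtr_sqr gtr0_norm// invfM mulrA divff ?gt_eqF//.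
  by rewrite mul1r.
rewrite cosK// in_itv/=; apply/andP; split.
  by rewrite -atan0; apply: le_atan.
by apply: ltW; apply: lt_trans (atan_ltpi2 _) _; have := pi_gt0 R; lra.
Qed.

(** In the right half-plane the argument, defined by an arccosine, is an arctangent. *)
Lemma qlog_slice (x y : R) : 0 < x -> 0 <= y ->
  qlog (slice (x +i* (- y))%C) =
  slice ((ln (x ^+ 2 + y ^+ 2) / 2) +i* (- atan (y / x)))%C.
Proof.
move=> x0 y0; rewrite /qlog slice_imnorm slice_norm /= sqrrN normrN ger0_norm//.
have lnE : ln (Num.sqrt (x ^+ 2 + y ^+ 2)) = ln (x ^+ 2 + y ^+ 2) / 2.
  have m0 : 0 < x ^+ 2 + y ^+ 2 by rewrite ltr_pwDl ?exprn_gt0// sqr_ge0.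
  rewrite -[in RHS](sqr_sqrtr (ltW m0)) expr2 lnM ?posrE ?sqrtr_gt0//; lra.
rewrite acos_atan// lnE.
have ay : atan (y / x) / y * - y = - atan (y / x).
  have [->|y1] := eqVneq y 0; first by rewrite mul0r atan0 oppr0 mulr0.
  by rewrite mulrN divfK.
by congr Quat; rewrite /= ?mulr0 ?addr0 ?add0r ?mulr1// mulrA ay.
Qed.

End Slice.

(** * The Bargmann kernel as a generating function *)

Section QuaternionGeneratingFunction.
Variable R : realType.
Local Notation H := (quat R).
Local Notation C := R[i].

Lemma slice_exists (q : H) : exists j1 j2 j3 y : R,
  [/\ j1 ^+ 2 + j2 ^+ 2 + j3 ^+ 2 = 1, 0 <= y &
      q = slice j1 j2 j3 (qre q +i* y)%C].
Proof.
case: q => a b c d /=; pose y := Num.sqrt (b ^+ 2 + c ^+ 2 + d ^+ 2).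
have m0 : 0 <= b ^+ 2 + c ^+ 2 + d ^+ 2 by rewrite !addr_ge0 ?sqr_ge0.
have y2 : y ^+ 2 = b ^+ 2 + c ^+ 2 + d ^+ 2 by rewrite sqr_sqrtr.
have [y0|y0] := eqVneq y 0.
  (* A real quaternion belongs to every slice. *)
  exists 1, 0, 0, 0; split=> //; first by rewrite expr1n expr0n /= !addr0.
  have /eqP : b ^+ 2 + c ^+ 2 + d ^+ 2 = 0 by rewrite -y2 y0 expr0n.
  rewrite !paddr_eq0 ?addr_ge0 ?sqr_ge0// !sqrf_eq0.
  by move=> /andP[/andP[/eqP-> /eqP->] /eqP->]; congr Quat; rewrite /= mul0r.
exists (b / y), (c / y), (d / y), y; split; last 1 first.
- by congr Quat; rewrite /= mulrC divfK.
- rewrite !expr_div_n -!mulrDl y2 divff// -y2 expf_neq0//.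
- exact: sqrtr_ge0.
Qed.

Variable alpha : R.
Hypothesis alpha_gt0 : 0 < alpha.

(** The kernel of the transform, with the power of [1 - q] under the integral sign. *)
Definition bargmann_kernel (q : H) (t : R) : H :=
  (qpow (1 - q) (alpha + 1))^-1 * qexp (t *: (q / (q - 1))).

(** It is a quaternion exponential, whose norm is the exponential of a real number. *)
Lemma qpow_neq0 (q : H) (s : R) : qpow q s != 0.
Proof.
apply/eqP => h; suff : `|qpow q s| = expR (qre (s *: qlog q)).
  by rewrite h normr0 => /esym/eqP; rewrite gt_eqF// expR_gt0.
rewrite /qpow; move: (s *: qlog q) => p.
have [j1 [j2 [j3 [y [ju _ ->]]]]] := slice_exists p.
rewrite qexp_slice// slice_norm//= !exprMn -mulrDr cos2Dsin2 mulr1 sqrtr_sqr.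
by rewrite ger0_norm// expR_ge0.
Qed.

(** All the terms lie in the slice of [q], where the complex formula applies. *)
Theorem quaternion_generating_function (q : H) (t : R) : `|q| < 1 ->
  series (fun n => (laguerre alpha n).[t] *: q ^+ n) N @[N --> \oo] -->
  bargmann_kernel q t.
Proof.
move=> q1; have [j1 [j2 [j3 [b [ju b0 qE]]]]] := slice_exists q.
pose a := qre q; pose z : C := (a +i* b)%C; pose em := slice j1 j2 j3.
have qz : q = em z := qE.
have z1 : Normc.normc z < 1 by rewrite -(slice_norm ju) -/em -qz.
have [] := laguerre_generating_function t alpha_gt0 z1.
rewrite /= !mul1r; set x := 1 - a; set m := x ^+ 2 + b ^+ 2.
set u := t - _ - _; set v := _ * _ - _ => cRe cIm.
have x0 : 0 < x.
  rewrite subr_gt0; apply: le_lt_trans q1; apply: le_trans (ler_norm _) _.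
  by have [] := qcomp_le q.
have m0 : 0 < m by rewrite ltr_pwDl ?exprn_gt0// sqr_ge0.
have sE N : series (fun n => (laguerre alpha n).[t] *: q ^+ n) N =
    em ((cpoly (laguerre_gf alpha t N)).[z]).
  rewrite /cpoly /laguerre_gf rmorph_sum horner_sum /em slice_sum /series.
  apply: eq_bigr => n _; rewrite -mul_polyC rmorphM /= map_polyC /= map_polyXn.
  by rewrite hornerM hornerC hornerXn sliceZ// sliceX// -/em -qz.
under eq_fun do rewrite sE.
have emF : em ((cpoly (laguerre_gf alpha t N)).[z]) @[N --> \oo] -->
    em ((expR u * cos v) +i* (expR u * sin v))%C.
  apply: qcvg_comp; first exact: cRe.
  - by apply: cvgM; [exact: cIm | exact: cvg_cst].
  - by apply: cvgM; [exact: cIm | exact: cvg_cst].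
  - by apply: cvgM; [exact: cIm | exact: cvg_cst].
suff -> : bargmann_kernel q t = em ((expR u * cos v) +i* (expR u * sin v))%C by [].
have e1q : 1 - q = em (x +i* (- b))%C.
  by rewrite [in LHS]qz -(slice1 j1 j2 j3); congr Quat; rewrite /= ?mul0r ?mulNr ?add0r.
have powE : qpow (1 - q) (alpha + 1) = em
    ((expR ((alpha + 1) / 2 * ln m) * cos (- ((alpha + 1) * atan (b / x)))) +i*
     (expR ((alpha + 1) / 2 * ln m) * sin (- ((alpha + 1) * atan (b / x)))))%C.
  rewrite /qpow e1q qlog_slice// -sliceZ// qexp_slice// /= !mul0r !subr0 !addr0 mulrN.
  have -> // : (alpha + 1) * (ln (x ^+ 2 + b ^+ 2) / 2) = (alpha + 1) / 2 * ln m.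
  by rewrite /m; ring.
have q1_neq0 : q - 1 != 0.
  apply/eqP => /subr0_eq qq; move: q1; rewrite qq qnorm1 ltxx.
  by [].
have divE : q / (q - 1) = em ((1 - x / m) +i* (- (b / m)))%C.
  apply: (mulIr (q1_neq0 : q - 1 \is a GRing.unit)); rewrite divrK//.
  have -> : q - 1 = em ((- x) +i* b)%C.
    by rewrite -opprB e1q; congr Quat; rewrite /= -?mulNr ?opprK.
  rewrite /em -sliceM//= [LHS]qz /em; congr slice; apply/eqP.
  rewrite eq_complex /=; have : m != 0 by rewrite gt_eqF.
  by rewrite /m /x => mn; apply/andP; split; apply/eqP; field.
(* Cleared of the inverse of the power, the identity compares two exponentials. *)
have pow_unit : qpow (1 - q) (alpha + 1) \is a GRing.unit := qpow_neq0 _ _.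
rewrite /bargmann_kernel; apply: (mulrI pow_unit).
rewrite mulrA divrr ?mul1r; last exact: qpow_neq0.
rewrite divE powE /em -sliceZ// qexp_slice// -sliceM//; congr slice; apply/eqP.
rewrite eq_complex /= !mul0r !subr0 !addr0.
have eU : expR (t * (1 - x / m)) = expR ((alpha + 1) / 2 * ln m) * expR u.
  by rewrite -expRD /u; congr expR; ring.
have eV : t * (- (b / m)) = - ((alpha + 1) * atan (b / x)) + v.
  by rewrite /v; ring.
by rewrite eU eV (cosD _ v) (sinD _ v); apply/andP; split; apply/eqP; ring.
Qed.

End QuaternionGeneratingFunction.

(** * Expansions in the Laguerre basis *)

Section LaguerreExpansion.
Variables (R : realType) (alpha : R).
Hypothesis alpha_gt0 : 0 < alpha.
Local Notation H := (quat R).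
Local Notation mu := (@lebesgue_measure R).
Local Notation w := (weight alpha).
Local Notation L2w := (wL2 mu (@Rpos R) w).
Local Notation ip := (wip mu (@Rpos R) w).
Local Notation e := (laguerre_on alpha).

Let mD := @measurable_Rpos R.
Let mw : measurable_fun (@Rpos R) w := @measurable_weight R alpha _.
Let w_gt0 := @weight_gt0 R alpha.
Let Le := wL2_laguerre_on alpha_gt0.
Let e_orth := laguerre_on_orth alpha_gt0.
Let e_total f (Lf : L2w f) (f0 : forall n, ip (e n) f = 0) :=
  laguerre_on_total alpha_gt0 Lf f0.

(** The convergence is weak, which is what pairings need, and which is tested one real
    component at a time. *)
Definition expansion (S : R -> R) (b : nat -> R) : Prop :=
  L2w S /\ forall h, L2w h ->
    series (fun n => b n * ip (e n) h) N @[N --> \oo] --> ip S h.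

Lemma expansion_coef f : L2w f -> expansion f (fun n => ip (e n) f).
Proof.
move=> Lf; split=> // h Lh.
exact: (parseval mD mw w_gt0 Le e_orth e_total Lf Lh).
Qed.

Lemma expansion_exists (b : nat -> R) : cvgn (series (fun n => b n ^+ 2)) ->
  exists S, expansion S b.
Proof.
move=> cb; have [S LS bS] := riesz_fischer mD mw w_gt0 Le e_orth cb.
by exists S.
Qed.

Lemma coef_expansion S b n : expansion S b -> ip (e n) S = b n.
Proof.
by move=> [LS bS]; exact: (riesz_fischer_coef Le e_orth LS bS).
Qed.

Lemma expansion_inj f g : L2w f -> L2w g ->
  (forall n, ip (e n) f = ip (e n) g) -> {ae mu, forall x, Rpos x -> f x = g x}.
Proof. exact: (wip_inj mD mw Le e_total). Qed.

(** The components of a product of quaternions are signed sums of four products; the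
    following three lemmas handle such sums. *)
Lemma cvg_linear4 (s0 s1 s2 s3 : R) (u0 u1 u2 u3 : nat -> R) (c0 c1 c2 c3 : R) :
  series u0 n @[n --> \oo] --> c0 -> series u1 n @[n --> \oo] --> c1 ->
  series u2 n @[n --> \oo] --> c2 -> series u3 n @[n --> \oo] --> c3 ->
  series (fun n => s0 * u0 n + s1 * u1 n + s2 * u2 n + s3 * u3 n) n @[n --> \oo] -->
    s0 * c0 + s1 * c1 + s2 * c2 + s3 * c3.
Proof.
move=> h0 h1 h2 h3; rewrite (_ : series _ = fun n =>
    s0 * series u0 n + s1 * series u1 n + s2 * series u2 n + s3 * series u3 n).
  by do 3 (apply: cvgD; last by apply: cvgM => //; exact: cvg_cst);
    apply: cvgM => //; exact: cvg_cst.
apply/funext => n; rewrite /series /= !mulr_sumr -!big_split /=.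
by apply: eq_bigr.
Qed.

Lemma integral_linear4 (s0 s1 s2 s3 : R) (f0 f1 f2 f3 g0 g1 g2 g3 : R -> R) :
  L2w f0 -> L2w f1 -> L2w f2 -> L2w f3 ->
  L2w g0 -> L2w g1 -> L2w g2 -> L2w g3 ->
  let F x := s0 * (f0 x * g0 x * w x) + s1 * (f1 x * g1 x * w x) +
             s2 * (f2 x * g2 x * w x) + s3 * (f3 x * g3 x * w x) in
  mu.-integrable (@Rpos R) (EFin \o F) /\
  \int[mu]_(x in @Rpos R) F x =
    s0 * ip f0 g0 + s1 * ip f1 g1 + s2 * ip f2 g2 + s3 * ip f3 g3.
Proof.
move=> Lf0 Lf1 Lf2 Lf3 Lg0 Lg1 Lg2 Lg3.
have I f g s : L2w f -> L2w g ->
    mu.-integrable (@Rpos R) (EFin \o (fun x => s * (f x * g x * w x))).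
  by move=> Lf Lg; have := integrableZl mD s (wL2_integrable mD mw Lf Lg).
have ZE f g s : L2w f -> L2w g ->
    \int[mu]_(x in @Rpos R) (s * (f x * g x * w x)) = s * ip f g.
  by move=> Lf Lg; rewrite RintegralZl//; exact: wL2_integrable.
have D f g : mu.-integrable (@Rpos R) (EFin \o f) -> mu.-integrable (@Rpos R) (EFin \o g) ->
    mu.-integrable (@Rpos R) (EFin \o (fun x => f x + g x)).
  by move=> If Ig; exact: (integrableD mD If Ig).
have i0 := I _ _ s0 Lf0 Lg0; have i1 := I _ _ s1 Lf1 Lg1.
have i2 := I _ _ s2 Lf2 Lg2; have i3 := I _ _ s3 Lf3 Lg3.
have i01 := D _ _ i0 i1; have i012 := D _ _ i01 i2.
split; first exact: (D _ _ i012 i3).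
by rewrite !RintegralD// !ZE.
Qed.

Lemma expansion_linear4 (s0 s1 s2 s3 : R) (f0 f1 f2 f3 : R -> R) (b0 b1 b2 b3 : nat -> R) :
  expansion f0 b0 -> expansion f1 b1 -> expansion f2 b2 -> expansion f3 b3 ->
  expansion (fun x => s0 * f0 x + s1 * f1 x + s2 * f2 x + s3 * f3 x)
    (fun n => s0 * b0 n + s1 * b1 n + s2 * b2 n + s3 * b3 n).
Proof.
move=> [L0 h0] [L1 h1] [L2 h2] [L3 h3]; split.
  by do 3 (apply: (wL2D mD mw); last exact: (wL2Z mD mw)); exact: (wL2Z mD mw).
move=> h Lh; have LZ s f : L2w f -> L2w (fun x => s * f x) by exact: (wL2Z mD mw).
rewrite !(wipDl mD mw)//; do ?[exact: LZ | apply: (wL2D mD mw)].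
rewrite !(wipZl mD mw)//.
have -> : (fun n => (s0 * b0 n + s1 * b1 n + s2 * b2 n + s3 * b3 n) * ip (e n) h) =
    (fun n => s0 * (b0 n * ip (e n) h) + s1 * (b1 n * ip (e n) h) +
      s2 * (b2 n * ip (e n) h) + s3 * (b3 n * ip (e n) h)).
  by apply/funext => n; ring.
by apply: cvg_linear4; [exact: h0 | exact: h1 | exact: h2 | exact: h3].
Qed.

Lemma L2_components (phi : R -> H) : L2 alpha phi <->
  [/\ L2w (qre \o phi), L2w (qi \o phi), L2w (qj \o phi) & L2w (qk \o phi)].
Proof.
split=> [[[m0 m1 m2 m3] I]|[L0 L1 L2 L3]].
  have le (f : R -> R) : measurable_fun (@Rpos R) f ->
      (forall x, f x ^+ 2 <= `|phi x| ^+ 2) -> L2w f.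
    move=> mf fphi; split=> //; apply: le_integrable I => //.
      by apply/measurable_EFinP; apply: measurable_funM => //; exact: measurable_funX.
    move=> x x0 /=; have wx := ltW (w_gt0 x0).
    rewrite lee_fin (ger0_norm (mulr_ge0 (sqr_ge0 _) wx)).
    by rewrite (ger0_norm (mulr_ge0 (sqr_ge0 _) wx)) ler_wpM2r.
  by split; apply: le => // x /=; rewrite qsqnE /qsqn;
    have := sqr_ge0 (qre (phi x)); have := sqr_ge0 (qi (phi x));
    have := sqr_ge0 (qj (phi x)); have := sqr_ge0 (qk (phi x)); lra.
split; first by split; [case: L0|case: L1|case: L2|case: L3].
have [I _] := integral_linear4 1 1 1 1 L0 L1 L2 L3 L0 L1 L2 L3.
apply: eq_integrable I => // x _ /=.
by rewrite qsqnE /qsqn; congr EFin; ring.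
Qed.

(** The basis is real, so these coefficients may be written on either side. *)
Definition qcoef (phi : R -> H) n : H :=
  Quat (ip (e n) (qre \o phi)) (ip (e n) (qi \o phi))
       (ip (e n) (qj \o phi)) (ip (e n) (qk \o phi)).

Definition qexpansion (F : R -> H) (c : nat -> H) : Prop :=
  [/\ expansion (qre \o F) (qre \o c), expansion (qi \o F) (qi \o c),
      expansion (qj \o F) (qj \o c) & expansion (qk \o F) (qk \o c)].

Lemma qexpansion_L2 F c : qexpansion F c -> L2 alpha F.
Proof.
by move=> [[? _] [? _] [? _] [? _]]; apply/L2_components.
Qed.

Lemma qexpansion_coef phi : L2 alpha phi -> qexpansion phi (qcoef phi).
Proof.
move=> /L2_components[p0 p1 p2 p3]; split.
- exact: (expansion_coef p0).
- exact: (expansion_coef p1).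
- exact: (expansion_coef p2).
- exact: (expansion_coef p3).
Qed.

Lemma qcoef_expansion F c : qexpansion F c -> qcoef F =1 c.
Proof.
move=> [h0 h1 h2 h3] n.
rewrite /qcoef (coef_expansion n h0) (coef_expansion n h1).
by rewrite (coef_expansion n h2) (coef_expansion n h3) /=; case: (c n).
Qed.

Lemma qcoef_inj phi psi : L2 alpha phi -> L2 alpha psi ->
  qcoef phi =1 qcoef psi -> aeq phi psi.
Proof.
move=> /L2_components[p0 p1 p2 p3] /L2_components[q0 q1 q2 q3] pq.
have a0 := expansion_inj p0 q0 (fun n => congr1 (@qre R) (pq n)).
have a1 := expansion_inj p1 q1 (fun n => congr1 (@qi R) (pq n)).
have a2 := expansion_inj p2 q2 (fun n => congr1 (@qj R) (pq n)).
have a3 := expansion_inj p3 q3 (fun n => congr1 (@qk R) (pq n)).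
have aeF := ae_filter_ringOfSetsType mu.
apply: (@filterS2 _ _ aeF _ _ _ _ (@filterI _ _ aeF _ _ a0 a1) (@filterI _ _ aeF _ _ a2 a3)).
move=> x [/= e0 e1] [/= e2 e3] x0.
move: (e0 x0) (e1 x0) (e2 x0) (e3 x0); case: (phi x) => ? ? ? ?.
by case: (psi x) => ? ? ? ? /= -> -> -> ->.
Qed.

Lemma qexpansion_mull (p : H) F c : qexpansion F c ->
  qexpansion (fun x => p * F x) (fun n => p * c n).
Proof.
move=> [h0 h1 h2 h3]; split.
- have := expansion_linear4 (qre p) (- qi p) (- qj p) (- qk p) h0 h1 h2 h3.
  by congr expansion; apply/funext => x /=; ring.
- have := expansion_linear4 (qi p) (qre p) (- qk p) (qj p) h0 h1 h2 h3.
  by congr expansion; apply/funext => x /=; ring.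
- have := expansion_linear4 (qj p) (qk p) (qre p) (- qi p) h0 h1 h2 h3.
  by congr expansion; apply/funext => x /=; ring.
- have := expansion_linear4 (qk p) (- qj p) (qi p) (qre p) h0 h1 h2 h3.
  by congr expansion; apply/funext => x /=; ring.
Qed.

Lemma qexpansion_mulr (p : H) F c : qexpansion F c ->
  qexpansion (fun x => F x * p) (fun n => c n * p).
Proof.
move=> [h0 h1 h2 h3]; split.
- have := expansion_linear4 (qre p) (- qi p) (- qj p) (- qk p) h0 h1 h2 h3.
  by congr expansion; apply/funext => x /=; ring.
- have := expansion_linear4 (qi p) (qre p) (qk p) (- qj p) h0 h1 h2 h3.
  by congr expansion; apply/funext => x /=; ring.
- have := expansion_linear4 (qj p) (- qk p) (qre p) (qi p) h0 h1 h2 h3.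
  by congr expansion; apply/funext => x /=; ring.
- have := expansion_linear4 (qk p) (qj p) (- qi p) (qre p) h0 h1 h2 h3.
  by congr expansion; apply/funext => x /=; ring.
Qed.

Lemma qexpansionD F G c d : qexpansion F c -> qexpansion G d ->
  qexpansion (fun x => F x + G x) (fun n => c n + d n).
Proof.
have D f g a b : expansion f a -> expansion g b ->
    expansion (fun x => f x + g x) (fun n => a n + b n).
  move=> fa gb; have := expansion_linear4 1 1 0 0 fa gb fa gb.
  by congr expansion; apply/funext => x /=; ring.
by move=> [f0 f1 f2 f3] [g0 g1 g2 g3]; split; apply: D.
Qed.

Lemma qexpansionB F G c d : qexpansion F c -> qexpansion G d ->
  qexpansion (fun x => F x - G x) (fun n => c n - d n).
Proof.
move=> Fc Gd; have := qexpansionD Fc (qexpansion_mulr (-1) Gd).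
by congr qexpansion; apply/funext => x; rewrite mulrN1.
Qed.

Lemma qexpansion_conj F c : qexpansion F c ->
  qexpansion (fun x => qconj (F x)) (fun n => qconj (c n)).
Proof.
have N f a : expansion f a -> expansion (fun x => - f x) (fun n => - a n).
  move=> fa; have := expansion_linear4 (-1) 0 0 0 fa fa fa fa.
  by congr expansion; apply/funext => x /=; ring.
by move=> [f0 f1 f2 f3]; split => //; exact: N.
Qed.

Lemma qexpansion_exists (c : nat -> H) : cvgn (series (fun n => `|c n| ^+ 2)) ->
  exists F, qexpansion F c.
Proof.
move=> cc; have le (b : nat -> R) : (forall n, b n ^+ 2 <= `|c n| ^+ 2) ->
    exists S, expansion S b.
  move=> bc; apply: expansion_exists; apply: series_le_cvg cc => n //; exact: sqr_ge0.
have sq n : [/\ qre (c n) ^+ 2 <= `|c n| ^+ 2, qi (c n) ^+ 2 <= `|c n| ^+ 2,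
    qj (c n) ^+ 2 <= `|c n| ^+ 2 & qk (c n) ^+ 2 <= `|c n| ^+ 2].
  rewrite qsqnE /qsqn; have := sqr_ge0 (qre (c n)); have := sqr_ge0 (qi (c n)).
  by have := sqr_ge0 (qj (c n)); have := sqr_ge0 (qk (c n)); split; lra.
have [|S0 h0] := le (qre \o c); first by move=> n; have [] := sq n.
have [|S1 h1] := le (qi \o c); first by move=> n; have [] := sq n.
have [|S2 h2] := le (qj \o c); first by move=> n; have [] := sq n.
have [|S3 h3] := le (qk \o c); first by move=> n; have [] := sq n.
by exists (fun x => Quat (S0 x) (S1 x) (S2 x) (S3 x)).
Qed.

(** Once the product is multiplied out, each component is a signed sum of four real
    pairings. No conjugate is taken, so that [F] can be a kernel; inner products are
    reached through [qexpansion_conj]. *)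
Theorem qexpansion_integral F c phi : qexpansion F c -> L2 alpha phi ->
  qintegrable (@Rpos R) (fun x => w x *: (F x * phi x)) /\
  (series (fun n => c n * qcoef phi n) N @[N --> \oo] -->
    qintegral (@Rpos R) (fun x => w x *: (F x * phi x))).
Proof.
move=> [[F0 h0] [F1 h1] [F2 h2] [F3 h3]] /L2_components[p0 p1 p2 p3].
have [i0 v0] := integral_linear4 1 (-1) (-1) (-1) F0 F1 F2 F3 p0 p1 p2 p3.
have [i1 v1] := integral_linear4 1 1 1 (-1) F0 F1 F2 F3 p1 p0 p3 p2.
have [i2 v2] := integral_linear4 1 (-1) 1 1 F0 F1 F2 F3 p2 p3 p0 p1.
have [i3 v3] := integral_linear4 1 1 (-1) 1 F0 F1 F2 F3 p3 p2 p1 p0.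
have c0 := @cvg_linear4 1 (-1) (-1) (-1) _ _ _ _ _ _ _ _ (h0 _ p0) (h1 _ p1) (h2 _ p2) (h3 _ p3).
have c1 := @cvg_linear4 1 1 1 (-1) _ _ _ _ _ _ _ _ (h0 _ p1) (h1 _ p0) (h2 _ p3) (h3 _ p2).
have c2 := @cvg_linear4 1 (-1) 1 1 _ _ _ _ _ _ _ _ (h0 _ p2) (h1 _ p3) (h2 _ p0) (h3 _ p1).
have c3 := @cvg_linear4 1 1 (-1) 1 _ _ _ _ _ _ _ _ (h0 _ p3) (h1 _ p2) (h2 _ p1) (h3 _ p0).
have int (f g : R -> R) : f = g -> mu.-integrable (@Rpos R) (EFin \o f) ->
  mu.-integrable (@Rpos R) (EFin \o g) by move=> ->.
split.
  split.
  - by apply: int i0; apply/funext => x /=; ring.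
  - by apply: int i1; apply/funext => x /=; ring.
  - by apply: int i2; apply/funext => x /=; ring.
  - by apply: int i3; apply/funext => x /=; ring.
have cv (u u' : nat -> R) (l : R) (f g : R -> R) : u =1 u' -> f =1 g ->
    \int[mu]_(x in @Rpos R) f x = l -> series u n @[n --> \oo] --> l ->
    series u' n @[n --> \oo] --> \int[mu]_(x in @Rpos R) g x.
  by move=> /funext <- /funext <- <-.
apply: qseries_cvg.
- by apply: cv v0 c0 => x /=; ring.
- by apply: cv v1 c1 => x /=; ring.
- by apply: cv v2 c2 => x /=; ring.
- by apply: cv v3 c3 => x /=; ring.
Qed.

End LaguerreExpansion.

Lemma cvgn_ext (T : topologicalType) (u v : nat -> T) (l : T) : u =1 v ->
  u n @[n --> \oo] --> l -> v n @[n --> \oo] --> l.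
Proof. by move=> /funext ->. Qed.

(** * Uniqueness of Taylor coefficients *)

Section ExpansionUniqueness.
Variable R : realType.
Local Notation H := (quat R).

(** The restriction to the real axis determines the coefficients, by the identity theorem
    applied to each component. *)
Lemma expands_inj (f : H -> H) (c d : nat -> H) : expands f c -> expands f d -> c = d.
Proof.
move=> fc fd; apply/funext => n.
have cvr (b : nat -> H) (r : R) : expands f b -> 0 < r < 1 ->
    series (fun n => r ^+ n *: b n) N @[N --> \oo] --> f r%:A.
  move=> fb /andP[r0 r1]; have : qball (r%:A : H).
    by rewrite /qball /= normrZ qnorm1 mulr1 ger0_norm// ltW.
  move=> /fb; under [in X in X -> _]eq_fun do [].
  have -> : (fun n => (r%:A : H) ^+ n * b n) = (fun n => r ^+ n *: b n).
    by apply/funext => k; rewrite exprZn expr1n mulr_algl.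
  by [].
have real (p : H -> R) (b1 b2 : nat -> R) : (forall n, b1 n = p (c n)) ->
    (forall n, b2 n = p (d n)) -> (forall r, 0 < r < 1 ->
    series (fun n => r ^+ n * b1 n) N @[N --> \oo] --> p (f r%:A)) ->
    (forall r, 0 < r < 1 ->
    series (fun n => r ^+ n * b2 n) N @[N --> \oo] --> p (f r%:A)) -> p (c n) = p (d n).
  move=> b1c b2d h1 h2; apply/eqP; rewrite -subr_eq0 -b1c -b2d; apply/eqP.
  apply: (@power_series_eq0 _ (fun n => b1 n - b2 n)) => r r01.
  have : series (fun n => r ^+ n * b1 n) N - series (fun n => r ^+ n * b2 n) N
      @[N --> \oo] --> p (f r%:A) - p (f r%:A).
    by apply: cvgB; [exact: h1 | exact: h2].
  rewrite subrr => h.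
  apply: (cvgn_ext _ h) => N.
  by rewrite /= /series /= -sumrB; apply: eq_bigr => k _; ring.
have comp r (r01 : 0 < r < 1) := (qseries_cvgP (cvr c r fc r01), qseries_cvgP (cvr d r fd r01)).
case E1 : (c n) => [c0 c1 c2 c3]; case E2 : (d n) => [d0 d1 d2 d3].
congr Quat.
- have := @real (@qre R) (qre \o c) (qre \o d) (fun=> erefl) (fun=> erefl)
    (fun r r01 => let: (And4 h _ _ _, _) := comp r r01 in h)
    (fun r r01 => let: (_, And4 h _ _ _) := comp r r01 in h).
  by rewrite E1 E2.
- have := @real (@qi R) (qi \o c) (qi \o d) (fun=> erefl) (fun=> erefl)
    (fun r r01 => let: (And4 _ h _ _, _) := comp r r01 in h)
    (fun r r01 => let: (_, And4 _ h _ _) := comp r r01 in h).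
  by rewrite E1 E2.
- have := @real (@qj R) (qj \o c) (qj \o d) (fun=> erefl) (fun=> erefl)
    (fun r r01 => let: (And4 _ _ h _, _) := comp r r01 in h)
    (fun r r01 => let: (_, And4 _ _ h _) := comp r r01 in h).
  by rewrite E1 E2.
- have := @real (@qk R) (qk \o c) (qk \o d) (fun=> erefl) (fun=> erefl)
    (fun r r01 => let: (And4 _ _ _ h, _) := comp r r01 in h)
    (fun r r01 => let: (_, And4 _ _ _ h) := comp r r01 in h).
  by rewrite E1 E2.
Qed.

Lemma coeffsE (f : H -> H) (c : nat -> H) : expands f c -> coeffs f = c.
Proof.
move=> fc; have h : expands f (coeffs f).
  exact: (@xgetPex _ (fun=> 0) [set c | expands f c] (ex_intro _ c fc)).
exact: expands_inj h fc.
Qed.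

End ExpansionUniqueness.

(** * Taylor coefficients of the Bargmann transform *)

Section BargmannExpansion.
Variables (R : realType) (alpha : R).
Hypothesis alpha_gt0 : 0 < alpha.
Local Notation H := (quat R).
Local Notation mu := (@lebesgue_measure R).
Local Notation w := (weight alpha).
Local Notation e := (laguerre_on alpha).
Local Notation sqn := (laguerre_sqn alpha).

(** The pointwise sum is measurable as an upper limit. *)
Lemma expansion_pointwise (b : nat -> R) (C s : R) (S : R -> R) : 0 <= s < 1 ->
  (forall n, `|b n| <= C * s ^+ n) ->
  (forall t, Rpos t -> series (fun n => b n * e n t) N @[N --> \oo] --> S t) ->
  expansion alpha S b.
Proof.
move=> s01 bC bS; apply: (laguerre_on_series alpha_gt0 s01 bC) => //.
have m : measurable_fun (@Rpos R) (esup_limit (fun N t => series (fun n => b n * e n t) N)).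
  apply: measurable_esup_limit => N.
  have LZ n : wL2 mu (@Rpos R) w (fun t => b n * e n t).
    apply: (wL2Z measurable_Rpos (@measurable_weight R alpha _)).
    exact: wL2_laguerre_on.
  by have [] := wL2_sum measurable_Rpos (@measurable_weight R alpha _) (index_iota 0 N) LZ.
apply: eq_measurable_fun m => t; rewrite inE => t0.
exact: (esup_limit_cvg (bS t t0)).
Qed.

Lemma qexpansion_pointwise (a : nat -> H) (C s : R) (F : R -> H) : 0 <= s < 1 ->
  (forall n, `|a n| <= C * s ^+ n) ->
  (forall t, Rpos t -> series (fun n => e n t *: a n) N @[N --> \oo] --> F t) ->
  qexpansion alpha F a.
Proof.
move=> s01 aC aF.
have le n := qcomp_le (a n).
have cv (p : H -> R) : (forall n, `|p (a n)| <= `|a n|) ->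
    (forall t, Rpos t -> series (fun n => p (a n) * e n t) N @[N --> \oo] --> p (F t)) ->
    expansion alpha (p \o F) (p \o a).
  move=> pa; apply: (expansion_pointwise s01) => n.
  by apply: le_trans (aC n).
have E (f : nat -> R) (g : nat -> R) (l : R) : f =1 g ->
    series f N @[N --> \oo] --> l -> series g N @[N --> \oo] --> l.
  by move=> /funext ->.
split; apply: cv => [n|t t0].
- by have [] := le n.
- by have [h _ _ _] := qseries_cvgP (aF t t0); apply: E h => n /=; rewrite mulrC.
- by have [] := le n.
- by have [_ h _ _] := qseries_cvgP (aF t t0); apply: E h => n /=; rewrite mulrC.
- by have [] := le n.
- by have [_ _ h _] := qseries_cvgP (aF t t0); apply: E h => n /=; rewrite mulrC.
- by have [] := le n.
- by have [_ _ _ h] := qseries_cvgP (aF t t0); apply: E h => n /=; rewrite mulrC.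
Qed.

Lemma qexpansion_bargmann_kernel (q : H) : `|q| < 1 ->
  qexpansion alpha (bargmann_kernel alpha q) (fun n => Num.sqrt (sqn n) *: q ^+ n).
Proof.
move=> q1; have q01 : 0 <= `|q| < 1 by rewrite normr_ge0.
have [s s01 [C C0 hC]] := subexp_geometric (subexp_laguerre_norm alpha_gt0) q01.
apply: (qexpansion_pointwise s01) => [n|t t0].
  by rewrite normrZ qnormX; exact: hC.
apply: cvgn_ext (@quaternion_generating_function _ _ alpha_gt0 q t q1) => N.
by apply: eq_bigr => n _; rewrite scalerA mulrC -laguerreE.
Qed.

Definition bargmann_scale : R := (Num.sqrt (pi * Gamma alpha))^-1.

Lemma bargmann_scale_gt0 : 0 < bargmann_scale.
Proof. by rewrite invr_gt0 sqrtr_gt0 mulr_gt0 ?pi_gt0 ?Gamma_gt0. Qed.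

(** Pairing the kernel with [phi] gives the series. The power of [1 - q] is outside the
    integral in the transform; it is moved inside by comparing the expansions of
    the kernel before and after multiplication by this power. *)
Lemma bargmann_expands phi : L2 alpha phi -> expands (bargmann alpha phi)
  (fun n => (bargmann_scale * Num.sqrt (sqn n)) *: qcoef alpha phi n).
Proof.
move=> Lphi q q1; pose P := qpow (1 - q) (alpha + 1).
have KE := qexpansion_bargmann_kernel q1.
have [_ cK] := qexpansion_integral KE Lphi.
have [_ cP] := qexpansion_integral (qexpansion_mull P KE) Lphi.
have PK t : P * bargmann_kernel alpha q t = qexp (t *: (q / (q - 1))).
  by rewrite mulrA divrr ?mul1r//; exact: qpow_neq0.
have cP' := qcvgMl (p := P) cK.
have PE : qintegral (@Rpos R) (fun t => w t *: (P * bargmann_kernel alpha q t * phi t)) =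
    P * qintegral (@Rpos R) (fun t => w t *: (bargmann_kernel alpha q t * phi t)).
  apply: (qcvg_unique cP); apply: cvgn_ext cP' => N; rewrite /series /= mulr_sumr.
  by apply: eq_bigr => n _; rewrite mulrA.
have -> : bargmann alpha phi q = bargmann_scale *:
    qintegral (@Rpos R) (fun t => w t *: (bargmann_kernel alpha q t * phi t)).
  rewrite /bargmann -/P -/bargmann_scale; congr (_ *: _).
  under [in LHS]eq_fun do rewrite -PK.
  by rewrite PE mulKr//; exact: qpow_neq0.
have := qcvgMl (p := bargmann_scale%:A) cK; rewrite mulr_algl; apply: cvgn_ext => N.
rewrite mulr_algl /series /= scaler_sumr; apply: eq_bigr => n _.
by rewrite -scalerAl -scalerAr scalerA.
Qed.

Lemma sum_sqr_qcoef phi : L2 alpha phi -> cvgn (series (fun n => `|qcoef alpha phi n| ^+ 2)).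
Proof.
move=> /L2_components[L0 L1 L2 L3].
have bes f : wL2 mu (@Rpos R) w f ->
    cvgn (series (fun n => wip mu (@Rpos R) w (e n) f ^+ 2)).
  move=> Lf; apply: (bessel measurable_Rpos (@measurable_weight R alpha _)
    (@weight_gt0 R alpha) (wL2_laguerre_on alpha_gt0) (laguerre_on_orth alpha_gt0) Lf).
have := is_cvg_seriesD
  (is_cvg_seriesD (is_cvg_seriesD (bes _ L0) (bes _ L1)) (bes _ L2)) (bes _ L3).
by under [in X in _ -> X]eq_fun do rewrite qsqnE /qsqn.
Qed.

(** The weight of the Bergman space cancels the factor [sqn n] in the squared norms. *)
Lemma bergman_expands f (c : nat -> H) : cvgn (series (fun n => `|c n| ^+ 2)) ->
  expands f (fun n => (bargmann_scale * Num.sqrt (sqn n)) *: c n) -> bergman alpha f.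
Proof.
move=> cc fc; eexists; first exact: fc.
have -> : (fun n => n`!%:R / Gamma (alpha + n%:R + 1) *
      `|(bargmann_scale * Num.sqrt (sqn n)) *: c n| ^+ 2) =
    bargmann_scale ^+ 2 *: (fun n => `|c n| ^+ 2).
  apply/funext => n; have h0 := laguerre_sqn_gt0 alpha_gt0 n.
  rewrite normrZ !exprMn -normrX ger0_norm ?sqr_ge0// exprMn sqr_sqrtr ?ltW//.
  rewrite /laguerre_sqn -[RHS]/(_ * _) mulrA; congr (_ * _).
  have s0 : 0 < alpha + n%:R + 1 by rewrite addr_gt0// ltr_wpDr.
  have g0 : Gamma (alpha + n%:R + 1) != 0 by rewrite gt_eqF// Gamma_gt0.
  have f0 : n`!%:R != 0 :> R by rewrite pnatr_eq0 -lt0n fact_gt0.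
  by move: n`!%:R f0 (Gamma _) g0 => f' f0 g g0; field; rewrite g0 f0.
exact: is_cvg_seriesZ.
Qed.

End BargmannExpansion.

(** * The conjugated operator *)

Section Conjugate.
Variables (R : realType) (alpha : R) (theta : quat R).
Hypotheses (alpha_gt0 : 0 < alpha) (theta_le1 : `|theta| <= 1).
Local Notation H := (quat R).
Local Notation mu := (@lebesgue_measure R).
Local Notation w := (weight alpha).
Local Notation e := (laguerre_on alpha).
Local Notation sqn := (laguerre_sqn alpha).
Local Notation Lt := (Ltilde alpha theta).
Local Notation coef := (qcoef alpha).

Lemma expands_eq (f g : H -> H) c : {in @qball R, f =1 g} -> expands f c -> expands g c.
Proof. by move=> fg fc q q1; rewrite -fg ?inE//; exact: fc. Qed.

(** This is the injectivity of the Bargmann transform. *)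
Lemma qcoef_bargmann phi psi : L2 alpha phi -> L2 alpha psi ->
  {in @qball R, bargmann alpha phi =1 bargmann alpha psi} -> coef phi =1 coef psi.
Proof.
move=> Lphi Lpsi E n; have h1 := expands_eq E (bargmann_expands alpha_gt0 Lphi).
have := congr1 (fun c => c n) (expands_inj h1 (bargmann_expands alpha_gt0 Lpsi)).
apply: scalerI; rewrite mulf_neq0// gt_eqF ?bargmann_scale_gt0//.
by rewrite sqrtr_gt0 laguerre_sqn_gt0.
Qed.

Lemma theta_le (c : H) n : `|theta ^+ n * c| <= `|c|.
Proof.
by rewrite qnormM qnormX ler_piMl// exprn_ile1.
Qed.

Lemma theta_summable phi : L2 alpha phi ->
  cvgn (series (fun n => `|theta ^+ n * coef phi n| ^+ 2)).
Proof.
move=> Lphi; apply: series_le_cvg (sum_sqr_qcoef alpha_gt0 Lphi) => n.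
- exact: sqr_ge0.
- exact: sqr_ge0.
- by rewrite lerXn2r ?nnegrE// theta_le.
Qed.

(** The Riesz-Fischer theorem gives a function with coefficients [theta ^+ n * coef phi n],
    whose Bargmann transform has the required Taylor coefficients. So preimages
    exist, and by injectivity the one that [Ltilde] selects has these
    coefficients too. *)
Lemma Ltilde_spec phi : L2 alpha phi ->
  [/\ L2 alpha (Lt phi), coef (Lt phi) =1 (fun n => theta ^+ n * coef phi n),
      {in @qball R, bargmann alpha (Lt phi) =1 Gamma_act theta (bargmann alpha phi)} &
      expands (Gamma_act theta (bargmann alpha phi))
        (fun n => (bargmann_scale alpha * Num.sqrt (sqn n)) *: (theta ^+ n * coef phi n))].
Proof.
move=> Lphi; have [F Fc] := qexpansion_exists alpha_gt0 (theta_summable Lphi).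
have LF := qexpansion_L2 Fc; have cF := qcoef_expansion alpha_gt0 Fc.
have FE := bargmann_expands alpha_gt0 LF.
have GF q : qball q -> Gamma_act theta (bargmann alpha phi) q = bargmann alpha F q.
  move=> q1; rewrite /Gamma_act (coeffsE (bargmann_expands alpha_gt0 Lphi)).
  apply/cvg_lim; first exact: norm_hausdorff.
  apply: cvgn_ext (FE q q1) => N; apply: eq_bigr => n _.
  by rewrite cF -!scalerAr mulrA.
have ex : exists psi, L2 alpha psi /\
    {in @qball R, bargmann alpha psi =1 Gamma_act theta (bargmann alpha phi)}.
  by exists F; split=> // q; rewrite inE => q1; rewrite GF.
have [LT TE] := @xgetPex _ (fun=> 0) [set psi | L2 alpha psi /\
  {in @qball R, bargmann alpha psi =1 Gamma_act theta (bargmann alpha phi)}] ex.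
split=> //.
  move=> n; rewrite -cF; apply: qcoef_bargmann => // q; rewrite inE => q1.
  by rewrite TE ?inE// GF.
apply: expands_eq (_ : {in @qball R, bargmann alpha F =1 _}) _ => [q|].
  by rewrite inE => q1; rewrite GF.
by move=> q q1; apply: cvgn_ext (FE q q1) => N; apply: eq_bigr => n _; rewrite cF.
Qed.

Lemma ip_coef phi psi : L2 alpha phi -> L2 alpha psi ->
  series (fun n => qconj (coef phi n) * coef psi n) N @[N --> \oo] --> ip alpha phi psi.
Proof.
move=> Lphi Lpsi; have [_ h] := qexpansion_integral
  (qexpansion_conj (qexpansion_coef alpha_gt0 Lphi)) Lpsi.
exact: h.
Qed.

Lemma sqr_L2norm phi : L2 alpha phi ->
  series (fun n => `|coef phi n| ^+ 2) N @[N --> \oo] --> qre (ip alpha phi phi).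
Proof.
move=> Lphi; have [h _ _ _] := qseries_cvgP (ip_coef Lphi Lphi).
apply: cvgn_ext h => N; apply: eq_bigr => n _.
by rewrite -[LHS]/(qre (qconj _ * coef phi n)) qconj_mul /= mulr1.
Qed.

Lemma L2norm_le phi psi : L2 alpha phi -> L2 alpha psi ->
  (forall n, `|coef phi n| <= `|coef psi n|) -> L2norm alpha phi <= L2norm alpha psi.
Proof.
move=> Lphi Lpsi le; apply: ler_wsqrtr.
apply: ler_cvg_to (sqr_L2norm Lphi) (sqr_L2norm Lpsi) _; apply: nearW => N.
by apply: ler_sum => n _; rewrite lerXn2r ?nnegrE.
Qed.

Lemma coefB phi psi : L2 alpha phi -> L2 alpha psi ->
  L2 alpha (fun x => phi x - psi x) /\
  coef (fun x => phi x - psi x) =1 (fun n => coef phi n - coef psi n).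
Proof.
move=> Lphi Lpsi; have E := qexpansionB (qexpansion_coef alpha_gt0 Lphi)
  (qexpansion_coef alpha_gt0 Lpsi).
by split; [exact: qexpansion_L2 E | exact: qcoef_expansion E].
Qed.

Lemma coefD_mulr phi psi (l : H) : L2 alpha phi -> L2 alpha psi ->
  L2 alpha (fun x => phi x + psi x * l) /\
  coef (fun x => phi x + psi x * l) =1 (fun n => coef phi n + coef psi n * l).
Proof.
move=> Lphi Lpsi; have E := qexpansionD (qexpansion_coef alpha_gt0 Lphi)
  (qexpansion_mulr l (qexpansion_coef alpha_gt0 Lpsi)).
by split; [exact: qexpansion_L2 E | exact: qcoef_expansion E].
Qed.

Lemma Ltilde_right_linear : right_linear alpha Lt.
Proof.
move=> phi psi l Lphi Lpsi; have [L cE] := coefD_mulr l Lphi Lpsi.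
have [L1 c1 _ _] := Ltilde_spec L; have [L2' c2 _ _] := Ltilde_spec Lphi.
have [L3 c3 _ _] := Ltilde_spec Lpsi; have [L4 c4] := coefD_mulr l L2' L3.
apply: (qcoef_inj alpha_gt0 L1 L4) => n.
rewrite (etrans (c1 n) (congr1 (fun c => theta ^+ n * c) (cE n))).
rewrite (etrans (c4 n) (congr2 (fun c d => c + d * l) (c2 n) (c3 n))).
by rewrite mulrDr mulrA.
Qed.

(** A difference of images has the coefficients [theta ^+ n * (coef psi n - coef phi n)]. *)
Lemma Ltilde_lipschitz phi psi : L2 alpha phi -> L2 alpha psi ->
  L2norm alpha (fun x => Lt psi x - Lt phi x) <= L2norm alpha (fun x => psi x - phi x).
Proof.
move=> Lphi Lpsi; have [L1 c1 _ _] := Ltilde_spec Lphi.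
have [L2' c2 _ _] := Ltilde_spec Lpsi.
have [L3 c3] := coefB L2' L1; have [L4 c4] := coefB Lpsi Lphi.
apply: (L2norm_le L3 L4) => n.
rewrite (etrans (c3 n) (congr2 (fun c d => c - d) (c2 n) (c1 n))) (c4 n) -mulrBr.
exact: theta_le.
Qed.

Lemma Ltilde_norm phi : L2 alpha phi -> L2norm alpha (Lt phi) <= L2norm alpha phi.
Proof.
move=> Lphi; have [L1 c1 _ _] := Ltilde_spec Lphi.
by apply: L2norm_le => // n; rewrite c1 theta_le.
Qed.

(** Parseval's identity, with [qconj (theta ^+ n) * theta ^+ n = 1]. *)
Lemma Ltilde_isometry phi psi : `|theta| = 1 -> L2 alpha phi -> L2 alpha psi ->
  ip alpha (Lt phi) (Lt psi) = ip alpha phi psi.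
Proof.
move=> theta1 Lphi Lpsi; have [L1 c1 _ _] := Ltilde_spec Lphi.
have [L2' c2 _ _] := Ltilde_spec Lpsi.
apply: (qcvg_unique (ip_coef L1 L2')).
apply: cvgn_ext (ip_coef Lphi Lpsi) => N; apply: eq_bigr => n _.
apply: (etrans _ (esym (congr2 (fun c d => qconj c * d) (c1 n) (c2 n)))).
rewrite qconjM -mulrA [qconj (theta ^+ n) * _]mulrA qconj_mul qnormX theta1.
by rewrite !expr1n mulr_algl scale1r.
Qed.

(** The preimage has the coefficients [qconj (theta ^+ n) * coef psi n]. *)
Lemma Ltilde_onto psi : `|theta| = 1 -> L2 alpha psi ->
  exists2 phi, L2 alpha phi & aeq (Lt phi) psi.
Proof.
move=> theta1 Lpsi; pose c n := qconj (theta ^+ n) * coef psi n.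
have cc : cvgn (series (fun n => `|c n| ^+ 2)).
  rewrite (_ : (fun n => _) = fun n => `|coef psi n| ^+ 2).
    exact: sum_sqr_qcoef.
  by apply/funext => n; rewrite /c qnormM qnorm_conj qnormX theta1 expr1n mul1r.
have [F Fc] := qexpansion_exists alpha_gt0 cc; have LF := qexpansion_L2 Fc.
exists F => //; have [L1 c1 _ _] := Ltilde_spec LF.
apply: (qcoef_inj alpha_gt0 L1 Lpsi) => n.
rewrite (etrans (c1 n) (congr1 (fun d => theta ^+ n * d) (qcoef_expansion alpha_gt0 Fc n))).
rewrite /c mulrA.
have -> : theta ^+ n * qconj (theta ^+ n) = 1.
  have cK (q : H) : qconj (qconj q) = q by case: q => *; congr Quat; rewrite /= opprK.
  by rewrite -{1}[theta ^+ n]cK qconj_mul qnorm_conj qnormX theta1 !expr1n scale1r.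
by rewrite mul1r.
Qed.

Section IntegralKernel.
Hypothesis theta_lt1 : `|theta| < 1.

Let part (p : H -> R) N (xy : R * R) : R :=
  series (fun n => p (theta ^+ n) * (e n xy.1 * e n xy.2)) N.

(** The kernel [sum_n e n x * e n y * theta ^+ n], made measurable in the two variables
    by taking upper limits of its components. *)
Let K (x y : R) : H := Quat (esup_limit (part (@qre R)) (x, y))
  (esup_limit (part (@qi R)) (x, y)) (esup_limit (part (@qj R)) (x, y))
  (esup_limit (part (@qk R)) (x, y)).

Let measurable_K (p : H -> R) :
  measurable_fun setT (fun xy : R * R => esup_limit (part p) (xy.1, xy.2)).
Proof.
have -> : (fun xy : R * R => esup_limit (part p) (xy.1, xy.2)) = esup_limit (part p).
  by apply/funext => -[].
apply: measurable_esup_limit => N; apply: measurable_sum => n.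
have me m : measurable_fun setT (e m) by apply: measurable_funM => //; exact: measurable_poly.
apply: measurable_funM => //; apply: measurable_funM.
  by apply: measurableT_comp => //; exact: measurable_fst.
by apply: measurableT_comp => //; exact: measurable_snd.
Qed.

Let theta01 : 0 <= `|theta| < 1. Proof. by rewrite normr_ge0. Qed.

Let cvg_part (p : H -> R) x y : (forall q, `|p q| <= `|q|) ->
  part p N (x, y) @[N --> \oo] --> esup_limit (part p) (x, y).
Proof.
move=> pq; have sub := subexpM (subexp_laguerre_on alpha_gt0 x) (subexp_laguerre_on alpha_gt0 y).
have : cvgn (series (fun n => p (theta ^+ n) * (e n x * e n y))).
  apply: normed_cvg; apply: series_le_cvg (subexp_summable sub theta01) => n /=.
  - exact: normr_ge0.
  - by rewrite mulr_ge0// exprn_ge0.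
  by rewrite normrM mulrC ler_wpM2l// -qnormX.
by move=> /cvg_ex[l cl]; rewrite (esup_limit_cvg (u := part p) (x := (x, y)) cl).
Qed.

Let K_cvg x y : series (fun n => e n y *: (e n x *: theta ^+ n)) N @[N --> \oo] --> K x y.
Proof.
have c4 q := qcomp_le (q : H).
have E (p : H -> R) : (forall (a : R) q, p (a *: q) = a * p q) ->
    (forall q, `|p q| <= `|q|) ->
    series (p \o (fun n => e n y *: (e n x *: theta ^+ n))) N @[N --> \oo] -->
      esup_limit (part p) (x, y).
  move=> pZ pq; have h := @cvg_part p x y pq.
  apply: (cvgn_ext _ h) => N; apply: eq_bigr => n _.
  by rewrite /= !pZ; ring.
by apply: qseries_cvg; apply: E => // q; have [] := c4 q.
Qed.

Let K_qexpansion x : qexpansion alpha (K x) (fun n => e n x *: theta ^+ n).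
Proof.
have [s s01 [C C0 hC]] := subexp_geometric (subexp_laguerre_on alpha_gt0 x) theta01.
apply: (qexpansion_pointwise alpha_gt0 s01) => [n|y _]; last exact: K_cvg.
by rewrite normrZ qnormX; exact: hC.
Qed.

(** Pairing [K x] with [phi] gives [sum_n e n x *: (theta ^+ n * coef phi n)]: this
    series converges at every [x], and its sum has the coefficients of the image
    of [phi]. *)
Lemma Ltilde_kernel : kernel_operator alpha Lt.
Proof.
exists K; split; first by split; exact: measurable_K.
move=> phi Lphi; have [LT cT _ _] := Ltilde_spec Lphi.
pose S x := qintegral (@Rpos R) (fun y => w y *: (K x y * phi y)).
have KS x := qexpansion_integral (K_qexpansion x) Lphi.
pose b n := theta ^+ n * coef phi n.
have [M hM] : exists M, forall n, `|coef phi n| <= M.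
  have c0 := cvg_series_cvg_0 (sum_sqr_qcoef alpha_gt0 Lphi).
  have /cvg_seq_bounded[M0 [_ /(_ (M0 + 1))]] : cvgn (fun n => `|coef phi n| ^+ 2).
    by apply/cvg_ex; exists 0.
  rewrite ltrDl ltr01 => /(_ isT) h; exists (1 + (M0 + 1)) => n.
  have := h n I; rewrite /= ger0_norm ?sqr_ge0//.
  by have := normr_ge0 (coef phi n); move: `|coef phi n| => x; nra.
have SE : qexpansion alpha S b.
  apply: (qexpansion_pointwise alpha_gt0 theta01 (C := M)) => [n|x _].
    by rewrite qnormM qnormX mulrC ler_wpM2r ?exprn_ge0.
  have [_ h] := KS x; rewrite /S; apply: (cvgn_ext _ h) => N; apply: eq_bigr => n _.
  by rewrite -scalerAl.
have : aeq (Lt phi) S.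
  apply: (qcoef_inj alpha_gt0 LT (qexpansion_L2 SE)) => n.
  exact: etrans (cT n) (esym (qcoef_expansion alpha_gt0 SE n)).
apply: (@filterS _ _ (ae_filter_ringOfSetsType mu)) => x TS x0.
by split; [have [] := KS x | exact: TS].
Qed.

End IntegralKernel.
End Conjugate.

Theorem proposition3p1 (R : realType) (alpha : R) (theta : quat R)
    (halpha : 0 < alpha) (htheta : `|theta| <= 1) :
  [/\ (forall phi : R -> quat R, L2 alpha phi ->
         [/\ bergman alpha (bargmann alpha phi),
             bergman alpha (Gamma_act theta (bargmann alpha phi)),
             L2 alpha (Ltilde alpha theta phi) &
             {in @qball R, bargmann alpha (Ltilde alpha theta phi)
                             =1 Gamma_act theta (bargmann alpha phi)}]),
      right_linear alpha (Ltilde alpha theta),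
      L2_continuous alpha (Ltilde alpha theta),
      (opnorm alpha (Ltilde alpha theta) <= 1)%E &
      (`|theta| < 1 -> kernel_operator alpha (Ltilde alpha theta)) /\
      (`|theta| = 1 ->
         (forall psi : R -> quat R, L2 alpha psi ->
            exists2 phi : R -> quat R,
              L2 alpha phi & aeq (Ltilde alpha theta phi) psi) /\
         (forall phi psi : R -> quat R, L2 alpha phi -> L2 alpha psi ->
            ip alpha (Ltilde alpha theta phi) (Ltilde alpha theta psi)
            = ip alpha phi psi))].
Proof.
split.
- move=> phi Lphi; have [LT cT TE GE] := Ltilde_spec halpha htheta Lphi.
  split=> //.
    exact: bergman_expands (sum_sqr_qcoef halpha Lphi) (bargmann_expands halpha Lphi).
  exact: bergman_expands (theta_summable halpha htheta Lphi) GE.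
- exact: Ltilde_right_linear.
- move=> phi Lphi eps eps0; exists eps => // psi Lpsi; apply: le_lt_trans.
  exact: Ltilde_lipschitz.
- apply: ge_ereal_sup => _ [phi [Lphi phi1] <-]; rewrite lee_fin.
  by apply: le_trans phi1; exact: Ltilde_norm.
split=> [theta1|theta1]; first exact: Ltilde_kernel.
split=> [psi Lpsi|phi psi Lphi Lpsi]; first exact: Ltilde_onto.
exact: Ltilde_isometry.
Qed.
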